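(* Let $V\colon\mathbb R\to\mathbb R$ be Lebesgue measurable with $\int_{\mathbb R}|V(x)-V_\infty|\,dx<\infty$ for some constant $V_\infty>0$, and suppose $0\in\sigma_{\rm d}(H)$, where $H$ is the self-adjoint realization of $-\frac{d^2}{dx^2}+V$ in $L^2(\mathbb R;dx)$. Then $${\det}_{L^2(\mathbb R;dx)}\big(I_{L^2(\mathbb R;dx)}-P_0-K_0\big)=\frac{-1}{2V_\infty^{1/2}}\int_{\mathbb R}dx\,[V(x)-V_\infty]\,e^{\pm V_\infty^{1/2}x}\,\psi_\pm(x),$$ where $\psi_\pm$ are defined by $$\psi_\pm(x)=-\Psi_\pm(0,x)-\frac1{V_\infty^{1/2}}\int_x^{\pm\infty}dx'\,\sinh\big(V_\infty^{1/2}(x-x')\big)\,[V(x')-V_\infty]\,\psi_\pm(x'),\quad x\in\mathbb R.$$ (The equations for the $+$ and $-$ signs are to be read separately; both hold.)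
   Context: $H$ is the operator $Hf=-f''+Vf$ with domain $\{g\in L^2(\mathbb R)\,|\,g,g'\in AC_{\rm loc}(\mathbb R),\ -g''+Vg\in L^2(\mathbb R)\}$; it is self-adjoint with $\sigma_{\rm ess}(H)=[V_\infty,\infty)$, and $\sigma_{\rm d}(H)$ is its discrete spectrum. $H^{(0)}=-\frac{d^2}{dx^2}+V_\infty$ with domain $H^2(\mathbb R)$. $W=V-V_\infty$, $v=|W|^{1/2}$, $u=\operatorname{sgn}(W)\,v$. $K_0=-\overline{u(H^{(0)})^{-1}v}$ (operator closure), i.e. the trace class operator on $L^2(\mathbb R;dx)$ with integral kernel $-u(x)\frac{e^{-V_\infty^{1/2}|x-x'|}}{2V_\infty^{1/2}}v(x')$. When $0\in\sigma_{\rm d}(H)$, $1$ is a simple eigenvalue of $K_0$, and $P_0$ is the corresponding one-dimensional Riesz projection of $K_0$. Explicitly, if $\Psi_0$ is a real-valued function spanning $\ker H$, then $P_0f=\big[\int_{\mathbb R}W\Psi_0^2\,dx\big]^{-1}\big(\int_{\mathbb R}v\Psi_0f\,dx\big)\,u\Psi_0$. ${\det}_{L^2}$ is the Fredholm determinant. The Jost solutions at $z=0$ are the solutions $\Psi_\pm(0,\cdot)$, with $e^{\pm V_\infty^{1/2}x}\Psi_\pm(0,x)$ bounded on $\mathbb R$, of the Volterra equations $$\Psi_\pm(0,x)=e^{\mp V_\infty^{1/2}x}-\frac1{V_\infty^{1/2}}\int_x^{\pm\infty}dx'\,\sinh\big(V_\infty^{1/2}(x-x')\big)[V(x')-V_\infty]\Psi_\pm(0,x').$$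 Likewise, $\psi_\pm$ is the unique solution of its Volterra equation for which $e^{\pm V_\infty^{1/2}x}\psi_\pm(x)$ is bounded on $\mathbb R$. *)

(* Defs.v *)
From HB Require Import structures.
From mathcomp Require Import all_boot all_order all_algebra.
From mathcomp Require Import all_classical all_reals all_analysis.
From mathcomp Require Import complex.
Set Implicit Arguments.
Unset Strict Implicit.
Unset Printing Implicit Defensive.
Import Order.TTheory GRing.Theory Num.Theory.
Import numFieldNormedType.Exports.
Local Open Scope classical_set_scope.
Local Open Scope ring_scope.
Local Open Scope complex_scope.

(* The completed measure is used so that "measurable" means Lebesgue (and not
   Borel) measurable; its sigma-algebra lives on an alias of R. *)
Notation leb R := (@completed_lebesgue_measure R).
Notation lebT R := (caratheodory_type
  (mu_ext (wlength (idfun : cumulative R R)))).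

Section L2.
Context {R : realType}.
Implicit Types f g : R -> R[i].

Definition cintegral f : R[i] :=
  (\int[leb R]_x complex.Re (f x)) +i* (\int[leb R]_x complex.Im (f x)).

(* Elements of L^2 are represented by functions; all the notions below are
   invariant under modification on null sets. *)
Definition L2 f : Prop :=
  [/\ measurable_fun [set: lebT R] (fun x : lebT R => complex.Re (f x)),
      measurable_fun [set: lebT R] (fun x : lebT R => complex.Im (f x)) &
      (leb R).-integrable setT
        (fun x => ((Normc.normc (f x)) ^+ 2)%:E)].

Definition ae_equal f g : Prop := {ae leb R, forall x, f x = g x}.

Definition inner f g : R[i] := cintegral (fun x => (f x)^* * g x).

Definition norm2 f : R :=
  Num.sqrt (\int[leb R]_x (Normc.normc (f x)) ^+ 2).

Definition ccvg (s : nat -> R[i]) (l : R[i]) : Prop :=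
  (fun n => complex.Re (s n)) @ \oo --> complex.Re l /\
  (fun n => complex.Im (s n)) @ \oo --> complex.Im l.

Definition orthonormal (e : nat -> R -> R[i]) : Prop :=
  (forall i, L2 (e i)) /\ (forall i j, inner (e i) (e j) = (i == j)%:R).

Definition orthonormal_basis (e : nat -> R -> R[i]) : Prop :=
  orthonormal e /\
  forall f, L2 f ->
    (fun n => norm2 (fun x => f x - \sum_(i < n) inner (e i) f * e i x))
      @ \oo --> (0 : R).

End L2.

Section Operators.
Context {R : realType}.
Implicit Types T A : (R -> R[i]) -> (R -> R[i]).

Definition bounded_operator A : Prop :=
  [/\ forall f, L2 f -> L2 (A f),
      forall (a : R[i]) f g, L2 f -> L2 g ->
        ae_equal (A (fun x => a * f x + g x)) (fun x => a * A f x + A g x) &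
      exists M : R, forall f, L2 f -> norm2 (A f) <= M * norm2 f].

(* A bounded operator is trace class iff its matrix diagonal with respect to
   any two orthonormal sequences is absolutely summable. *)
Definition trace_class A : Prop :=
  bounded_operator A /\
  forall e f : nat -> R -> R[i], orthonormal e -> orthonormal f ->
    (\sum_(0 <= n <oo) (Normc.normc (inner (e n) (A (f n))))%:E
       < +oo)%E.

(* Partial sums of Tr(Lambda^k A) in the orthonormal basis
   (e_{i_1} /\ ... /\ e_{i_k})_{i_1 < ... < i_k} of the k-th exterior power, in
   which the diagonal coefficients of Lambda^k A are k x k minors. *)
Definition exterior_trace A (e : nat -> R -> R[i]) (k N : nat) : R[i] :=
  \sum_(i : {ffun 'I_k -> 'I_N} |
         [forall a : 'I_k, forall b : 'I_k, (a < b)%N ==> (i a < i b)%N])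
    \det (\matrix_(a < k, b < k) inner (e (i a)) (A (e (i b)))).

(* det(T) = sum_k Tr(Lambda^k A) for T = I + A with A trace class. *)
Definition is_fredholm_det T (d : R[i]) : Prop :=
  let A := fun f x => T f x - f x in
  trace_class A /\
  forall e, orthonormal_basis e ->
    exists c : nat -> R[i],
      (forall k, ccvg (exterior_trace A e k) (c k)) /\
      ccvg (fun n => \sum_(k < n) c k) d.

End Operators.

Section Spectrum.
Context {R : realType}.

(* An unbounded operator is given by its graph: [H g h] means that g is in the
   domain of H and H g = h. *)
Implicit Types H : (R -> R[i]) -> (R -> R[i]) -> Prop.

Definition resolvent_set H (z : R[i]) : Prop :=
  (forall f, L2 f ->
     exists g h, H g h /\ ae_equal (fun x => h x - z * g x) f) /\
  (exists M : R, forall g h, H g h ->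
     norm2 g <= M * norm2 (fun x => h x - z * g x)).

Definition spectrum H (z : R[i]) : Prop := ~ resolvent_set H z.

Definition eigenvector H (z : R[i]) (g : R -> R[i]) : Prop :=
  H g (fun x => z * g x).

(* H being self-adjoint in the application, the multiplicity of an isolated
   eigenvalue is the dimension of its eigenspace. *)
Definition discrete_spectrum H (z : R[i]) : Prop :=
  [/\ spectrum H z,
      exists2 eps : R, 0 < eps &
        forall w, w != z -> Normc.normc (w - z) < eps ->
          resolvent_set H w,
      exists2 g, eigenvector H z g & ~ ae_equal g (fun=> 0) &
      exists (n : nat) (b : 'I_n -> R -> R[i]),
        forall g, eigenvector H z g ->
          exists c : 'I_n -> R[i],
            ae_equal g (fun x => \sum_(i < n) c i * b i x)].

End Spectrum.

Section Schrodinger.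
Context {R : realType}.
Implicit Types (V g : R -> R) (Vinf : R).

Definition abs_cont (a b : R) g : Prop :=
  forall eps : R, 0 < eps -> exists2 delta : R, 0 < delta &
    forall (n : nat) (s t : 'I_n -> R),
      (forall i, a <= s i /\ s i <= t i /\ t i <= b) ->
      (forall i j, i != j -> t i <= s j \/ t j <= s i) ->
      \sum_(i < n) (t i - s i) < delta ->
      \sum_(i < n) `|g (t i) - g (s i)| < eps.

Definition AC_loc g : Prop := forall a b : R, abs_cont a b g.

(* g and g' are locally absolutely continuous, so g'' exists a.e., and
   -g'' + V g = h a.e. *)
Definition schrodinger_eq V g (h : R -> R) : Prop :=
  [/\ AC_loc g, (forall x : R, derivable g x 1), AC_loc (derive1 g) &
      {ae leb R, forall x : R,
         derivable (derive1 g) x 1 /\ h x = - derive1 (derive1 g) x + V x * g x}].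

Definition schrodinger V (g h : R -> R[i]) : Prop :=
  [/\ L2 g, L2 h,
      schrodinger_eq V (fun x => complex.Re (g x)) (fun x => complex.Re (h x)) &
      schrodinger_eq V (fun x => complex.Im (g x)) (fun x => complex.Im (h x))].

Definition spans_kernel V (Psi0 : R -> R) : Prop :=
  schrodinger V (fun x => (Psi0 x)%:C) (fun=> 0) /\
  forall g : R -> R[i], schrodinger V g (fun=> 0) ->
    exists c : R[i], ae_equal g (fun x => c * (Psi0 x)%:C).

Definition potW V Vinf (x : R) : R := V x - Vinf.
Definition potv V Vinf (x : R) : R := Num.sqrt `|potW V Vinf x|.
Definition potu V Vinf (x : R) : R := Num.sg (potW V Vinf x) * potv V Vinf x.

(* - closure(u (H^(0))^-1 v), where (H^(0))^-1 has the Green's function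
   e^{-k|x-y|}/(2k), k = Vinf^{1/2}, as integral kernel. *)
Definition K0 V Vinf (f : R -> R[i]) (x : R) : R[i] :=
  let k := Num.sqrt Vinf in
  cintegral (fun y =>
    (- potu V Vinf x * (expR (- k * `|x - y|) / (2 * k)) * potv V Vinf y)%:C
      * f y).

(* The Riesz projection of K0 for its simple eigenvalue 1, when Psi0 spans
   ker H: u Psi0 and v Psi0 are eigenvectors of K0 and of its adjoint. *)
Definition P0 V Vinf (Psi0 : R -> R) (f : R -> R[i]) (x : R) : R[i] :=
  ((\int[leb R]_y (potW V Vinf y * Psi0 y ^+ 2))^-1)%:C
  * cintegral (fun y => (potv V Vinf y * Psi0 y)%:C * f y)
  * (potu V Vinf x * Psi0 x)%:C.

Inductive side := Plus | Minus.

Definition side_sg (s : side) : R := if s is Plus then 1 else -1.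

Definition sinh (x : R) : R := (expR x - expR (- x)) / 2.

(* The oriented integral from x to +oo, resp. from x to -oo. *)
Definition integral_to (s : side) (x : R) (f : R -> R) : R :=
  if s is Plus then \int[leb R]_(y in [set y : R | x <= y]) f y
  else - \int[leb R]_(y in [set y : R | y <= x]) f y.

Definition volterra_solution V Vinf (s : side) (f0 Y : R -> R) : Prop :=
  let k := Num.sqrt Vinf in
  [/\ measurable_fun [set: lebT R] (Y : lebT R -> R),
      exists M : R, forall x, `|expR (side_sg s * k * x) * Y x| <= M &
      forall x, Y x = f0 x - k^-1 * integral_to s x
        (fun y => sinh (k * (x - y)) * potW V Vinf y * Y y)].

Definition jost_at_0 V Vinf (s : side) (Psi : R -> R) : Prop :=
  volterra_solution V Vinf s
    (fun x => expR (- side_sg s * Num.sqrt Vinf * x)) Psi.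

End Schrodinger.

(* Main.v *)
(** Put k = Vinf^{1/2}, W = V - Vinf, w = W / (2k) and let g be the integral
    operator with kernel e^{-k|x-y|} / (2k), so that M := - K0 = u g v.

    Traces. The coefficients e_n(M_N) of det(1 + z M_N) for the sections M_N of
    M are computed by Jacobi's formula n e_n(M_N) = tr (M_N C_{n-1}), where
    C_n = e_n(M_N) - M_N C_{n-1}. As g(x, y) = \int l(x, t) l(y, t) dt with
    l(x, t) = e^{-k(t-x)} for x <= t, the trace is an integral over t that passes
    to the limit by dominated convergence. The limits F_n satisfy
    n F_n = \int W(x) p_{n-1}(x, x) dx with p_n = F_n g - g W p_{n-1}, and this
    recursion is solved by p_n(x, y) = g(x, y) \sum_{i+j=n} b_j(min) a_i(max),
    where a_i and b_j are the terms of the Neumann series of the two Jost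
    solutions, with F_{n+1} = \int w a_n = \int w b_n.

    Rank one perturbation. P0 = q p^T with M q = - q and p^T q = 1. From
    e_n(M_N - q p^T) = e_n(M_N) - p^T C_{n-1} q one gets
    Tr Lambda^n (- P0 - K0) = F_n - S_n, where S_n = F_0 + ... + F_{n-1}.

    Zero energy. Psi0 is bounded and Psi0 = - g W Psi0. Integrating the recursion
    for p_n against W Psi0 gives S_n -> 0, and \int W Psi0^2 is minus the squared
    norm of the half-line transform of W Psi0, hence is not zero.

    Summation. y = e^{+-kx} Psi satisfies y = 1 + T y and phi = e^{+-kx} psi
    satisfies phi = - y + T phi for a Volterra operator T. With
    r_n = \int w T^n y the first equation gives S_{n+1} = - r_n, and the second
    gives \sum_n r_n = - \int w phi; hence
    \sum_n (F_n - S_n) = \sum_n r_n = - \int w phi. *)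
Require Import Defs.
From mathcomp Require Import all_boot all_order all_algebra.
From mathcomp Require Import all_classical all_reals all_analysis.
From mathcomp Require Import complex.
From mathcomp Require Import measurable_realfun perm ring lra zify.
Set Implicit Arguments.
Unset Strict Implicit.
Unset Printing Implicit Defensive.
Import Order.TTheory GRing.Theory Num.Theory.
Import numFieldNormedType.Exports.
Local Open Scope classical_set_scope.
Local Open Scope ring_scope.
Local Open Scope complex_scope.

(** * Sums of principal minors *)

(** Put D(z) = \sum_n F_n z^n, the determinant of I - z K0. Since (I + z M)^-1 q = q / (1 - z), the
    perturbed determinant is formally D(z) - z D(z) / (1 - z). At zero energy D(1) = 0, so its value
    at z = 1 is the derivative D'(1). With y_z = 1 + z T y_z one has D(z) = 1 + z \int w y_z, and
    the derivative of z y_z at z = 1 solves chi = y + T chi; it is therefore - phi, which is where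
    psi comes from. The moments r_n carry out this differentiation on coefficients. The definition
    of the determinant speaks of limits of minors of finite sections in an arbitrary orthonormal
    basis. The obstacle is that strong convergence of the sections does not by itself give
    convergence of their traces. Factoring g through the half-line kernel l writes each trace as an
    integral over t of inner products of L^2 functions: strong convergence applies for each t, and a
    multiple of \int |W(x)| l(x, t)^2 dx, independent of the section, dominates. *)

Lemma deriv_prod (F : comNzRingType) (I : eqType) (r : seq I) (f : I -> {poly F}) :
  uniq r -> (\prod_(i <- r) f i)^`() =
    \sum_(i <- r) (f i)^`() * \prod_(j <- r | j != i) f j.
Proof.
elim: r => [|a r IH] /=; first by rewrite !big_nil derivC.
move=> /andP[ar ur]; rewrite !big_cons derivM IH // eqxx /=; congr (_ * _ + _).
  by rewrite big_seq [RHS]big_seq_cond; apply: eq_bigl => j;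
    have [->|] := eqVneq j a; rewrite ?(negbTE ar) //= andbT.
rewrite big_distrr /= big_seq [RHS]big_seq; apply: eq_bigr => i ir.
rewrite big_cons; case: (eqVneq a i) => [ai|_]; first by rewrite ai ir in ar.
by rewrite mulrCA.
Qed.

(** This is [char_poly_mx (- A)]; the sign is chosen so that the coefficients of its determinant are
    the sums of principal minors without alternating signs. *)
Definition pencil (F : comNzRingType) (n : nat) (A : 'M[F]_n) : 'M[{poly F}]_n :=
  'X%:M + map_mx polyC A.

(** Jacobi's formula. The variable occurs only on the diagonal, so differentiating the i-th factor
    of the Leibniz expansion keeps the permutations that fix i, and these form the (i, i)
    cofactor. *)
Lemma deriv_det_pencil (F : comNzRingType) (n : nat) (A : 'M[F]_n) :
  (\det (pencil A))^`() = \tr (\adj (pencil A)).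
Proof.
rewrite /mxtrace [in LHS]/determinant.
rewrite (big_morph _ (@derivD F) (@deriv0 F)).
transitivity (\sum_(i < n) \sum_(s : 'S_n | s i == i)
   (-1) ^+ s * \prod_(k | i != k) pencil A k (s k)); last first.
  by apply: eq_bigr => i _; rewrite mxE expand_cofactor.
rewrite (exchange_big_dep predT) //=; apply: eq_bigr => s _.
rewrite -signr_odd (_ : (-1) ^+ odd s = ((-1) ^+ odd s)%:P); last first.
  by rewrite rmorphXn /= rmorphN1.
rewrite deriv_mulC deriv_prod ?index_enum_uniq // big_distrr /= [RHS]big_mkcond /=.
apply: eq_bigr => i _; rewrite !mxE derivD derivC addr0 derivMn derivX.
rewrite eq_sym; case: (s i == i); rewrite ?mulr0n ?mul0r ?mulr0 // mulr1n mul1r.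
by rewrite rmorphXn /= rmorphN1; congr (_ * _); apply: eq_bigl => j; rewrite eq_sym.
Qed.

Definition incr (k N : nat) (f : {ffun 'I_k -> 'I_N}) : bool :=
  [forall a : 'I_k, forall b : 'I_k, (a < b)%N ==> (f a < f b)%N].

(** The trace of the k-th exterior power of A, in the shape of [exterior_trace]: increasing maps
    stand for the k-element sets of indices. *)
Definition minor_sum (F : comNzRingType) (N : nat) (A : 'M[F]_N) (k : nat) : F :=
  \sum_(f : {ffun 'I_k -> 'I_N} | incr f) \det (\matrix_(a < k, b < k) A (f a) (f b)).

Lemma incrP (k N : nat) (f : {ffun 'I_k -> 'I_N}) :
  reflect (forall a b : 'I_k, (a < b)%N -> (f a < f b)%N) (incr f).
Proof.
apply: (iffP forallP) => H a; first by move=> b; move/forallP: (H a) => /(_ b)/implyP.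
by apply/forallP => b; apply/implyP/H.
Qed.

Lemma incr_inj (k N : nat) (f : {ffun 'I_k -> 'I_N}) : incr f -> injective f.
Proof.
move=> /incrP H a b ab; apply/val_inj/eqP.
by case: (ltngtP (val a) (val b)) => // /H; rewrite ab ltnn.
Qed.

(** Strict growth gives [f a + d <= f (a + d)]; applied from 0 up to a, and from a up to the last
    index, it bounds [f a] on both sides by a. *)
Lemma incr_id (N : nat) (f : {ffun 'I_N -> 'I_N}) : incr f = (f == [ffun i => i]).
Proof.
apply/idP/eqP => [/incrP H|->]; last by apply/incrP => a b; rewrite !ffunE.
have gap (d : nat) : forall a b : 'I_N, val b = (a + d)%N -> (f a + d <= f b)%N.
  elim: d => [|d IH] a b; first by rewrite !addn0 => /val_inj ->.
  move=> bE; have cN : (a + d < N)%N by rewrite (leq_ltn_trans _ (ltn_ord b)) // bE; lia.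
  have := IH a (Ordinal cN) erefl.
  have /H : (Ordinal cN < b)%N by rewrite /= bE; lia.
  by lia.
apply/ffunP => a; rewrite ffunE; apply/val_inj => /=.
case: N f H gap a => [|N] f H gap a; first by case: a.
have := gap a ord0 a erefl; have := gap (N - a)%N a ord_max.
have := ltn_ord a; have := ltn_ord (f ord_max) => /= h1 h2.
move=> /(_ ltac:(lia)) h3 h4; lia.
Qed.

Lemma minor_sum_full (F : comNzRingType) (N : nat) (A : 'M[F]_N) :
  minor_sum A N = \det A.
Proof.
rewrite /minor_sum (eq_bigl _ _ (@incr_id N)) big_pred1_eq; congr (\det _).
by apply/matrixP => i j; rewrite !mxE !ffunE.
Qed.

Lemma minor_sum0 (F : comNzRingType) (N : nat) (A : 'M[F]_N) : minor_sum A 0 = 1.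
Proof.
rewrite /minor_sum (eq_bigl predT); last by move=> f; apply/incrP => -[].
rewrite (eq_bigr (fun=> 1)); last by move=> f _; rewrite det_mx00.
by rewrite sumr_const card_ffun !card_ord expn0.
Qed.

Lemma minor_sum_gt (F : comNzRingType) (N : nat) (A : 'M[F]_N) (k : nat) :
  (N < k)%N -> minor_sum A k = 0.
Proof.
move=> Nk; rewrite /minor_sum big_pred0 // => f; apply/negP => /incr_inj /leq_card.
by rewrite !card_ord leqNgt Nk.
Qed.

(** Double counting: a principal minor of size k survives the deletion of index i exactly when i is
    not one of its k indices, so it is counted N + 1 - k times. *)
Lemma minor_sum_row'_col' (F : comNzRingType) (N : nat) (A : 'M[F]_N.+1) (k : nat) :
  \sum_i minor_sum (row' i (col' i A)) k = (N.+1 - k)%:R * minor_sum A k.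
Proof.
transitivity (\sum_(i < N.+1) \sum_(f : {ffun 'I_k -> 'I_N.+1} | incr f && (i \notin codom f))
   \det (\matrix_(a < k, b < k) A (f a) (f b))).
  apply: eq_bigr => i _.
  pose h (f : {ffun 'I_k -> 'I_N}) := [ffun a => lift i (f a)].
  have hinj : injective h.
    by move=> f g /ffunP fg; apply/ffunP => a; have := fg a; rewrite !ffunE => /lift_inj.
  transitivity (\sum_(f in h @: [set f | incr f]%SET)
      \det (\matrix_(a < k, b < k) A (f a) (f b))).
    rewrite big_imset /=; last by move=> f g _ _; exact: hinj.
    apply: eq_big => f; first by rewrite inE.
    by move=> _; congr (\det _); apply/matrixP => a b; rewrite !mxE !ffunE.
  apply: eq_bigl => f; apply/imsetP/andP => [[g]|[/incrP H iN]]; last first.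
    have ex a : exists b, f a = lift i b.
      have : i != f a by apply: contraNneq iN => ->; exact: codom_f.
      by move=> /unlift_some[b -> _]; exists b.
    have [g gE] := fin_all_exists ex; exists [ffun a => g a]; last first.
      by apply/ffunP => a; rewrite !ffunE.
    rewrite inE; apply/incrP => a b ab; rewrite !ffunE.
    by have := H _ _ ab; rewrite !gE /= !ltnNge leq_bump2.
  rewrite inE => /incrP H ->; split.
    by apply/incrP => a b /H; rewrite !ffunE /= !ltnNge leq_bump2.
  apply/negP => /codomP[a]; rewrite ffunE => /eqP; exact/negP/neq_lift.
rewrite (exchange_big_dep (fun f : {ffun _} => incr f)) /=; last by move=> i f _ /andP[].
rewrite /minor_sum big_distrr /=; apply: eq_bigr => f fi.
rewrite fi /= sumr_const mulr_natl; congr (_ *+ _).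
have := cardC (mem (codom f)); rewrite card_codom; last exact: incr_inj.
rewrite !card_ord => /(congr1 (subn^~ k)); rewrite addKn => <-.
by apply: eq_card => j; rewrite !inE.
Qed.

(** Induction on j by differentiation: the derivative is the sum of the determinants of the pencils
    with one index deleted. The multiplicity of minors of size N - j in [minor_sum_row'_col'] is
    exactly the factor j + 1 from the derivative, which cancels in characteristic 0. *)
Lemma coef_det_pencil (F : numFieldType) (j N : nat) (A : 'M[F]_N) :
  (j <= N)%N -> (\det (pencil A))`_j = minor_sum A (N - j).
Proof.
elim: j N A => [|j IH] N A jN.
  rewrite subn0 minor_sum_full -horner_coef0 -[RHS]/(\det A).
  have -> : (\det (pencil A)).[0] = horner_eval 0 (\det (pencil A)) by [].
  rewrite -det_map_mx; congr (\det _); apply/matrixP => a b.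
  by rewrite !mxE /= /horner_eval hornerD hornerC hornerMn hornerX mul0rn add0r.
case: N A jN => // N A; rewrite ltnS => jN; rewrite subSS.
have j0 : j.+1%:R != 0 :> F by rewrite pnatr_eq0.
apply: (mulfI j0); rewrite mulr_natl -coef_deriv deriv_det_pencil coef_sum.
rewrite -(_ : (N.+1 - (N - j))%N = j.+1); last by rewrite subSn ?leq_subr // subKn.
rewrite -minor_sum_row'_col'; apply: eq_bigr => i _.
rewrite mxE /cofactor addnn -signr_odd odd_double expr0 mul1r.
rewrite -IH //; congr (polyseq (\det _))`_j; apply/matrixP => a b.
by rewrite !mxE (inj_eq lift_inj).
Qed.

(* Faddeev-LeVerrier: these are the coefficients of the powers of z in
   \adj (1 + z A). *)
Fixpoint adj_coef (F : comNzRingType) (N : nat) (A : 'M[F]_N) (n : nat) : 'M[F]_N :=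
  if n is n'.+1 then (minor_sum A n)%:M - A *m adj_coef A n' else 1%:M.

Definition adj_pencil_coef (F : comNzRingType) (N : nat) (A : 'M[F]_N) (j : nat) : 'M[F]_N :=
  \matrix_(a, b) ((\adj (pencil A)) a b)`_j.

(** The coefficient of degree j in (X + A) \adj (X + A) = \det (X + A). *)
Lemma adj_pencil_coef_rec (F : comNzRingType) (N : nat) (A : 'M[F]_N) (j : nat) :
  (if j is j'.+1 then adj_pencil_coef A j' else 0) + A *m adj_pencil_coef A j =
    ((\det (pencil A))`_j)%:M.
Proof.
apply/matrixP => a b; rewrite !mxE.
rewrite -[_ *+ _]coefMn; have -> : \det (pencil A) *+ (a == b) =
    (pencil A *m \adj (pencil A)) a b by rewrite mul_mx_adj !mxE.
rewrite /pencil mulmxDl mul_scalar_mx 2!mxE coefD; congr (_ + _); last first.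
  by rewrite mxE coef_sum; apply: eq_bigr => i _; rewrite !mxE coefCM.
by case: j => [|j]; rewrite ?mxE mulrC coefMX.
Qed.

(** The coefficients vanish beyond the largest degree J of a cofactor. Above degree N the right side
    of the recursion is zero, which carries the vanishing down from J to N. *)
Lemma adj_pencil_coef_ge (F : comNzRingType) (N : nat) (A : 'M[F]_N) (j : nat) :
  (N <= j)%N -> adj_pencil_coef A j = 0.
Proof.
have szdet : size (\det (pencil A))%R = N.+1.
  have -> : pencil A = char_poly_mx (- A).
    by apply/matrixP => a b; rewrite !mxE rmorphN opprK.
  by rewrite -/(char_poly _) size_char_poly.
have szN i : (N < i)%N -> (\det (pencil A))`_i = 0.
  by move=> Ni; apply: nth_default; rewrite szdet.
pose J := (\max_(a < N) \max_(b < N) size (\adj (pencil A) a b)%R)%N.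
have top i : (J <= i)%N -> adj_pencil_coef A i = 0.
  move=> Ji; apply/matrixP => a b; rewrite mxE [RHS]mxE; apply: nth_default.
  apply: leq_trans Ji; apply: leq_trans (leq_bigmax a).
  by apply: (leq_bigmax (F := fun b => size (\adj (pencil A) a b)%R) b).
suff down d : forall i, (N <= i)%N -> (J <= i + d)%N -> adj_pencil_coef A i = 0.
  by move=> Nj; apply: (down J) => //; rewrite leq_addl.
elim: d => [|d IH] i Ni; first by rewrite addn0; exact: top.
rewrite addnS -addSn => /(IH i.+1 (leqW Ni)) B0.
have := adj_pencil_coef_rec A i.+1; rewrite B0 mulmx0 addr0 => ->.
by rewrite szN ?ltnS // raddf0.
Qed.

(** Passing from 1 + z A to X + A reverses the order of the coefficients, hence the index N - 1 - n;
    from n = N on, the recursion yields zero. *)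
Lemma adj_coefE (F : numFieldType) (N : nat) (A : 'M[F]_N) (n : nat) :
  adj_coef A n = if (n < N)%N then adj_pencil_coef A (N.-1 - n) else 0.
Proof.
elim: n => [|n IH] /=.
  case: N A => [|N] A; first by apply/matrixP => -[].
  have := adj_pencil_coef_rec A N.+1; rewrite (adj_pencil_coef_ge A (leqnn N.+1)).
  by rewrite mulmx0 addr0 coef_det_pencil // subnn minor_sum0 /= subn0 => ->.
rewrite IH; have [nN|Nn] := ltnP n N; last first.
  by rewrite minor_sum_gt ?ltnS // raddf0 mulmx0 subr0 ltnNge (leqW Nn).
have eqj : (N - (N.-1 - n))%N = n.+1 by lia.
have := adj_pencil_coef_rec A (N.-1 - n); rewrite coef_det_pencil; last by lia.
rewrite eqj => <-; rewrite addrK; have [n1N|Nn1] := ltnP.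
  by have -> : (N.-1 - n)%N = (N.-1 - n.+1).+1 by lia.
by have -> : (N.-1 - n)%N = 0%N by lia.
Qed.

(** Write d_j for the coefficients of the determinant and B_j for those of the adjugate. The trace
    of the recursion is tr B_(j-1) + tr (A B_j) = N d_j, and Jacobi's formula gives tr B_(j-1) = j
    d_j; so tr (A B_j) = (N - j) d_j. *)
Lemma minor_sum_adj_coef (F : numFieldType) (N : nat) (A : 'M[F]_N) (n : nat) :
  n.+1%:R * minor_sum A n.+1 = \tr (A *m adj_coef A n).
Proof.
rewrite adj_coefE; case: ltnP => [nN|Nn]; last first.
  by rewrite minor_sum_gt ?ltnS // mulr0 mulmx0 mxtrace0.
have trB j : \tr (adj_pencil_coef A j) = j.+1%:R * (\det (pencil A))`_j.+1.
  rewrite mulr_natl -coef_deriv deriv_det_pencil coef_sum.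
  by apply: eq_bigr => i _; rewrite mxE.
have : \tr (A *m adj_pencil_coef A (N.-1 - n)) =
    (N - (N.-1 - n))%:R * (\det (pencil A))`_(N.-1 - n).
  have := congr1 mxtrace (adj_pencil_coef_rec A (N.-1 - n)).
  rewrite mxtraceD mxtrace_scalar -[_ *+ N]mulr_natl.
  case E : (N.-1 - n)%N => [|j]; first by rewrite /= mxtrace0 add0r subn0.
  rewrite /= trB => h; rewrite natrB; last by lia.
  by rewrite mulrBl -h addrC addKr.
rewrite coef_det_pencil; last by lia.
by have -> : (N - (N.-1 - n))%N = n.+1 by lia.
Qed.

(** B has no inverse in D in general, so the Schur complement is taken with the adjugate:
    multiplying the bordered matrix by one with block - \adj B q clears its lower left corner, and
    the factor \det B gained on the way is cancelled. *)
Lemma det_sub_rank1 (D : idomainType) (N : nat) (B : 'M[D]_N) (q : 'cV[D]_N) (p : 'rV[D]_N) :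
  \det B != 0 -> \det (B - q *m p) = \det B - (p *m \adj B *m q) 0 0.
Proof.
move=> B0.
have L : \det (block_mx 1%:M p q B) = \det (B - q *m p).
  have -> : block_mx 1%:M p q B =
      block_mx 1%:M 0 q 1%:M *m block_mx 1%:M p 0 (B - q *m p).
    by rewrite mulmx_block !mul0mx !mulmx0 !mul1mx !mulmx1 !addr0 addrC subrK.
  by rewrite det_mulmx det_lblock det_ublock !det1 !mul1r.
apply: (mulIf B0); rewrite -L.
have -> : \det B = \det (block_mx (\det B)%:M 0 (- (\adj B *m q)) (1%:M : 'M[D]_N)).
  by rewrite det_lblock det1 mulr1 det_mx11 mxE.
rewrite -det_mulmx mulmx_block !mul1mx !mulmx0 !mulmx1 !add0r mulmxN mulmxA.
rewrite mulmxN mulmxA mul_mx_adj mul_scalar_mx mul_mx_scalar subrr det_ublock.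
rewrite ?det_lblock ?det1 ?mulr1 !det_mx11; congr (_ * _); last by rewrite mxE.
by rewrite !mxE mulr1n.
Qed.

(** Applied to the pencil instead of A, the determinant formula covers singular A too, because the
    determinant of a pencil is monic. The identity is then read off coefficient by coefficient. *)
Lemma minor_sum_sub_rank1 (F : numFieldType) (N : nat) (A : 'M[F]_N)
    (q : 'cV[F]_N) (p : 'rV[F]_N) (n : nat) :
  minor_sum (A - q *m p) n.+1 = minor_sum A n.+1 - (p *m adj_coef A n *m q) 0 0.
Proof.
rewrite adj_coefE; case: ltnP => [nN|Nn]; last first.
  by rewrite !minor_sum_gt ?ltnS // mulmx0 mul0mx mxE subr0.
have eqj : (N - (N.-1 - n))%N = n.+1 by lia.
rewrite -eqj -!coef_det_pencil; try lia.
have -> : pencil (A - q *m p) = pencil A - map_mx polyC q *m map_mx polyC p.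
  by rewrite /pencil map_mxB map_mxM addrA.
have D0 : \det (pencil A) != 0.
  have -> : pencil A = char_poly_mx (- A).
    by apply/matrixP => a b; rewrite !mxE rmorphN opprK.
  by rewrite -/(char_poly _) monic_neq0 ?char_poly_monic.
rewrite det_sub_rank1 // coefB; congr (_ - _).
rewrite !mxE coef_sum; apply: eq_bigr => i _.
rewrite !mxE coefMC coef_sum; congr (_ * _); apply: eq_bigr => a _.
by rewrite !mxE coefCM.
Qed.

(** * Real integrals for the completed Lebesgue measure *)

Lemma measurable_idfun_leb (R : realType) :
  measurable_fun [set: lebT R] (idfun : lebT R -> R).
Proof.
move=> _ Y mY; rewrite setTI preimage_id; exact: sub_caratheodory.
Qed.

Section RealFubini.
Context d1 d2 (T1 : measurableType d1) (T2 : measurableType d2) (R : realType).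
Variables (m1 : {sigma_finite_measure set T1 -> \bar R}).
Variables (m2 : {sigma_finite_measure set T2 -> \bar R}).
Implicit Types (K : T1 * T2 -> R).

Lemma measurable_Rintegral K : measurable_fun setT K ->
  measurable_fun setT (fun x => \int[m2]_y K (x, y)).
Proof.
move=> mK; pose K' := EFin \o K.
have mK' : measurable_fun setT K' by exact/measurable_EFinP.
have -> : (fun x => \int[m2]_y K (x, y)) = fine \o
    (fubini_F m2 K'^\+ \- fubini_F m2 K'^\-)%E.
  apply/funext => x; rewrite /Rintegral /= integralE.
  by congr (fine (_ - _)%E); apply: eq_integral => y _; rewrite ?funeposE ?funenegE.
apply: (measurableT_comp (@fine_measurable R setT measurableT)).
apply: emeasurable_funB.
  by apply: measurable_fun_fubini_tonelli_F => //; exact: measurable_funepos.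
by apply: measurable_fun_fubini_tonelli_F => //; exact: measurable_funeneg.
Qed.

(** The sections in y are integrable for every x, those in x only for almost every y. At the
    exceptional y the real integral is a default value, which the final almost everywhere comparison
    ignores. *)
Lemma Rintegral_fubini K (f : T1 -> R) :
    measurable_fun setT K ->
    (forall x, m2.-integrable setT (fun y => (K (x, y))%:E)) ->
    m1.-integrable setT (EFin \o f) ->
    (forall x, \int[m2]_y `|K (x, y)| <= f x) ->
  [/\ \int[m1]_x \int[m2]_y K (x, y) = \int[m2]_y \int[m1]_x K (x, y),
      m1.-integrable setT (fun x => (\int[m2]_y K (x, y))%:E) &
      m2.-integrable setT (fun y => (\int[m1]_x K (x, y))%:E)].
Proof.
move=> mK iK fi Kf; pose K' := EFin \o K.
have mK' : measurable_fun setT K' by exact/measurable_EFinP.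
have EI d (T : measurableType d) (m : {measure set T -> \bar R}) (g : T -> R) :
    m.-integrable setT (EFin \o g) -> (\int[m]_x (g x)%:E = (\int[m]_x g x)%:E)%E.
  by move=> ig; rewrite /Rintegral fineK //; exact: integrable_fin_num.
have iK' : (m1 \x m2)%E.-integrable setT K'.
  apply/integrable12ltyP => //.
  have /integrableP[_] := fi; apply: le_lt_trans.
  apply: ge0_le_integral => //.
  - by move=> x _; exact: integral_ge0.
  - apply: (measurable_fun_fubini_tonelli_F (fun p => `|K' p|)%E) => //; exact: measurableT_comp.
  - by apply: measurableT_comp => //; have /integrableP[] := fi.
  move=> x _ /=; rewrite (EI _ _ m2 (fun y => `|K (x, y)|)) ?lee_fin.
    by rewrite (le_trans (Kf x)) // ler_norm.
  exact: (integrable_norm (iK x)).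
have mF := measurable_fubini_F iK'; have mG := measurable_fubini_G iK'.
have iF := integrable_fubini_F iK'.
have EF x : fubini_F m2 K' x = (\int[m2]_y K (x, y))%:E.
  by rewrite -(EI _ _ m2 (fun y => K (x, y)) (iK x)).
have mRG : measurable_fun setT (fun y => \int[m1]_x K (x, y)).
  exact: (measurableT_comp (@fine_measurable R setT measurableT) mG).
have L1G : m2.-integrable setT (fun y => (\int[m1]_x K (x, y))%:E).
  apply/integrableP; split; first exact/measurable_EFinP.
  apply: le_lt_trans ((integrable21ltyP _ _ mK').1 iK').
  apply: ge0_le_integral => //.
  - by apply: measurableT_comp => //; exact/measurable_EFinP.
  - apply: (measurable_fun_fubini_tonelli_G (fun p => `|K' p|)%E) => //.
    exact: measurableT_comp.
  (* [fine] sends infinite values to 0, so it never increases an absolute value. *)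
  move=> y _ /=; apply: (@le_trans _ _ `|\int[m1]_x K' (x, y)|%E).
    rewrite /Rintegral -/(fubini_G m1 K' y).
    by case: (fubini_G _ _ _) => [r||] //=; rewrite ?normr0 ?lee_fin ?leey.
  apply: le_abse_integral => //.
  by apply: (measurableT_comp mK'); apply: measurable_fun_pair => //; exact: measurable_cst.
split=> //; last by apply: eq_integrable iF => // x _; rewrite EF.
transitivity (fine (\int[m1]_x fubini_F m2 K' x)).
  by rewrite /Rintegral; congr fine; apply: eq_integral => x _; rewrite EF.
rewrite (integral12_prod_meas1 iK') -(integral21_prod_meas1 iK').
rewrite /Rintegral; congr fine.
apply: ae_eq_integral => //; first exact/measurable_EFinP.
have := ae_integrable2 iK'; apply: filterS => y iy _.
by rewrite -EI.
Qed.

End RealFubini.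

Section Leb.
Context {R : realType}.
Implicit Types (f g h : R -> R) (k : R -> R -> R).

Definition measL f : Prop := measurable_fun [set: lebT R] (f : lebT R -> R).
Definition meas2 k : Prop :=
  measurable_fun [set: lebT R * lebT R] (fun p : lebT R * lebT R => k p.1 p.2 : R).
Definition L1 f : Prop := (leb R).-integrable setT (fun x : lebT R => (f x)%:E).
Definition lint f : R := \int[leb R]_x f x.

Lemma measL_comp (F : R -> R) f : measurable_fun [set: R] F -> measL f -> measL (fun x => F (f x)).
Proof. by move=> mF mf; exact: (measurableT_comp mF mf). Qed.

Lemma meas2_comp (F : R -> R) k : measurable_fun [set: R] F -> meas2 k -> meas2 (fun x y => F (k x y)).
Proof. by move=> mF mf; exact: (measurableT_comp mF mf). Qed.

Lemma measL_id : measL (fun x => x).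
Proof. exact: measurable_idfun_leb. Qed.

Lemma measL_cst (c : R) : measL (fun=> c).
Proof. exact: measurable_cst. Qed.

Lemma measL_D f g : measL f -> measL g -> measL (fun x => f x + g x).
Proof. exact: measurable_funD. Qed.

Lemma measL_N f : measL f -> measL (fun x => - f x).
Proof. by move=> mf; exact: (measurableT_comp (@oppr_measurable R setT) mf). Qed.

Lemma measL_M f g : measL f -> measL g -> measL (fun x => f x * g x).
Proof. exact: measurable_funM. Qed.

Lemma measL_norm f : measL f -> measL (fun x => `|f x|).
Proof. by apply: measL_comp; exact: normr_measurable. Qed.

Lemma measL_if_le f1 f2 f3 f4 : measL f1 -> measL f2 -> measL f3 -> measL f4 ->
  measL (fun x => if f1 x <= f2 x then f3 x else f4 x).
Proof.
move=> m1 m2 m3 m4.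
refine (@measurable_fun_ifT _ _ (lebT R) R f3 f4 (fun x => f1 x <= f2 x) _ m3 m4).
exact: (@measurable_fun_ler _ (lebT R) R setT f1 f2 m1 m2).
Qed.

Lemma meas2_1 f : measL f -> meas2 (fun x y => f x).
Proof. by move=> mf; exact: (measurableT_comp mf measurable_fst). Qed.

Lemma meas2_2 f : measL f -> meas2 (fun x y => f y).
Proof. by move=> mf; exact: (measurableT_comp mf measurable_snd). Qed.

Lemma meas2_D k1 k2 : meas2 k1 -> meas2 k2 -> meas2 (fun x y => k1 x y + k2 x y).
Proof. exact: measurable_funD. Qed.

Lemma meas2_B k1 k2 : meas2 k1 -> meas2 k2 -> meas2 (fun x y => k1 x y - k2 x y).
Proof. exact: measurable_funB. Qed.

Lemma meas2_M k1 k2 : meas2 k1 -> meas2 k2 -> meas2 (fun x y => k1 x y * k2 x y).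
Proof. exact: measurable_funM. Qed.

Lemma meas2_if_le k1 k2 k3 k4 : meas2 k1 -> meas2 k2 -> meas2 k3 -> meas2 k4 ->
  meas2 (fun x y => if k1 x y <= k2 x y then k3 x y else k4 x y).
Proof. by move=> *; apply: measurable_fun_ifT => //; exact: measurable_fun_ler. Qed.

Lemma meas2_sec1 k y : meas2 k -> measL (k^~ y).
Proof.
move=> mk; refine (@measurableT_comp _ _ _ (lebT R) (lebT R * lebT R)%type R (fun p => k p.1 p.2) setT (fun x => (x, y)) mk _).
by apply: measurable_fun_pair; [exact: measurable_id|exact: measurable_cst].
Qed.

Lemma meas2_sec2 k x : meas2 k -> measL (k x).
Proof.
move=> mk; refine (@measurableT_comp _ _ _ (lebT R) (lebT R * lebT R)%type R (fun p => k p.1 p.2) setT (fun y => (x, y)) mk _).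
by apply: measurable_fun_pair; [exact: measurable_cst|exact: measurable_id].
Qed.

Lemma meas2_swap k : meas2 k -> meas2 (fun x y => k y x).
Proof.
move=> mk; refine (@measurableT_comp _ _ _ (lebT R * lebT R)%type (lebT R * lebT R)%type R (fun p => k p.1 p.2) setT (fun p => (p.2, p.1)) mk _).
by apply: measurable_fun_pair; [exact: measurable_snd|exact: measurable_fst].
Qed.

Lemma L1_measL f : L1 f -> measL f.
Proof. by move/measurable_int/measurable_EFinP. Qed.

Lemma L1_le f g : measL f -> (forall x, `|f x| <= g x) -> L1 g -> L1 f.
Proof.
move=> mf fg ig.
refine (@le_integrable _ (lebT R) R (leb R) setT measurableT (EFin \o f) (EFin \o g) _ _ ig).
  exact/measurable_EFinP.
by move=> x _; rewrite /= lee_fin (le_trans (fg x)) // ler_norm.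
Qed.

Lemma L1_D f g : L1 f -> L1 g -> L1 (fun x => f x + g x).
Proof. exact: integrableD. Qed.

Lemma L1_B f g : L1 f -> L1 g -> L1 (fun x => f x - g x).
Proof. exact: integrableB. Qed.

Lemma L1_Z (c : R) f : L1 f -> L1 (fun x => c * f x).
Proof. exact: integrableZl. Qed.

Lemma L1_N f : L1 f -> L1 (fun x => - f x).
Proof. exact: integrableN. Qed.

Lemma L1_norm f : L1 f -> L1 (fun x => `|f x|).
Proof. exact: integrable_norm. Qed.

Lemma L1_0 : L1 (fun=> 0).
Proof. exact: integrable0. Qed.

Lemma L1_sum (I : Type) (r : seq I) (P : pred I) (F : I -> R -> R) :
  (forall i, L1 (F i)) -> L1 (fun x => \sum_(i <- r | P i) F i x).
Proof.
move=> H; elim: r => [|i r IH].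
  by under eq_fun do rewrite big_nil; exact: L1_0.
under eq_fun do rewrite big_cons; case: (P i) => //; exact: L1_D.
Qed.

Lemma L1_bM (C : R) f g : measL f -> (forall x, `|f x| <= C) -> L1 g -> L1 (fun x => f x * g x).
Proof.
move=> mf fC ig; apply: (@L1_le _ (fun x => C * `|g x|)).
- by apply: measL_M => //; exact: L1_measL.
- by move=> x; rewrite normrM ler_wpM2r.
- exact/L1_Z/L1_norm.
Qed.

Lemma lintD f g : L1 f -> L1 g -> lint (fun x => f x + g x) = lint f + lint g.
Proof. by move=> *; exact: RintegralD. Qed.

Lemma lintB f g : L1 f -> L1 g -> lint (fun x => f x - g x) = lint f - lint g.
Proof. by move=> *; exact: RintegralB. Qed.

Lemma lintZ (c : R) f : L1 f -> lint (fun x => c * f x) = c * lint f.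
Proof. by move=> *; exact: RintegralZl. Qed.

Lemma lintN f : L1 f -> lint (fun x => - f x) = - lint f.
Proof.
by move=> /(lintZ (-1)); rewrite mulN1r => <-; congr lint; apply/funext => x; rewrite mulN1r.
Qed.

Lemma lint0 : lint (fun=> 0) = 0.
Proof. by rewrite /lint /Rintegral integral0. Qed.

Lemma lint_sum (I : Type) (r : seq I) (P : pred I) (F : I -> R -> R) :
  (forall i, L1 (F i)) ->
  lint (fun x => \sum_(i <- r | P i) F i x) = \sum_(i <- r | P i) lint (F i).
Proof.
move=> H; elim: r => [|i r IH].
  by under eq_fun do rewrite big_nil; rewrite big_nil lint0.
under eq_fun do rewrite big_cons; rewrite big_cons; case: (P i) => //.
by rewrite lintD ?IH //; exact: L1_sum.
Qed.

Lemma lint_ge0 f : (forall x, 0 <= f x) -> 0 <= lint f.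
Proof. by move=> f0; exact: Rintegral_ge0. Qed.

Lemma lint_le f g : L1 f -> L1 g -> (forall x, f x <= g x) -> lint f <= lint g.
Proof. by move=> *; exact: le_Rintegral. Qed.

Lemma lint_norm f : L1 f -> `|lint f| <= lint (fun x => `|f x|).
Proof. by move=> *; exact: le_normr_Rintegral. Qed.

Lemma lint_normM (C : R) f g : measL f -> (forall x, `|f x| <= C) -> L1 g ->
  `|lint (fun x => f x * g x)| <= C * lint (fun x => `|g x|).
Proof.
move=> mf fC ig; apply: le_trans (lint_norm (L1_bM mf fC ig)) _.
rewrite -lintZ; last exact: L1_norm.
apply: lint_le; first exact/L1_norm/(L1_bM mf fC ig).
  exact/L1_Z/L1_norm.
by move=> x; rewrite normrM ler_wpM2r.
Qed.

Lemma lintE f : L1 f -> (\int[leb R]_x (f x)%:E = (lint f)%:E)%E.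
Proof. by move=> *; rewrite /lint /Rintegral fineK //; exact: integrable_fin_num. Qed.


Lemma lint_fubini k f : meas2 k -> (forall x, L1 (k x)) -> L1 f ->
    (forall x, lint (fun y => `|k x y|) <= f x) ->
  [/\ lint (fun x => lint (k x)) = lint (fun y => lint (k^~ y)),
      L1 (fun x => lint (k x)) & L1 (fun y => lint (k^~ y))].
Proof.
exact: (@Rintegral_fubini _ _ (lebT R) (lebT R) R (leb R) (leb R) (fun p => k p.1 p.2) f).
Qed.

Lemma measL_lint k : meas2 k -> measL (fun x => lint (k x)).
Proof.
move=> mk; exact: (@measurable_Rintegral _ _ (lebT R) (lebT R) R (leb R) (fun p => k p.1 p.2) mk).
Qed.

(** The tool for moving an integral operator to the other factor: the double integrand is dominated
    by C |f(x)| |h(y)|. *)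
Lemma lint_bounded_kernel (C : R) k f h : meas2 k -> (forall x y, `|k x y| <= C) ->
    L1 f -> L1 h ->
  lint (fun x => f x * lint (fun y => k x y * h y)) =
    lint (fun y => h y * lint (fun x => k x y * f x)).
Proof.
move=> mk kC fi hi.
have ikh x : L1 (fun y => k x y * h y) by apply: (@L1_bM C) => //; exact: meas2_sec2.
have ikf y : L1 (fun x => k x y * f x).
  by apply: (@L1_bM C (k^~ y)) => //; exact: meas2_sec1.
have [||||E _ _] := @lint_fubini (fun x y => f x * (k x y * h y))
    (fun x => (C * lint (fun y => `|h y|)) * `|f x|).
- by apply: (meas2_M (meas2_1 (L1_measL fi)) (meas2_M mk (meas2_2 (L1_measL hi)))).
- by move=> x; exact: L1_Z.
- exact/L1_Z/L1_norm.
- move=> x; under eq_fun do rewrite normrM.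
  rewrite lintZ; last exact: L1_norm.
  rewrite mulrC ler_wpM2r //.
  rewrite -lintZ; last exact: L1_norm.
  apply: lint_le; [exact: L1_norm|exact/L1_Z/L1_norm|].
  by move=> y; rewrite normrM ler_wpM2r.
transitivity (lint (fun x => lint (fun y => f x * (k x y * h y)))).
  by congr lint; apply/funext => x; rewrite lintZ.
rewrite E; congr lint; apply/funext => y; rewrite -lintZ //.
by congr lint; apply/funext => x; rewrite mulrA mulrC [f x * _]mulrC.
Qed.

(** Lebesgue measure on Borel sets is the image of its completion under the identity map. This
    imports the fundamental theorem of calculus from the Borel line. *)
Lemma lint_borelE (f : R -> \bar R) : measurable_fun [set: measurableTypeR R] f ->
  (\int[leb R]_x f x = \int[@lebesgue_measure R]_x f x)%E.
Proof.
move=> mf.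
have E (g : R -> \bar R) : measurable_fun [set: measurableTypeR R] g -> (forall x, 0 <= g x)%E ->
   (\int[leb R]_x g x = \int[@lebesgue_measure R]_x g x)%E.
  move=> mg g0.
  have <- := @ge0_integral_pushforward _ _ (lebT R) (measurableTypeR R) R idfun
    (@measurable_idfun_leb R) (leb R) setT g measurableT mg (fun x _ => g0 x).
  by apply: eq_measure_integral; first exact: (@measurable_idfun_leb R).
by rewrite integralE [RHS]integralE !E //; [exact: measurable_funeneg|exact: measurable_funepos].
Qed.

Lemma L1_borel f : (@lebesgue_measure R).-integrable setT (fun x => (f x)%:E) -> L1 f.
Proof.
move=> fi; have mf := measurable_int _ fi; have /integrableP[_ fy] := fi.
apply/integrableP; split; first exact: (measurableT_comp mf (@measurable_idfun_leb R)).
by rewrite (@lint_borelE (fun x => `|(f x)%:E|%E)) //; exact: measurableT_comp.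
Qed.

Lemma lint_exp (c m : R) : 0 < c ->
  L1 (fun t => if m <= t then expR (- (c * t)) else 0) /\
  lint (fun t => if m <= t then expR (- (c * t)) else 0) = expR (- (c * m)) / c.
Proof.
move=> c0; set f := fun t => expR (- (c * t)).
have -> : (fun t => if m <= t then expR (- (c * t)) else 0) = f \_ `[m, +oo[.
  apply/funext => t; rewrite patchE; case: ifP => mt; first by rewrite mem_set //= in_itv /= mt.
  by rewrite memNset //= in_itv /= mt.
have df (t : R) : is_derive t 1 (fun t : R => - (c^-1 * expR (- (c * t)))) (f t).
  apply: is_derive_eq; rewrite /f /GRing.scale /= !mulr1; field; exact: lt0r_neq0.
have cf : continuous f.
  move=> t; apply/differentiable_continuous/derivable1_diffP.
  by have := derivable_expR; rewrite /f => _; apply: ex_derive.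
have cF : continuous (fun t : R => - (c^-1 * expR (- (c * t)))).
  by move=> t; apply/differentiable_continuous/derivable1_diffP; have := df t.
have mf : measurable_fun [set: measurableTypeR R] f by exact: continuous_measurable_fun.
have mr : measurable_fun [set: measurableTypeR R] (f \_ `[m, +oo[ : R -> R).
  by apply/(measurable_restrictT _ _).1 => //; exact: (measurable_funS measurableT (@subsetT _ _) mf).
have I : (\int[@lebesgue_measure R]_x ((f \_ `[m, +oo[) x)%:E = (expR (- (c * m)) / c)%:E)%E.
  transitivity (\int[@lebesgue_measure R]_(x in `[m, +oo[) (f x)%:E)%E.
    rewrite [RHS]integral_mkcond; apply: eq_integral => x _; rewrite !patchE.
    by case: ifP.
  rewrite (@ge0_continuous_FTC2y _ f (fun t => - (c^-1 * expR (- (c * t)))) m 0).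
  - by rewrite sub0e -EFinN opprK mulrC.
  - by move=> x _; exact: expR_ge0.
  - exact: continuous_subspaceT.
  - have h : expR (- (c * t)) @[t --> +oo] --> (0 : R).
      apply: (@cvg_comp _ _ _ (fun t : R => c * t) (fun y : R => expR (- y)) _ (pinfty_nbhs R)).
        exact: gt0_cvgMry.
      exact: cvgr_expR.
    by rewrite -oppr0 -(mulr0 c^-1); exact: (cvgN (cvgM (cvg_cst _) h)).
  - by move=> x _; have := df x.
  - exact/cvg_at_right_filter/cF.
  - by move=> x _; rewrite derive1E; apply: derive_val.
have L : L1 (f \_ `[m, +oo[).
  apply: L1_borel; apply/integrableP; split; first exact/measurable_EFinP.
  have -> : (\int[@lebesgue_measure R]_x `|((f \_ `[m, +oo[) x)%:E| = (expR (- (c * m)) / c)%:E)%E.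
    rewrite -I; apply: eq_integral => x _.
    by rewrite gee0_abs // lee_fin patchE; case: ifP => // _; exact: expR_ge0.
  exact: ltry.
split=> //; apply/EFin_inj; rewrite -lintE // (@lint_borelE (fun x => ((f \_ `[m, +oo[) x)%:E)) //.
exact/measurable_EFinP.
Qed.

(* [green k] is the Green's function of -d^2/dx^2 + k^2, and [halfgreen k] the
   kernel of its half-line factor (k - d/dx)^-1. *)
Definition green (k x y : R) : R := expR (- k * `|x - y|) / (2 * k).
Definition halfgreen (k x t : R) : R := if x <= t then expR (- (k * (t - x))) else 0.

Lemma green_sym kap x y : green kap x y = green kap y x.
Proof. by rewrite /green distrC. Qed.

Lemma meas2_fst : meas2 (fun x y => x).
Proof. exact: (meas2_1 measL_id). Qed.

Lemma meas2_snd : meas2 (fun x y => y).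
Proof. exact: (meas2_2 measL_id). Qed.

Lemma meas2_cst (c : R) : meas2 (fun _ _ => c).
Proof. exact: (meas2_1 (measL_cst c)). Qed.

Lemma meas2_expZ (c : R) k : meas2 k -> meas2 (fun x y => expR (c * k x y)).
Proof.
move=> mk; apply: (@meas2_comp expR (fun x y => c * k x y)); first exact: measurable_expR.
exact: (meas2_M (meas2_cst c) mk).
Qed.

Lemma meas2_green kap : meas2 (green kap).
Proof.
apply: (meas2_M _ (meas2_cst _)); apply: meas2_expZ.
apply: (@meas2_comp Num.norm (fun x y => x - y)); first exact: normr_measurable.
exact: (meas2_B meas2_fst meas2_snd).
Qed.

Lemma meas2_halfgreen kap : meas2 (halfgreen kap).
Proof.
apply: (meas2_if_le meas2_fst meas2_snd _ (meas2_cst 0)).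
have -> : (fun x y : R => expR (- (kap * (y - x)))) = (fun x y => expR (- kap * (y - x))).
  by apply/funext => x; apply/funext => y; rewrite mulNr.
by apply: meas2_expZ; exact: (meas2_B meas2_snd meas2_fst).
Qed.

Lemma halfgreen_ge0 kap x t : 0 <= halfgreen kap x t.
Proof. by rewrite /halfgreen; case: ifP => // _; exact: expR_ge0. Qed.

Lemma halfgreen_le1 kap x t : 0 < kap -> `|halfgreen kap x t| <= 1.
Proof.
move=> k0p; rewrite ger0_norm ?halfgreen_ge0 // /halfgreen; case: ifP => // xt.
by rewrite -expR0 ler_expR oppr_le0 mulr_ge0 ?subr_ge0 // ltW.
Qed.

Lemma green_ge0 (kap x y : R) : 0 < kap -> 0 <= green kap x y.
Proof. by move=> kp; rewrite /green divr_ge0 ?expR_ge0 // mulr_ge0 // ltW. Qed.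

Lemma green_le (kap x y : R) : 0 < kap -> `|green kap x y| <= (2 * kap)^-1.
Proof.
move=> kp; rewrite ger0_norm ?green_ge0 // /green ler_piMl ?invr_ge0 ?(mulr_ge0 _ (ltW kp)) //.
by rewrite -expR0 ler_expR mulNr oppr_le0 mulr_ge0 // ltW.
Qed.

Lemma lint_halfgreen kap x : 0 < kap -> L1 (halfgreen kap x) /\ lint (halfgreen kap x) = kap^-1.
Proof.
move=> kp; have [i e] := lint_exp x kp.
have -> : halfgreen kap x = (fun t => expR (kap * x) * (if x <= t then expR (- (kap * t)) else 0)).
  apply/funext => t; rewrite /halfgreen; case: ifP => _; last by rewrite mulr0.
  by rewrite -expRD; congr expR; ring.
split; first exact: L1_Z.
by rewrite lintZ // e mulrA -expRD addrN expR0 mul1r.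
Qed.

(** The operator (k - d/dx)^-1 times its adjoint is (k^2 - d^2/dx^2)^-1. In kernels: the product is
    supported on t >= max(a, b), and a + b - 2 max(a, b) = - |a - b|. *)
Lemma lint_halfgreenM kap a b : 0 < kap ->
  lint (fun t => halfgreen kap a t * halfgreen kap b t) = green kap a b.
Proof.
move=> kp; have k2 : 0 < 2 * kap by rewrite mulr_gt0.
have [i e] := lint_exp (Num.max a b) k2.
have -> : (fun t => halfgreen kap a t * halfgreen kap b t) =
    (fun t => expR (kap * (a + b)) * (if Num.max a b <= t then expR (- (2 * kap * t)) else 0)).
  apply/funext => t; rewrite /halfgreen ge_max; case: (a <= t); case: (b <= t);
    rewrite /= ?mulr0 ?mul0r // -!expRD; congr expR; ring.
rewrite lintZ // e /green mulrA -expRD; congr (expR _ / _).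
by case: (leP a b) => ab; [rewrite ler0_norm ?subr_le0 //|rewrite gtr0_norm ?subr_gt0 //]; ring.
Qed.

End Leb.

(** * Complex-valued square integrable functions *)

Section Hilbert.
Context {R : realType}.
Implicit Types (f g h : R -> R[i]) (c : R[i]) (e : nat -> R -> R[i]) (N : nat).

Local Notation re := (@complex.Re R).
Local Notation im := (@complex.Im R).
Local Notation nc := (@Normc.normc R).

Lemma normc_sqr c : nc c ^+ 2 = re c ^+ 2 + im c ^+ 2.
Proof. by case: c => a b /=; rewrite sqr_sqrtr // addr_ge0 // sqr_ge0. Qed.

Lemma normcM c d : nc (c * d) = nc c * nc d.
Proof. exact: Normc.normcM. Qed.

Lemma normc_ge0 c : 0 <= nc c.
Proof. by case: c => a b /=; rewrite sqrtr_ge0. Qed.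

Lemma normcD c d : nc (c + d) <= nc c + nc d.
Proof. exact: le_normcD. Qed.

Lemma normc_conj c : nc c^* = nc c.
Proof. by case: c => a b /=; rewrite sqrrN. Qed.

Lemma normc_real (r : R) : nc r%:C = `|r|.
Proof. by rewrite /= expr0n /= addr0 sqrtr_sqr. Qed.

Lemma cReM c d : re (c * d) = re c * re d - im c * im d.
Proof. by case: c; case: d. Qed.

Lemma cImM c d : im (c * d) = re c * im d + im c * re d.
Proof. by case: c; case: d. Qed.

Lemma cReD c d : re (c + d) = re c + re d.
Proof. by case: c; case: d. Qed.

Lemma cImD c d : im (c + d) = im c + im d.
Proof. by case: c; case: d. Qed.

Lemma cRe_conj c : re c^* = re c.
Proof. by case: c. Qed.

Lemma cIm_conj c : im c^* = - im c.
Proof. by case: c. Qed.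

Lemma complexP c d : re c = re d -> im c = im d -> c = d.
Proof. by case: c => a b; case: d => a' b' /= -> ->. Qed.

Definition cL1 f : Prop := L1 (fun x => re (f x)) /\ L1 (fun x => im (f x)).

Lemma cintegralE f : cintegral f = lint (fun x => re (f x)) +i* lint (fun x => im (f x)).
Proof. by []. Qed.

Lemma cL1_D f g : cL1 f -> cL1 g -> cL1 (fun x => f x + g x).
Proof.
by move=> [f1 f2] [g1 g2]; split; [under eq_fun do rewrite cReD|under eq_fun do rewrite cImD]; exact: L1_D.
Qed.

Lemma cL1_Z c f : cL1 f -> cL1 (fun x => c * f x).
Proof.
move=> [f1 f2]; split.
  by under eq_fun do rewrite cReM; apply: L1_B; exact: L1_Z.
by under eq_fun do rewrite cImM; apply: L1_D; exact: L1_Z.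
Qed.

Lemma cL1_0 : cL1 (fun=> 0).
Proof. by split; exact: L1_0. Qed.

Lemma cL1_sum (I : Type) (r : seq I) (P : pred I) (F : I -> R -> R[i]) :
  (forall i, cL1 (F i)) -> cL1 (fun x => \sum_(i <- r | P i) F i x).
Proof.
move=> H; elim: r => [|i r IH].
  by under eq_fun do rewrite big_nil; exact: cL1_0.
by under eq_fun do rewrite big_cons; case: (P i) => //; exact: cL1_D.
Qed.

Lemma cintD f g : cL1 f -> cL1 g ->
  cintegral (fun x => f x + g x) = cintegral f + cintegral g.
Proof.
move=> [f1 f2] [g1 g2]; rewrite !cintegralE; apply: complexP => /=.
  by under eq_fun do rewrite cReD; rewrite lintD.
by under eq_fun do rewrite cImD; rewrite lintD.
Qed.

Lemma cintZ c f : cL1 f -> cintegral (fun x => c * f x) = c * cintegral f.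
Proof.
move=> [f1 f2]; rewrite !cintegralE; apply: complexP; rewrite ?cReM ?cImM /=.
  by under eq_fun do rewrite cReM; rewrite lintB ?lintZ //; exact: L1_Z.
by under eq_fun do rewrite cImM; rewrite lintD ?lintZ //; exact: L1_Z.
Qed.

Lemma cint0 : cintegral (fun=> 0) = 0 :> R[i].
Proof. by rewrite cintegralE lint0. Qed.

Lemma cint_sum (I : Type) (r : seq I) (P : pred I) (F : I -> R -> R[i]) :
  (forall i, cL1 (F i)) ->
  cintegral (fun x => \sum_(i <- r | P i) F i x) = \sum_(i <- r | P i) cintegral (F i).
Proof.
move=> H; elim: r => [|i r IH].
  by under eq_fun do rewrite big_nil; rewrite big_nil cint0.
under eq_fun do rewrite big_cons; rewrite big_cons; case: (P i) => //.
by rewrite cintD ?IH //; exact: cL1_sum.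
Qed.

Lemma cint_conj f : cL1 f -> cintegral (fun x => (f x)^*) = (cintegral f)^*.
Proof.
move=> [f1 f2]; rewrite !cintegralE; apply: complexP; rewrite ?cRe_conj ?cIm_conj /=.
  by under eq_fun do rewrite cRe_conj.
by under eq_fun do rewrite cIm_conj; rewrite lintN.
Qed.

Lemma cint_real (f : R -> R) : cintegral (fun x => (f x)%:C) = (lint f)%:C.
Proof. by rewrite cintegralE /= lint0. Qed.

Definition rL2 (f : R -> R) : Prop := measL f /\ L1 (fun x => f x ^+ 2).

Lemma rL2M (f g : R -> R) : rL2 f -> rL2 g -> L1 (fun x => f x * g x).
Proof.
move=> [mf f2] [mg g2]; apply: (@L1_le _ _ (fun x => f x ^+ 2 + g x ^+ 2)).
- exact: measL_M.
- move=> x; rewrite ler_norml; have := sqr_ge0 (f x + g x); have := sqr_ge0 (f x - g x).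
  by have := sqr_ge0 (f x); have := sqr_ge0 (g x); rewrite !expr2; move=> *; apply/andP; split; nra.
- exact: L1_D.
Qed.

Lemma rL2_D (f g : R -> R) : rL2 f -> rL2 g -> rL2 (fun x => f x + g x).
Proof.
move=> hf hg; split; first by apply: measL_D; [exact: hf.1|exact: hg.1].
have -> : (fun x => (f x + g x) ^+ 2) = (fun x => f x ^+ 2 + 2 * (f x * g x) + g x ^+ 2).
  by apply/funext => x; ring.
by apply: L1_D; [apply: L1_D; [exact: hf.2|exact/L1_Z/rL2M]|exact: hg.2].
Qed.

Lemma rL2_Z (a : R) (f : R -> R) : rL2 f -> rL2 (fun x => a * f x).
Proof.
move=> hf; split; first by apply: measL_M; [exact: measL_cst|exact: hf.1].
by under eq_fun do rewrite exprMn; apply: L1_Z; exact: hf.2.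
Qed.

Lemma rL2_bM (C : R) (h f : R -> R) : measL h -> (forall x, `|h x| <= C) -> rL2 f -> rL2 (fun x => h x * f x).
Proof.
move=> mh hC [mf f2]; split; first exact: measL_M.
under eq_fun do rewrite exprMn; apply: (@L1_bM _ (C ^+ 2)) => //.
  exact: (measL_M mh mh).
move=> x; rewrite ger0_norm ?sqr_ge0 // -(@real_normK _ (h x)) ?num_real //.
by rewrite ler_pXn2r // ?nnegrE // (le_trans _ (hC x)).
Qed.

Lemma L2P f : L2 f <-> rL2 (fun x => re (f x)) /\ rL2 (fun x => im (f x)).
Proof.
have E : (fun x => nc (f x) ^+ 2) = (fun x => re (f x) ^+ 2 + im (f x) ^+ 2).
  by apply/funext => x; rewrite normc_sqr.
split=> [[mr mi]|[[mr r2] [mi i2]]]; last first.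
  by split=> //; rewrite -/(L1 (fun x => nc (f x) ^+ 2)) E; exact: L1_D.
rewrite -/(L1 (fun x => nc (f x) ^+ 2)) E => i2.
split; split=> //; apply: L1_le i2; try exact: (measL_M _ _).
  by move=> x; rewrite ger0_norm ?sqr_ge0 // lerDl sqr_ge0.
by move=> x; rewrite ger0_norm ?sqr_ge0 // lerDr sqr_ge0.
Qed.

Lemma L2_real (f : R -> R) : rL2 f -> L2 (fun x => (f x)%:C).
Proof.
move=> hf; apply/L2P; split => //=; split; first exact: measL_cst.
by rewrite expr0n; exact: L1_0.
Qed.

Lemma L2_D f g : L2 f -> L2 g -> L2 (fun x => f x + g x).
Proof.
move=> /L2P[f1 f2] /L2P[g1 g2]; apply/L2P; split.
  by under eq_fun do rewrite cReD; exact: rL2_D.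
by under eq_fun do rewrite cImD; exact: rL2_D.
Qed.

Lemma L2_Z c f : L2 f -> L2 (fun x => c * f x).
Proof.
move=> /L2P[f1 f2]; apply/L2P; split.
  under eq_fun do rewrite cReM -mulNr; apply: rL2_D; exact: rL2_Z.
by under eq_fun do rewrite cImM; apply: rL2_D; exact: rL2_Z.
Qed.

Lemma L2_0 : L2 (fun=> 0 : R[i]).
Proof. by apply: (@L2_real (fun=> 0)); split; [exact: measL_cst|rewrite expr0n; exact: L1_0]. Qed.

(* Otherwise failing unifications unfold the integrals and do not terminate. *)
#[local] Opaque L2 cintegral.

Lemma L2_sum (I : Type) (r : seq I) (P : pred I) (F : I -> R -> R[i]) :
  (forall i, L2 (F i)) -> L2 (fun x => \sum_(i <- r | P i) F i x).
Proof.
move=> H; elim: r => [|i r IH].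
  by under eq_fun do rewrite big_nil; exact: L2_0.
by under eq_fun do rewrite big_cons; case: (P i); [exact: (L2_D (H i) IH)|exact: IH].
Qed.

Lemma cL1M f g : L2 f -> L2 g -> cL1 (fun x => (f x)^* * g x).
Proof.
move=> /L2P[f1 f2] /L2P[g1 g2]; split.
  under eq_fun do rewrite cReM cRe_conj cIm_conj mulNr opprK; apply: L1_D; exact: rL2M.
under eq_fun do rewrite cImM cRe_conj cIm_conj mulNr; apply: L1_B; exact: rL2M.
Qed.

Lemma innerDr f g h : L2 f -> L2 g -> L2 h ->
  inner f (fun x => g x + h x) = inner f g + inner f h.
Proof.
move=> *; rewrite /inner -cintD; try exact: cL1M.
by congr cintegral; apply/funext => x; rewrite mulrDr.
Qed.

Lemma innerZr c f g : L2 f -> L2 g -> inner f (fun x => c * g x) = c * inner f g.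
Proof.
move=> *; rewrite /inner -cintZ; last exact: cL1M.
by congr cintegral; apply/funext => x; rewrite mulrCA.
Qed.

Lemma inner0r f : inner f (fun=> 0) = 0.
Proof. by rewrite /inner; under eq_fun do rewrite mulr0; exact: cint0. Qed.

Lemma inner_sumr (I : Type) (r : seq I) (P : pred I) f (F : I -> R -> R[i]) :
  L2 f -> (forall i, L2 (F i)) ->
  inner f (fun x => \sum_(i <- r | P i) F i x) = \sum_(i <- r | P i) inner f (F i).
Proof.
move=> hf H; rewrite /inner -cint_sum; last by move=> i; exact: cL1M.
by congr cintegral; apply/funext => x; rewrite mulr_sumr.
Qed.

Lemma inner_conj f g : L2 f -> L2 g -> inner g f = (inner f g)^*.
Proof.
move=> hf hg; rewrite /inner -cint_conj; last exact: cL1M.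
by congr cintegral; apply/funext => x; rewrite rmorphM /= conjcK mulrC.
Qed.

Lemma norm2_ge0 f : 0 <= norm2 f.
Proof. exact: sqrtr_ge0. Qed.

Lemma norm2_sqr f : norm2 f ^+ 2 = lint (fun x => nc (f x) ^+ 2).
Proof. by rewrite sqr_sqrtr // lint_ge0 // => x; exact: sqr_ge0. Qed.

Lemma inner_norm2 f : L2 f -> inner f f = (norm2 f ^+ 2)%:C.
Proof.
move=> hf; rewrite norm2_sqr -cint_real; congr cintegral; apply/funext => x.
by apply: complexP; rewrite ?cReM ?cImM cRe_conj cIm_conj ?normc_sqr /=; ring.
Qed.

Lemma norm2_sqrD f g : L2 f -> L2 g ->
  norm2 (fun x => f x + g x) ^+ 2 = norm2 f ^+ 2 + 2 * re (inner f g) + norm2 g ^+ 2.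
Proof.
move=> hf hg; have hfg := L2_D hf hg.
have := inner_norm2 hfg; rewrite innerDr // (inner_conj hf) // (inner_conj hg) //.
rewrite !innerDr // !inner_norm2 // (inner_conj hf hg).
move=> /(congr1 re); rewrite !cReD !cRe_conj !cReD !cRe_conj /= => <-; ring.
Qed.

Lemma norm2Z c f : L2 f -> norm2 (fun x => c * f x) = nc c * norm2 f.
Proof.
move=> hf; apply/eqP; rewrite -(eqrXn2 (n := 2)) ?norm2_ge0 ?mulr_ge0 ?normc_ge0 ?norm2_ge0 //.
rewrite exprMn !norm2_sqr -lintZ; last by case: hf.
by apply/eqP; congr lint; apply/funext => x; rewrite normcM exprMn.
Qed.

Lemma cauchy_schwarz f g : L2 f -> L2 g -> nc (inner f g) <= norm2 f * norm2 g.
Proof.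
move=> hf hg; rewrite -(ler_pXn2r (n := 2)) ?nnegrE ?mulr_ge0 ?normc_ge0 ?norm2_ge0 //.
rewrite exprMn; set z := inner f g; set F := norm2 f ^+ 2; set G := norm2 g ^+ 2.
(* Scaling g by conj(z) makes the cross term the real number - 2 t |z|^2. *)
have key (t : R) : 0 <= F - 2 * t * nc z ^+ 2 + t ^+ 2 * nc z ^+ 2 * G.
  have := sqr_ge0 (norm2 (fun x => f x + (- t%:C * z^*) * g x)).
  rewrite (norm2_sqrD hf (L2_Z _ hg)).
  rewrite innerZr // norm2Z // -/z exprMn -/F -/G.
  rewrite !(normcM, normc_conj, normcN) exprMn.
  rewrite normc_real real_normK ?num_real //.
  rewrite (_ : re _ = - t * nc z ^+ 2); first by congr (0 <= _); ring.
  by rewrite normc_sqr !(cReM, cImM) cRe_conj cIm_conj /=; ring.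
have [G0|G0] := eqVneq G 0.
  have [->|z0] := eqVneq (nc z ^+ 2) 0; first by rewrite G0 mulr0.
  (* For G = 0 the expression is affine in t, and this t gives it the value -1. *)
  have := key ((F + 1) / (2 * nc z ^+ 2)); rewrite G0 mulr0 addr0.
  rewrite (_ : F - _ = -1); last first.
    by field; apply: contraNneq z0 => ->; rewrite expr0n.
  by rewrite ler0N1.
have Gp : 0 < G by rewrite lt_def G0 sqr_ge0.
have := key (G^-1); rewrite (_ : F - _ + _ = F - nc z ^+ 2 / G); last by field.
by rewrite subr_ge0 ler_pdivrMr.
Qed.

Lemma norm2_triangle f g : L2 f -> L2 g ->
  norm2 (fun x => f x + g x) <= norm2 f + norm2 g.
Proof.
move=> hf hg; rewrite -(ler_pXn2r (n := 2)) ?nnegrE ?addr_ge0 ?norm2_ge0 //.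
rewrite norm2_sqrD // sqrrD lerD2r lerD2l -[leRHS]mulr_natl ler_pM2l //.
apply: le_trans (cauchy_schwarz hf hg).
rewrite (le_trans (ler_norm _)) // -sqrtr_sqr; case: (inner f g) => a b /=.
by rewrite ler_wsqrtr // lerDl sqr_ge0.
Qed.

Lemma norm2_ext f g : f =1 g -> norm2 f = norm2 g.
Proof. by move=> /funext ->. Qed.

#[local] Opaque norm2 inner.

Lemma L2_lincomb e (c : nat -> R[i]) N : (forall i, L2 (e i)) ->
  L2 (fun x => \sum_(i < N) c i * e i x).
Proof. by move=> eL; apply: L2_sum => i; exact: (L2_Z (c i) (eL i)). Qed.

Lemma inner_lincombr e (c : nat -> R[i]) N f : (forall i, L2 (e i)) -> L2 f ->
  inner f (fun x => \sum_(i < N) c i * e i x) = \sum_(i < N) c i * inner f (e i).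
Proof.
move=> eL fL; rewrite (inner_sumr _ _ fL (F := fun i : 'I_N => fun x => c i * e i x)).
  by apply: eq_bigr => i _; exact: (innerZr (c i) fL (eL i)).
by move=> i; exact: (L2_Z (c i) (eL i)).
Qed.

Lemma inner_orthonormal_lincomb e (c : nat -> R[i]) N (i : 'I_N) : Defs.orthonormal e ->
  inner (e i) (fun x => \sum_(j < N) c j * e j x) = c i.
Proof.
move=> [eL eo]; rewrite (inner_lincombr c N eL (eL i)) (bigD1 i) //= eo eqxx mulr1.
rewrite big1 ?addr0 // => j ji.
by rewrite eo val_eqE eq_sym (negbTE ji) mulr0.
Qed.

Lemma norm2_sum_orthonormal e (c : nat -> R[i]) N :
  Defs.orthonormal e ->
  norm2 (fun x => \sum_(i < N) c i * e i x) ^+ 2 = \sum_(i < N) nc (c i) ^+ 2.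
Proof.
move=> oe; have eL := oe.1; have FL := L2_lincomb c N eL.
have := inner_norm2 FL; rewrite (inner_lincombr c N eL FL).
under eq_bigr => i _ do rewrite (inner_conj (eL i) FL) (inner_orthonormal_lincomb c i oe).
move=> /(congr1 re) /= <-; rewrite raddf_sum /=; apply: eq_bigr => i _.
by rewrite normc_sqr cReM cRe_conj cIm_conj; ring.
Qed.

Definition oproj e N f : R -> R[i] := fun x => \sum_(i < N) inner (e i) f * e i x.

Lemma L2_proj e N f : Defs.orthonormal e -> L2 (oproj e N f).
Proof. by move=> [eL _]; exact: (L2_lincomb (fun i => inner (e i) f) N eL). Qed.

Lemma norm2_proj_sqr e N f : Defs.orthonormal e ->
  norm2 (oproj e N f) ^+ 2 = \sum_(i < N) nc (inner (e i) f) ^+ 2.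
Proof. by move=> oe; exact: (norm2_sum_orthonormal (fun i => inner (e i) f) N oe). Qed.

Lemma bessel e N f : Defs.orthonormal e -> L2 f ->
  \sum_(i < N) nc (inner (e i) f) ^+ 2 <= norm2 f ^+ 2.
Proof.
move=> oe fL; have eL := oe.1; have pL := L2_proj N f oe.
have := sqr_ge0 (norm2 (fun x => f x + (-1) * oproj e N f x)).
rewrite (norm2_sqrD fL (L2_Z _ pL)) (norm2Z _ pL) (innerZr _ fL pL) exprMn (norm2_proj_sqr _ _ oe).
have -> : inner f (oproj e N f) = (\sum_(i < N) nc (inner (e i) f) ^+ 2)%:C.
  rewrite /oproj (inner_lincombr (fun i => inner (e i) f) N eL fL).
  rewrite rmorph_sum /=; apply: eq_bigr => i _; rewrite (inner_conj (eL i) fL).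
  by apply: complexP; rewrite ?cReM ?cImM ?cRe_conj ?cIm_conj ?normc_sqr /=; ring.
have -> : nc (-1) = 1 by rewrite normcN /= expr0n /= addr0 expr1n sqrtr1.
rewrite mulN1r expr1n mul1r; set S := \sum_(i < N) _.
by move=> /=; lra.
Qed.

Lemma norm2_proj e N f : Defs.orthonormal e -> L2 f -> norm2 (oproj e N f) <= norm2 f.
Proof.
move=> oe fL; rewrite -(ler_pXn2r (n := 2)) ?nnegrE ?norm2_ge0 //.
by rewrite (norm2_proj_sqr _ _ oe); exact: bessel.
Qed.

Lemma projD e N f g : Defs.orthonormal e -> L2 f -> L2 g ->
  oproj e N (fun x => f x + g x) = (fun x => oproj e N f x + oproj e N g x).
Proof.
move=> [eL _] fL gL; apply/funext => x; rewrite /oproj -big_split /=.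
by apply: eq_bigr => i _; rewrite (innerDr (eL i) fL gL) mulrDl.
Qed.

Lemma projZ e N c f : Defs.orthonormal e -> L2 f ->
  oproj e N (fun x => c * f x) = (fun x => c * oproj e N f x).
Proof.
move=> [eL _] fL; apply/funext => x; rewrite /oproj mulr_sumr.
by apply: eq_bigr => i _; rewrite (innerZr c (eL i) fL) mulrA.
Qed.

Lemma Re_normc c : `|re c| <= nc c.
Proof.
by case: c => a b /=; rewrite -(sqrtr_sqr a) ler_wsqrtr // lerDl sqr_ge0.
Qed.

Lemma Im_normc c : `|im c| <= nc c.
Proof.
by case: c => a b /=; rewrite -(sqrtr_sqr b) ler_wsqrtr // lerDr sqr_ge0.
Qed.

Lemma normc_le c : nc c <= `|re c| + `|im c|.
Proof.
rewrite -(ler_pXn2r (n := 2)) ?nnegrE ?addr_ge0 ?normc_ge0 //.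
rewrite normc_sqr sqrrD !real_normK ?num_real // addrAC lerDl.
by rewrite mulrn_wge0 // mulr_ge0.
Qed.

Lemma cReB c d : re (c - d) = re c - re d. Proof. by case: c; case: d. Qed.
Lemma cImB c d : im (c - d) = im c - im d. Proof. by case: c; case: d. Qed.

Lemma ccvgP (s : nat -> R[i]) (l : R[i]) :
  ccvg s l <-> (fun n => nc (s n - l)) @ \oo --> (0 : R).
Proof.
split=> [[/subr_cvg0 sr /subr_cvg0 si]|H].
  apply: (@squeeze_cvgr _ _ _ _ (fun=> 0) (fun n => `|re (s n) - re l| + `|im (s n) - im l|)).
  - by apply: nearW => n; rewrite normc_ge0 -cReB -cImB normc_le.
  - exact: cvg_cst.
  - by rewrite -(addr0 0); apply: cvgD; rewrite -(@normr0 _ R); exact: cvg_norm.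
split; apply/subr_cvg0/norm_cvg0P.
  apply: (squeeze_cvgr _ (cvg_cst _) H).
  by apply: nearW => n; rewrite normr_ge0 -cReB Re_normc.
apply: (squeeze_cvgr _ (cvg_cst _) H).
by apply: nearW => n; rewrite normr_ge0 -cImB Im_normc.
Qed.

Lemma ccvg_cst c : ccvg (fun=> c) c.
Proof. by split; exact: cvg_cst. Qed.

Lemma ccvgB (s t : nat -> R[i]) (l m : R[i]) : ccvg s l -> ccvg t m ->
  ccvg (fun n => s n - t n) (l - m).
Proof.
move=> [s1 s2] [t1 t2]; split.
  by under eq_fun do rewrite cReB; rewrite cReB; exact: cvgB.
by under eq_fun do rewrite cImB; rewrite cImB; exact: cvgB.
Qed.

Lemma ccvgZ c (s : nat -> R[i]) (l : R[i]) : ccvg s l -> ccvg (fun n => c * s n) (c * l).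
Proof.
move=> [s1 s2]; split.
  by under eq_fun do rewrite cReM; rewrite cReM; apply: cvgB; apply: cvgM => //; exact: cvg_cst.
by under eq_fun do rewrite cImM; rewrite cImM; apply: cvgD; apply: cvgM => //; exact: cvg_cst.
Qed.

Lemma ccvg_real (s : nat -> R) (l : R) : s @ \oo --> l -> ccvg (fun n => (s n)%:C) l%:C.
Proof. by move=> sl; split => //=; exact: cvg_cst. Qed.

Lemma inner_cvg f (s : nat -> R -> R[i]) g : L2 f -> (forall n, L2 (s n)) -> L2 g ->
  (fun n => norm2 (fun x => s n x + (-1) * g x)) @ \oo --> (0 : R) ->
  ccvg (fun n => inner f (s n)) (inner f g).
Proof.
move=> fL sL gL H; apply/ccvgP.
apply: (@squeeze_cvgr _ _ _ _ (fun=> 0) (fun n => norm2 f * norm2 (fun x => s n x + (-1) * g x))).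
- apply: nearW => n; rewrite normc_ge0 /=.
  have := cauchy_schwarz fL (L2_D (sL n) (L2_Z (-1) gL)).
  by rewrite (innerDr fL (sL n) (L2_Z (-1) gL)) (innerZr _ fL gL) mulN1r.
- exact: cvg_cst.
- by rewrite -(mulr0 (norm2 f)); apply: cvgM => //; exact: cvg_cst.
Qed.

End Hilbert.

(** * The Neumann series of the Jost solutions *)

Section Bounded.
Context {R : realType}.
Implicit Types (f g h : R -> R) (k : R -> R -> R).

Definition bdd f : Prop := measL f /\ exists C : R, forall x, `|f x| <= C.

Lemma bdd_cst (c : R) : bdd (fun=> c).
Proof. by split; [exact: measL_cst|exists `|c|]. Qed.

Lemma bdd_M f g : bdd f -> bdd g -> bdd (fun x => f x * g x).
Proof.
move=> [mf [C fC]] [mg [D gD]]; split; first exact: measL_M.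
by exists (C * D) => x; rewrite normrM ler_pM.
Qed.

Lemma bdd_Z (c : R) f : bdd f -> bdd (fun x => c * f x).
Proof. by apply: bdd_M; exact: bdd_cst. Qed.

Lemma bdd_if_le f1 f2 f3 f4 : measL f1 -> measL f2 -> bdd f3 -> bdd f4 ->
  bdd (fun x => if f1 x <= f2 x then f3 x else f4 x).
Proof.
move=> m1 m2 [m3 [C3 b3]] [m4 [C4 b4]]; split; first exact: measL_if_le.
exists (`|C3| + `|C4|) => x; case: ifP => _.
  by rewrite (le_trans (b3 x)) // (le_trans (ler_norm _)) // lerDl.
by rewrite (le_trans (b4 x)) // (le_trans (ler_norm _)) // lerDr.
Qed.

Lemma bdd_L1 f g : bdd f -> L1 g -> L1 (fun x => f x * g x).
Proof. by move=> [mf [C fC]]; exact: L1_bM fC. Qed.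

Lemma bdd_lint k h (C : R) : meas2 k -> (forall x y, `|k x y| <= C) -> L1 h ->
  bdd (fun x => lint (fun y => k x y * h y)).
Proof.
move=> mk kC hi; split; last first.
  by exists (C * lint (fun y => `|h y|)) => x; apply: lint_normM => //; exact: meas2_sec2.
by apply: measL_lint; apply: (meas2_M mk); apply: meas2_2; exact: L1_measL.
Qed.

(** Allows strict and non-strict cuts at y to be exchanged under the integral. *)
Lemma lint_point f g (y : R) : L1 f -> L1 g -> (forall z, z != y -> f z = g z) -> lint f = lint g.
Proof.
move=> fi gi fg; rewrite /lint /Rintegral; congr fine.
apply: (@ae_eq_integral _ (lebT R) R (leb R) setT (EFin \o g) (EFin \o f) measurableT).
- exact/measurable_EFinP/L1_measL.
- exact/measurable_EFinP/L1_measL.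
exists [set y]; split.
- by apply: sub_caratheodory; exact: (@measurable_set1 R y).
- exact: lebesgue_measure_set1.
move=> z /= nfg; apply/eqP/negPn/negP => zy; apply: nfg => _; by rewrite fg.
Qed.

End Bounded.

(** * Volterra iterates and products of Jost solutions *)

Section Volterra.
Context {R : realType} (kap : R) (w : R -> R).
Context (kap_gt0 : 0 < kap) (wi : L1 w).
Implicit Types (x y z : R) (h f : R -> R) (b : bool).

Definition before b x z : bool := if b then x < z else z < x.
(* [vop b] is the Volterra operator of the Jost equation after conjugation by
   e^{+-kx} (b = true for the sign +), with w = (V - Vinf) / (2k). *)
Definition vker b x z : R := (before b x z)%:R * (1 - expR (- (2 * kap * `|x - z|))).
Definition vop b h x : R := lint (fun z => vker b x z * (w z * h z)).
Definition vtail b x : R := lint (fun z => (before b x z)%:R * `|w z|).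

Lemma beforeE b x z : (before b x z)%:R =
  (if b then (if z <= x then 0 else 1) else (if x <= z then 0 else 1)) :> R.
Proof. by rewrite /before; case: b; rewrite ltNge; case: (_ <= _). Qed.

Lemma meas2_before b : meas2 (fun x z => (before b x z)%:R : R).
Proof.
have -> : (fun x z => (before b x z)%:R : R) = (fun x z =>
    if b then (if z <= x then 0 else 1) else (if x <= z then 0 else 1)).
  by apply/funext => x; apply/funext => z; exact: beforeE.
case: b.
  exact: (meas2_if_le meas2_snd meas2_fst (meas2_cst 0) (meas2_cst 1)).
exact: (meas2_if_le meas2_fst meas2_snd (meas2_cst 0) (meas2_cst 1)).
Qed.

Lemma before_le1 b x z : `|(before b x z)%:R : R| <= 1.
Proof. by case: before; rewrite ?normr0 ?normr1. Qed.

Lemma meas2_expdist (c : R) : meas2 (fun x z => expR (- (c * `|x - z|))).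
Proof.
have -> : (fun x z : R => expR (- (c * `|x - z|))) = (fun x z => expR (- c * `|x - z|)).
  by apply/funext => x; apply/funext => z; rewrite mulNr.
apply: meas2_expZ; apply: (@meas2_comp _ Num.norm (fun x y => x - y)); first exact: normr_measurable.
exact: (meas2_B meas2_fst meas2_snd).
Qed.

Lemma expdist_le1 (c : R) x z : 0 <= c -> expR (- (c * `|x - z|)) <= 1.
Proof. by move=> c0; rewrite -[X in _ <= X]expR0 ler_expR oppr_le0 mulr_ge0. Qed.

Lemma meas2_vker b : meas2 (vker b).
Proof. exact: (meas2_M (meas2_before b) (meas2_B (meas2_cst 1) (meas2_expdist _))). Qed.

Lemma vker_le b x z : `|vker b x z| <= (before b x z)%:R.
Proof.
have k2 : 0 <= 2 * kap by rewrite mulr_ge0 // ltW.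
rewrite /vker normrM ger0_norm ?ler0n // ler_piMr ?ler0n //.
have := expdist_le1 x z k2; have := expR_ge0 (- (2 * kap * `|x - z|)).
by move=> *; rewrite ger0_norm; lra.
Qed.

Lemma vker_le1 b x z : `|vker b x z| <= 1.
Proof. by rewrite (le_trans (vker_le b x z)) // (le_trans _ (before_le1 b x z)) // ler_norm. Qed.

Lemma vker_sym b x z : vker b x z = vker (~~ b) z x.
Proof. by rewrite /vker distrC /before; case: b. Qed.

Lemma bdd_wL1 h : bdd h -> L1 (fun z => w z * h z).
Proof. by move=> /bdd_L1/(_ wi); under eq_fun do rewrite mulrC. Qed.

Lemma bdd_vop b h : bdd h -> bdd (vop b h).
Proof. by move=> bh; apply: (bdd_lint (meas2_vker b) (vker_le1 b)); exact: bdd_wL1. Qed.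

Lemma vop_adj b h f : bdd h -> bdd f ->
  lint (fun x => w x * h x * vop b f x) = lint (fun x => w x * f x * vop (~~ b) h x).
Proof.
move=> bh bf; rewrite /vop (lint_bounded_kernel (meas2_vker b) (vker_le1 b)); try exact: bdd_wL1.
congr lint; apply/funext => y; congr (_ * lint _); apply/funext => x.
by rewrite vker_sym.
Qed.

Lemma wabs : L1 (fun z => `|w z|).
Proof. exact: L1_norm. Qed.

Lemma bdd_vtail b : bdd (vtail b).
Proof. exact: (bdd_lint (meas2_before b) (before_le1 b) wabs). Qed.

Lemma vtail_ge0 b x : 0 <= vtail b x.
Proof. by apply: lint_ge0 => z; rewrite mulr_ge0 // ler0n. Qed.

Lemma bdd_before b x : bdd (fun z => (before b x z)%:R : R).
Proof. by split; [exact: (meas2_sec2 x (meas2_before b))|exists 1 => z; exact: before_le1]. Qed.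

Lemma vtail_le b x : vtail b x <= lint (fun z => `|w z|).
Proof.
apply: lint_le; [exact: (bdd_L1 (bdd_before b x) wabs)|exact: wabs|].
by move=> z; rewrite ler_piMl //; case: before.
Qed.

Lemma bdd_X h n : bdd h -> bdd (fun x => h x ^+ n).
Proof.
move=> bh; elim: n => [|n IH]; first by under eq_fun do rewrite expr0; exact: bdd_cst.
by under eq_fun do rewrite exprS; exact: bdd_M.
Qed.

(** The interval between x and y is a difference of two half-lines; this keeps [vtailX] within
    integrals over half-lines. *)
Lemma before_split b x y z : z != y ->
  (before b z y)%:R * (before b x z)%:R =
    (before b x y)%:R * ((before b x z)%:R - (before b y z)%:R) :> R.
Proof.
rewrite /before; case: b => zy.
  case: (ltgtP z y) zy => // zy _; case: (ltP x z); case: (ltP x y) => /= *; lra.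
case: (ltgtP z y) zy => // zy _; case: (ltP z x); case: (ltP y x) => /= *; lra.
Qed.

(** Formally the integral of a derivative, but w is merely integrable, so the induction goes through
    Fubini. Expanding one tail in the integral X for exponent n + 1 and exchanging the integrals
    gives X = V^(n+1) / (n+1) V - X / (n+1), with V the tail at x. *)
Lemma vtailX b n x : lint (fun z => (before b x z)%:R * (`|w z| * vtail b z ^+ n)) =
  vtail b x ^+ n.+1 / n.+1%:R.
Proof.
have bX m : bdd (fun z => vtail b z ^+ m) by exact: (bdd_X _ (bdd_vtail b)).
have LX m : L1 (fun z => `|w z| * vtail b z ^+ m).
  by have := bdd_L1 (bX m) wabs; under eq_fun do rewrite mulrC.
have LB m y : L1 (fun z => (before b y z)%:R * (`|w z| * vtail b z ^+ m)).
  exact: (bdd_L1 (bdd_before b y) (LX m)).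
elim: n x => [|n IH] x.
  by rewrite divr1 expr1; congr lint; apply/funext => z; rewrite expr0 mulr1.
pose J y := lint (fun z => (before b y z)%:R * (`|w z| * vtail b z ^+ n)).
have JE y : J y = vtail b y ^+ n.+1 / n.+1%:R by exact: IH.
have step : lint (fun z => (before b x z)%:R * (`|w z| * vtail b z ^+ n.+1)) =
    lint (fun y => `|w y| * lint (fun z => (before b z y)%:R * ((before b x z)%:R * (`|w z| * vtail b z ^+ n)))).
  rewrite -(lint_bounded_kernel (meas2_before b) (before_le1 b)) //; last exact: wabs.
  congr lint; apply/funext => z; rewrite exprSr -/(vtail b z) !mulrA; congr (_ * _).
have Ey : (fun y => `|w y| * lint (fun z => (before b z y)%:R * ((before b x z)%:R * (`|w z| * vtail b z ^+ n)))) =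
    (fun y => J x * ((before b x y)%:R * `|w y|) - (n.+1%:R)^-1 * ((before b x y)%:R * (`|w y| * vtail b y ^+ n.+1))).
  apply/funext => y.
  have -> : lint (fun z => (before b z y)%:R * ((before b x z)%:R * (`|w z| * vtail b z ^+ n))) =
     lint (fun z => (before b x y)%:R * ((before b x z)%:R * (`|w z| * vtail b z ^+ n) -
        (before b y z)%:R * (`|w z| * vtail b z ^+ n))).
    apply: (@lint_point _ _ _ y).
    - have bb : bdd (fun z => (before b z y)%:R : R).
        by split; [exact: (meas2_sec1 y (meas2_before b))|exists 1 => z; exact: before_le1].
      exact: (bdd_L1 bb (LB n x)).
    - by apply: L1_Z; exact: (L1_B (LB n x) (LB n y)).
    by move=> z zy; rewrite mulrA before_split // -mulrA mulrBl.
  rewrite lintZ; last exact: (L1_B (LB n x) (LB n y)).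
  rewrite (lintB (LB n x) (LB n y)) -/(J x) -/(J y) (JE y); ring.
set X := lint _ in step *.
rewrite Ey in step; move: step; rewrite lintB; last 2 first.
- by apply: L1_Z; exact: (bdd_L1 (bdd_before b x) wabs).
- by apply: L1_Z; exact: LB.
rewrite lintZ; last exact: (bdd_L1 (bdd_before b x) wabs).
rewrite lintZ; last exact: LB.
rewrite -/(vtail b x) JE -/X => E0.
have n1 : n.+1%:R != 0 :> R by rewrite pnatr_eq0.
have n2 : n.+2%:R != 0 :> R by rewrite pnatr_eq0.
apply: (mulIf n2); rewrite divfK // -[n.+2]addn1 natrD mulrDr mulr1.
have gen (Y P Q d : R) : d != 0 -> Y = P / d * Q - d^-1 * Y -> Y * d + Y = P * Q.
  by move=> d0 EY; rewrite {1}EY; field.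
by rewrite addn1 exprSr; exact: gen.
Qed.

Lemma bdd_iter_vop b n h : bdd h -> bdd (iter n (vop b) h).
Proof. by move=> bh; elim: n => //= n IH; exact: bdd_vop. Qed.

(** The kernel is at most the indicator [before], so every iteration integrates one more power of
    the tail; [vtailX] then yields 1 / n!, the source of all later convergence. *)
Lemma iter_vop_le b n h (M : R) x : bdd h -> (forall y, `|h y| <= M) ->
  `|iter n (vop b) h x| <= M * (vtail b x ^+ n / n`!%:R).
Proof.
move=> bh hM; elim: n x => [|n IH] x /=; first by rewrite expr0 fact0 divr1 mulr1.
have bI := bdd_iter_vop b n bh.
have bX := bdd_X n (bdd_vtail b).
have LX : L1 (fun z => `|w z| * vtail b z ^+ n).
  by have := bdd_L1 bX wabs; under eq_fun do rewrite mulrC.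
have LV : L1 (fun z => vker b x z * (w z * iter n (vop b) h z)).
  apply: bdd_L1 (bdd_wL1 bI); split; first exact: (meas2_sec2 x (meas2_vker b)).
  by exists 1 => z; exact: vker_le1.
have n1 : n.+1%:R != 0 :> R by rewrite pnatr_eq0.
have f0 : n`!%:R != 0 :> R by rewrite pnatr_eq0 -lt0n fact_gt0.
rewrite (_ : M * _ = M / n`!%:R * (vtail b x ^+ n.+1 / n.+1%:R)); last first.
  by rewrite factS natrM invfM; ring.
rewrite -vtailX -lintZ; last exact: (bdd_L1 (bdd_before b x) LX).
apply: le_trans (lint_norm LV) _; apply: lint_le; first exact: L1_norm.
  by apply: L1_Z; exact: (bdd_L1 (bdd_before b x) LX).
move=> z; rewrite normrM [`|w z * _|]normrM.
rewrite (_ : M / _ * _ = (before b x z)%:R * (`|w z| * (M * (vtail b z ^+ n / n`!%:R)))); last by ring.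
by apply: ler_pM => //; [exact: vker_le|exact: ler_wpM2l].
Qed.

Definition jost b n : R -> R := iter n (vop b) (fun=> 1).
(* [jost_coef n] is Tr(Lambda^n(- K0)): see jost_green_rec and jost_green_diag,
   which are the recursions satisfied by these traces. *)
Definition jost_coef n : R := if n is m.+1 then lint (fun z => w z * jost true m z) else 1.

Arguments jost : simpl never.

Local Notation a := (jost true).
Local Notation c := (jost false).

Lemma bdd_jost b n : bdd (jost b n).
Proof. exact: (bdd_iter_vop b n (bdd_cst 1)). Qed.

Lemma jost0 b x : jost b 0 x = 1. Proof. by []. Qed.

Lemma jost_le b n x : `|jost b n x| <= lint (fun z => `|w z|) ^+ n / n`!%:R.
Proof.
have h1 y : `|(fun=> 1 : R) y| <= 1 :> R by rewrite normr1.
apply: le_trans (iter_vop_le b n x (bdd_cst 1) h1) _; rewrite mul1r.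
rewrite ler_wpM2r ?invr_ge0 ?ler0n // lerXn2r ?nnegrE ?vtail_ge0 ?vtail_le //.
by apply: lint_ge0 => z.
Qed.

(** The two Volterra operators are adjoint for the weight w ([vop_adj]), so iterations can be moved
    from c to a and only i + j matters. *)
Lemma jost_pair i j : lint (fun z => w z * (c j z * a i z)) = jost_coef (i + j).+1.
Proof.
elim: j i => [|j IH] i; first by rewrite addn0 /=; congr lint; apply/funext => z; rewrite /jost /= mul1r.
rewrite addnS -addSn -IH.
have := vop_adj false (bdd_jost true i) (bdd_jost false j).
rewrite (_ : (fun x => w x * a i x * vop false (c j) x) = (fun z => w z * (c j.+1 z * a i z))); last first.
  by apply/funext => z; rewrite /jost /=; ring.
by move=> ->; congr lint; apply/funext => z; rewrite /jost /=; ring.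
Qed.

Definition decay x z : R := expR (- (2 * kap * `|x - z|)).

Lemma bdd_decay y : bdd (decay y).
Proof.
split; first exact: (meas2_sec2 y (meas2_expdist _)).
exists 1 => z; rewrite ger0_norm ?expR_ge0 // expdist_le1 // mulr_ge0 // ltW //.
Qed.

Lemma decayC x y : decay x y = decay y x.
Proof. by rewrite /decay distrC. Qed.

Lemma decayM x y z : x <= y <= z -> decay x z = decay x y * decay y z.
Proof.
move=> /andP[xy yz]; rewrite /decay -expRD !ler0_norm ?subr_le0 // ?(le_trans xy) //.
by congr expR; ring.
Qed.

Lemma bdd_ltcut y f1 f2 : bdd f1 -> bdd f2 -> bdd (fun z => if z <= y then f1 z else f2 z).
Proof. exact: (bdd_if_le measL_id (measL_cst y)). Qed.

(** The Volterra kernel is 1 minus [decay]. These four functions integrate the two parts separately,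
    beyond y against a_i and up to y against c_j, so that every integral below becomes a combination
    of values at y. *)
Definition jtail i y := lint (fun z => (if z <= y then 0 else 1) * (w z * a i z)).
Definition jtail_decay i y := lint (fun z => (if z <= y then 0 else decay y z) * (w z * a i z)).
Definition jhead j y := lint (fun z => (if z <= y then 1 else 0) * (w z * c j z)).
Definition jhead_decay j y := lint (fun z => (if z <= y then decay y z else 0) * (w z * c j z)).

Lemma L1_cut y f1 f2 b i : bdd f1 -> bdd f2 ->
  L1 (fun z => (if z <= y then f1 z else f2 z) * (w z * jost b i z)).
Proof. by move=> b1 b2; apply: bdd_L1 (bdd_wL1 (bdd_jost b i)); exact: bdd_ltcut. Qed.

Let b0 := @bdd_cst R 0.
Let b1 := @bdd_cst R 1.

Lemma jostS_true i y : a i.+1 y = jtail i y - jtail_decay i y.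
Proof.
rewrite -lintB; last 2 first.
- exact: (L1_cut y true i b0 b1).
- exact: (L1_cut y true i b0 (bdd_decay y)).
rewrite /jost /= /vop; congr lint; apply/funext => z; rewrite -mulrBl; congr (_ * _).
by rewrite /vker beforeE -/(decay y z); case: ifP => _; ring.
Qed.

Lemma jostS_false j y : c j.+1 y = jhead j y - jhead_decay j y.
Proof.
rewrite -lintB; last 2 first.
- exact: (L1_cut y false j b1 b0).
- exact: (L1_cut y false j (bdd_decay y) b0).
rewrite /jost /= /vop; congr lint; apply/funext => z; rewrite -mulrBl; congr (_ * _).
rewrite /vker beforeE -/(decay y z); case: (ltgtP z y) => [_|_|->]; [by ring|by ring|].
(* At z = y the two parts of the kernel cancel, so the closed cut agrees with the strict one. *)
by rewrite /decay subrr normr0 mulr0 oppr0 expR0; ring.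
Qed.

Definition cut_pair j i y := lint (fun x => (if x <= y then 1 else 0) * (w x * (c j x * a i x))).

(** On the half-line x <= y the adjointness behind [jost_pair] fails by the contribution of z > y to
    a_(i+1)(x). There [decay x z] factors through y ([decayM]), so the defect is a sum of two
    products of integrals at y. *)
Lemma cut_pair_step j i y :
  cut_pair j i.+1 y - cut_pair j.+1 i y = jhead j y * jtail i y - jhead_decay j y * jtail_decay i y.
Proof.
pose ch z : R := if z <= y then 1 else 0.
pose fa z := ch z * (w z * a i z).
pose fc z := ch z * (w z * c j z).
have fai : L1 fa := L1_cut y true i b1 b0.
have fci : L1 fc := L1_cut y false j b1 b0.
have bk x : bdd (vker true x).
  by split; [exact: (meas2_sec2 x (meas2_vker true))|exists 1 => z; exact: vker_le1].
have split1 x : fc x * a i.+1 x =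
   fc x * lint (fun z => vker true x z * fa z) + (jtail i y * fc x - jtail_decay i y * (decay y x * fc x)).
  rewrite /fc /ch; case: ifP => xy; last by ring.
  have -> : a i.+1 x = lint (fun z => vker true x z * fa z) + (jtail i y - decay y x * jtail_decay i y).
    rewrite -lintZ; last exact: (L1_cut y true i b0 (bdd_decay y)).
    rewrite -lintB; last 2 first.
    - exact: (L1_cut y true i b0 b1).
    - by apply: L1_Z; exact: (L1_cut y true i b0 (bdd_decay y)).
    rewrite -lintD; last 2 first.
    - exact: (bdd_L1 (bk x) fai).
    - apply: L1_B; first exact: (L1_cut y true i b0 b1).
      by apply: L1_Z; exact: (L1_cut y true i b0 (bdd_decay y)).
    rewrite /jost /= /vop; congr lint; apply/funext => z; rewrite -/(a i z) /fa /ch.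
    rewrite /vker beforeE -/(decay x z); case: (leP z y) => zy; first by ring.
    have xz : x <= y <= z by rewrite xy ltW.
    by rewrite (lt_geF (le_lt_trans xy zy)) (decayM xz) (decayC y x); ring.
  by ring.
have E1 : cut_pair j i.+1 y = lint (fun x => fc x * lint (fun z => vker true x z * fa z)) +
    (jtail i y * jhead j y - jtail_decay i y * jhead_decay j y).
  have dfc : L1 (fun x => decay y x * fc x) := bdd_L1 (bdd_decay y) fci.
  have -> : jhead_decay j y = lint (fun x => decay y x * fc x).
    by congr lint; apply/funext => x; rewrite /fc /ch; case: ifP => _; ring.
  rewrite -[jhead j y]/(lint fc) -lintZ // -lintZ // -lintB; try exact: L1_Z.
  rewrite -lintD; last 2 first.
  - have bI : bdd (fun x => lint (fun z => vker true x z * fa z)).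
      exact: (bdd_lint (meas2_vker true) (vker_le1 true) fai).
    by have := bdd_L1 bI fci; under eq_fun do rewrite mulrC.
  - by apply: L1_B; exact: L1_Z.
  congr lint; apply/funext => x; rewrite -split1 /fc /ch; ring.
have E2 : lint (fun x => fc x * lint (fun z => vker true x z * fa z)) = cut_pair j.+1 i y.
  rewrite (lint_bounded_kernel (meas2_vker true) (vker_le1 true) fci fai).
  congr lint; apply/funext => z; rewrite /fa /ch; case: ifP => zy; last by rewrite !mul0r.
  rewrite !mul1r -mulrA; congr (_ * _); rewrite mulrC; congr (_ * _).
  rewrite /jost /= /vop; congr lint; apply/funext => x.
  rewrite vker_sym /=; have [xz|xz] := leP x z.
    by rewrite /fc /ch (le_trans xz zy) mul1r.
  by rewrite /vker /before ltNge (ltW xz) /= !mul0r.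
by rewrite E1 E2; ring.
Qed.

Lemma cut_pair0 m y : cut_pair 0 m y = jost_coef m.+1 - jtail m y.
Proof.
rewrite /= -lintB; last 2 first.
- exact: (bdd_wL1 (bdd_jost true m)).
- exact: (L1_cut y true m b0 b1).
by congr lint; apply/funext => z; rewrite /jost /=; case: ifP => _; ring.
Qed.

Lemma cut_pairm m y : cut_pair m 0 y = jhead m y.
Proof. by congr lint; apply/funext => z; rewrite jost0 mulr1. Qed.

(** Telescoping along i + j = m, from [cut_pair 0 m], which is [jost_coef] up to a tail, to
    [cut_pair m 0], which is a head. *)
Lemma jost_coef_cut m y : jost_coef m.+1 = jtail m y + jhead m y +
  \sum_(j < m) (jhead j y * jtail (m - j.+1) y - jhead_decay j y * jtail_decay (m - j.+1) y).
Proof.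
have tele n : (n <= m)%N -> cut_pair 0 m y - cut_pair n (m - n) y =
    \sum_(j < n) (jhead j y * jtail (m - j.+1) y - jhead_decay j y * jtail_decay (m - j.+1) y).
  elim: n => [|n IH] nm; first by rewrite subn0 subrr big_ord0.
  rewrite big_ord_recr /= -IH ?(ltnW nm) // -cut_pair_step -subSn // subSS; ring.
by rewrite -tele // subnn cut_pair0 cut_pairm; ring.
Qed.

(** The Wronskian of the two Jost solutions does not depend on y; this is that fact order by order
    in the coupling constant. The combination of [jhead] and [jtail_decay] is the one that
    [jost_green_rec] meets for x <= y. *)
Lemma jost_wronskian m y : jost_coef m.+1 = a m.+1 y +
  \sum_(j < m.+1) (jhead j y * a (m - j) y + c j y * jtail_decay (m - j) y).
Proof.
rewrite (jost_coef_cut m y) jostS_true sumrB big_split /=.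
rewrite [\sum_(j < m.+1) jhead j y * _]big_ord_recr /= subnn jost0 mulr1.
rewrite [\sum_(j < m.+1) c j y * _]big_ord_recl /= jost0 mul1r subn0.
have -> : \sum_(j < m) jhead j y * a (m - j) y =
    \sum_(j < m) jhead j y * jtail (m - j.+1) y - \sum_(j < m) jhead j y * jtail_decay (m - j.+1) y.
  by rewrite -sumrB; apply: eq_bigr => j _; rewrite -(subnSK (ltn_ord j)) jostS_true; ring.
have -> : \sum_(j < m) c (bump 0 j) y * jtail_decay (m - bump 0 j) y =
    \sum_(j < m) jhead j y * jtail_decay (m - j.+1) y - \sum_(j < m) jhead_decay j y * jtail_decay (m - j.+1) y.
  by rewrite -sumrB; apply: eq_bigr => j _; rewrite /bump /= add1n jostS_false; ring.
move: (\sum_(j < m) jhead j y * jtail _ y) (\sum_(j < m) jhead j y * jtail_decay _ y) (\sum_(j < m) jhead_decay j y * jtail_decay _ y).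
by move: (jtail m y) (jhead m y) (jtail_decay m y) => *; ring.
Qed.

(** The mirror form, with the decaying integral on the left, for the case y < x of
    [jost_green_rec]. *)
Lemma jost_wronskian' m y : jost_coef m.+1 = c m.+1 y +
  \sum_(j < m.+1) (jhead_decay j y * a (m - j) y + c j y * jtail (m - j) y).
Proof.
rewrite (jost_wronskian m y).
(* The sum telescopes in c_j a_(m+1-j); adding it converts one form of the Wronskian into the
   other. *)
have S : \sum_(j < m.+1) (c j y * a (m - j).+1 y - c j.+1 y * a (m - j) y) = a m.+1 y - c m.+1 y.
  rewrite sumrB big_ord_recl [X in _ - X]big_ord_recr /= subnn subn0 !jost0 mul1r mulr1.
  have -> : \sum_(i < m) c (bump 0 i) y * a (m - bump 0 i).+1 y = \sum_(j < m) c j.+1 y * a (m - j) y.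
    by apply: eq_bigr => j _; rewrite /bump /= add1n -subSn.
  by move: (\sum_(j < m) _) (a m.+1 y) (c m.+1 y) => *; ring.
have -> : a m.+1 y = c m.+1 y + \sum_(j < m.+1) (c j y * a (m - j).+1 y - c j.+1 y * a (m - j) y).
  by rewrite S addrC subrK.
rewrite -addrA -big_split /=; congr (_ + _); apply: eq_bigr => j _.
by rewrite jostS_true jostS_false; ring.
Qed.

(* The coefficients of det(I - z K0) times the Green's function of
   -d^2/dx^2 + k^2 + z (V - Vinf), expanded in powers of z: a product of two
   Jost solutions. *)
Definition jost_green n x y : R :=
  green kap x y * \sum_(j < n.+1) c j (Num.min x y) * a (n - j) (Num.max x y).

(** A detour through z costs e^(-2k d), where d is the distance from z to the interval [x, y]; the
    three cases are z left of it, inside it and right of it. *)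
Lemma green_mul x y z : x <= y -> green kap x z * (2 * kap * green kap z y) =
  green kap x y * (if z <= x then decay x z else if z <= y then 1 else decay y z).
Proof.
move=> xy; have k0 : kap != 0 by rewrite gt_eqF.
rewrite /green /decay (_ : _ * _ = (expR (- kap * `|x - z|) * expR (- kap * `|z - y|)) / (2 * kap)); last first.
  by field.
rewrite [RHS]mulrAC -expRD (ler0_norm (_ : x - y <= 0)) ?subr_le0 //.
have [zx|xz] := leP z x.
  rewrite -expRD ger0_norm ?subr_ge0 // ler0_norm ?subr_le0 ?(le_trans zx) //.
  by congr (expR _ / _); ring.
have [zy|yz] := leP z y.
  rewrite mulr1 ltr0_norm ?subr_lt0 // ler0_norm ?subr_le0 //.
  by congr (expR _ / _); ring.
rewrite -expRD ltr0_norm ?subr_lt0 // gtr0_norm ?subr_gt0 // ltr0_norm ?subr_lt0 //.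
by congr (expR _ / _); ring.
Qed.

(** The resolvent identity, order by order. [green_mul] extracts the factor g(x, y); the integrals
    cut at the point carrying the outer variable x recombine into the next Jost term there, and
    those cut at y are the sum in [jost_wronskian] or [jost_wronskian']. *)
Lemma jost_green_rec n x y :
  lint (fun z => green kap x z * (2 * kap * w z) * jost_green n z y) =
  jost_coef n.+1 * green kap x y - jost_green n.+1 x y.
Proof.
have [xy|yx] := leP x y.
  (* The middle piece x < z <= y is written as a difference of cuts at y and at x, so that only
     half-line integrals appear. *)
  pose T j z := a (n - j) y * (((if z <= x then decay x z else 0) * (w z * c j z) +
     (if z <= y then 1 else 0) * (w z * c j z)) - (if z <= x then 1 else 0) * (w z * c j z)) +
     c j y * ((if z <= y then 0 else decay y z) * (w z * a (n - j) z)).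
  have T1 j := L1_cut x false j (bdd_decay x) b0.
  have T2 j := L1_cut y false j b1 b0.
  have T3 j := L1_cut x false j b1 b0.
  have T4 j := L1_cut y true (n - j) b0 (bdd_decay y).
  have T12 j := L1_D (T1 j) (T2 j).
  have T123 j := L1_B (T12 j) (T3 j).
  have TL (j : nat) : L1 (T j) by exact: L1_D (L1_Z _ (T123 j)) (L1_Z _ (T4 j)).
  have TE (j : nat) : lint (T j) = a (n - j) y * (jhead j y - c j.+1 x) + c j y * jtail_decay (n - j) y.
    rewrite (lintD (L1_Z _ (T123 j)) (L1_Z _ (T4 j))) (lintZ _ (T123 j)) (lintZ _ (T4 j)).
    by rewrite (lintB (T12 j) (T3 j)) (lintD (T1 j) (T2 j)) jostS_false /jhead_decay /jhead /jtail_decay; ring.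
  transitivity (lint (fun z => green kap x y * \sum_(j < n.+1) T j z)).
    congr lint; apply/funext => z; rewrite /jost_green.
    rewrite (_ : _ * _ = green kap x z * (2 * kap * green kap z y) * (w z * \sum_(j < n.+1) c j (Num.min z y) * a (n - j) (Num.max z y))); last by ring.
    rewrite green_mul // -mulrA; congr (_ * _); rewrite mulrA mulr_sumr; apply: eq_bigr => j _.
    rewrite /T; have [zx|xz] := leP z x.
      by rewrite (le_trans zx xy) (min_l (le_trans zx xy)) (max_r (le_trans zx xy)); ring.
    have [zy|yz] := leP z y; first by ring.
    by ring.
  rewrite lintZ; last by apply: L1_sum => j; exact: TL.
  rewrite lint_sum; last by move=> j; exact: TL.
  rewrite (jost_wronskian n y) /jost_green (min_l xy) (max_r xy).
  rewrite [\sum_(j < n.+2) _]big_ord_recl /= ?subn0 jost0 mul1r.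
  under eq_bigr => j _ do rewrite (TE j).
  rewrite (mulrC (_ + _)) -mulrBr; congr (_ * _).
  rewrite opprD addrACA subrr add0r -sumrB; apply: eq_bigr => j _.
  by rewrite /bump /= add1n subSS; ring.
pose T j z := a (n - j) y * ((if z <= y then decay y z else 0) * (w z * c j z)) +
    c j y * (((if z <= y then 0 else 1) * (w z * a (n - j) z) -
      (if z <= x then 0 else 1) * (w z * a (n - j) z)) + (if z <= x then 0 else decay x z) * (w z * a (n - j) z)).
have T1 j := L1_cut y false j (bdd_decay y) b0.
have T2 j := L1_cut y true (n - j) b0 b1.
have T3 j := L1_cut x true (n - j) b0 b1.
have T4 j := L1_cut x true (n - j) b0 (bdd_decay x).
have T23 j := L1_B (T2 j) (T3 j).
have T234 j := L1_D (T23 j) (T4 j).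
have TL (j : nat) : L1 (T j) by exact: L1_D (L1_Z _ (T1 j)) (L1_Z _ (T234 j)).
have TE (j : nat) : lint (T j) = jhead_decay j y * a (n - j) y + c j y * (jtail (n - j) y - a (n - j).+1 x).
  rewrite (lintD (L1_Z _ (T1 j)) (L1_Z _ (T234 j))) (lintZ _ (T1 j)) (lintZ _ (T234 j)).
  by rewrite (lintD (T23 j) (T4 j)) (lintB (T2 j) (T3 j)) jostS_true /jhead_decay /jtail /jtail_decay; ring.
transitivity (lint (fun z => green kap x y * \sum_(j < n.+1) T j z)).
  congr lint; apply/funext => z; rewrite /jost_green.
  rewrite (_ : _ * _ = green kap y z * (2 * kap * green kap z x) * (w z * \sum_(j < n.+1) c j (Num.min z y) * a (n - j) (Num.max z y))); last first.
    by rewrite (green_sym kap y z) (green_sym kap z x); ring.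
  rewrite (green_mul z (ltW yx)) (green_sym kap y x) -mulrA; congr (_ * _).
  rewrite mulrA mulr_sumr; apply: eq_bigr => j _; rewrite /T.
  have [zy|yz] := leP z y; first by rewrite (le_trans zy (ltW yx)); ring.
  by have [zx|xz] := leP z x; ring.
rewrite lintZ; last by apply: L1_sum => j; exact: TL.
rewrite lint_sum; last by move=> j; exact: TL.
rewrite (jost_wronskian' n y) /jost_green (min_r (ltW yx)) (max_l (ltW yx)).
rewrite [\sum_(j < n.+2) _]big_ord_recr /= subnn jost0 mulr1.
under eq_bigr => j _ do rewrite (TE j).
  rewrite (mulrC (_ + _)) -mulrBr; congr (_ * _).
rewrite [X in _ - X]addrC opprD addrACA subrr add0r -sumrB; apply: eq_bigr => j _.
by rewrite subSn ?mulrBr ?addrA // -ltnS.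
Qed.

(** On the diagonal g is 1 / (2k), and by [jost_pair] the n + 1 products c_j a_(n-j) have the same
    integral; this is the factor n + 1 of Jacobi's formula. *)
Lemma jost_green_diag n :
  lint (fun x => 2 * kap * w x * jost_green n x x) = n.+1%:R * jost_coef n.+1.
Proof.
have k0 : kap != 0 by rewrite gt_eqF.
transitivity (lint (fun x => \sum_(j < n.+1) w x * (c j x * a (n - j) x))).
  congr lint; apply/funext => x; rewrite /jost_green minxx maxxx /green subrr normr0 mulr0 expR0.
  by rewrite -mulr_sumr; field.
rewrite lint_sum; last by move=> j; apply: bdd_wL1; apply: bdd_M; exact: bdd_jost.
rewrite (eq_bigr (fun=> jost_coef n.+1)); last first.
  by move=> j _; rewrite jost_pair subnK // -ltnS.
by rewrite sumr_const card_ord mulr_natl.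
Qed.

(** The bounds 1 / (j! (n-j)!) on the products sum to 2^n / n! by the binomial theorem. *)
Lemma jost_green_le n x y : `|jost_green n x y| <=
  (2 * kap)^-1 * ((2 * lint (fun z => `|w z|)) ^+ n / n`!%:R).
Proof.
set C := lint _.
have C0 : 0 <= C by apply: lint_ge0.
rewrite /jost_green normrM ler_pM ?normr_ge0 ?green_le //.
apply: le_trans (ler_norm_sum _ _ _) _.
apply: (@le_trans _ _ (\sum_(j < n.+1) C ^+ n / n`!%:R *+ 'C(n, j))).
  apply: ler_sum => j _; have jn : (j <= n)%N by rewrite -ltnS.
  have f3 : 'C(n, j)%:R != 0 :> R by rewrite pnatr_eq0 -lt0n bin_gt0.
  have <- : C ^+ j / j`!%:R * (C ^+ (n - j) / (n - j)`!%:R) = C ^+ n / n`!%:R *+ 'C(n, j).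
    rewrite -(bin_fact jn) -[RHS]mulr_natr mulrACA -exprD subnKC // -mulrA; congr (_ * _).
    by rewrite !natrM !invfM mulrAC mulVf // mul1r.
  by rewrite normrM; apply: ler_pM => //; exact: jost_le.
rewrite sumrMnr (_ : (\sum_(i < n.+1) 'C(n, i))%N = (2 ^ n)%N); last first.
  by rewrite -[2%N]/(1 + 1)%N expnDn; apply: eq_bigr => i _; rewrite !exp1n !muln1.
by rewrite exprMn -[leLHS]mulr_natl natrX mulrA.
Qed.

End Volterra.

(** * Absolutely continuous functions *)

Section DCT.
Context {R : realType}.

Lemma lint_dct (F : nat -> R -> R) (f g : R -> R) :
  (forall n, measL (F n)) -> (forall x, F n x @[n --> \oo] --> f x) ->
  (forall n x, `|F n x| <= g x) -> L1 g ->
  L1 f /\ (fun n => lint (F n)) @ \oo --> lint f.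
Proof.
move=> mF Ff Fg ig.
have mf : measL f.
  by apply: (@measurable_fun_cvg _ (lebT R) R setT (fun n => F n : lebT R -> R)) => // x _; exact: Ff.
have mFE n : measurable_fun [set: lebT R] (fun x : lebT R => (F n x)%:E).
  by apply/measurable_EFinP; exact: mF.
have mfE : measurable_fun [set: lebT R] (fun x : lebT R => (f x)%:E) by exact/measurable_EFinP.
have h1 : {ae leb R, forall x, [set: lebT R] x -> (F n x)%:E @[n --> \oo] --> (f x)%:E}.
  by apply: aeW => x _; apply/cvg_EFin; [exact: nearW|exact: Ff].
have h2 : {ae leb R, forall x n, [set: lebT R] x -> (`|(F n x)%:E| <= (g x)%:E)%E}.
  by apply: aeW => x n _; rewrite lee_fin; exact: Fg.
have [iF _ cF] := @dominated_convergence _ (lebT R) R (leb R) setT measurableT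
    (fun n x => (F n x)%:E) (fun x => (f x)%:E) (fun x => (g x)%:E) mFE mfE h1 ig h2.
split=> //; have fE : (\int[leb R]_x (f x)%:E = (lint f)%:E)%E by exact: lintE.
rewrite fE in cF; have /fine_cvgP[_] := cF.
by apply: cvg_trans; apply: near_eq_cvg; apply: nearW => n.
Qed.

End DCT.

Section NullCover.
Context {R : realType}.
Notation lam := (@lebesgue_measure R).

Lemma cara_borel (A : set R) : (@measurable _ (lebT R) A) ->
  exists B C : set R, [/\ @measurable _ (measurableTypeR R) B, @measurable _ (measurableTypeR R) C,
    lam C = 0%E, B `<=` A & A `<=` B `|` C].
Proof.
move=> mA.
have : (completed_algebra_gen lam).-sigma.-measurable A by rewrite completed_caratheodory_measurable.
rewrite g_sigma_completed_algebra_genE => -[B mB [N [C [mC C0 NC]]] <-].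
by exists B, C; split => // x [Bx|/NC Cx]; [left|right].
Qed.

Lemma null_cover (N : set R) (eps : R) : 0 < eps -> (leb R).-negligible N ->
  exists U : set R, [/\ open U, N `<=` U & (lam U < eps%:E)%E].
Proof.
move=> e0 [A [mA A0 NA]].
have [B [C [mB mC C0 BA ABC]]] := cara_borel mA.
have B0 : lam B = 0%E.
  by apply/eqP; rewrite eq_le measure_ge0 andbT -A0; exact: le_outer_measure.
have mBC : @measurable _ (measurableTypeR R) (B `|` C) by exact: measurableU.
have BC0 : lam (B `|` C) = 0%E by exact: (null_set_setU mB mC B0 C0).
have BCy : (lam (B `|` C) < +oo)%E by rewrite BC0 ltry.
have [U [oU BCU mU]] := @lebesgue_regularity_outer R _ _ mBC BCy e0.
exists U; split => // [x Nx|]; first by apply: BCU; apply: ABC; exact: NA.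
have mUR : @measurable _ (measurableTypeR R) U by exact: open_measurable.
have := @measureU2 _ _ _ lam (B `|` C) (U `\` (B `|` C)) mBC (measurableD mUR mBC).
rewrite setDUK // => le1; apply: (@le_lt_trans _ _ (0 + lam (U `\` (B `|` C)))%E).
  by rewrite -[X in (_ <= X + _)%E]BC0.
by rewrite add0e.
Qed.

Lemma is_derive0_le (D : R -> R) (c eps : R) : 0 < eps -> is_derive c 1 D 0 ->
  exists2 eta : R, 0 < eta & forall t, `|t - c| < eta -> `|D t - D c| <= eps * `|t - c|.
Proof.
move=> e0 /is_derive1_caratheodory[g [gE cg g0]].
have /cvgrPdist_le/(_ _ e0) := cg; rewrite g0 => -[eta /= eta0 H].
exists eta => // t tc; rewrite gE normrM ler_wpM2r //.
by have := H t; rewrite /= sub0r normrN; apply; rewrite distrC.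
Qed.

(* Continuous induction along [a, b]: around a point of N one adds an interval
   of a cover of N with small measure, on which absolute continuity controls
   the variation; around the other points the increment is at most eps times
   the length. *)
Lemma gauge_const (D : R -> R) (a b : R) (N : set R) : a <= b -> abs_cont a b D ->
  (leb R).-negligible N ->
  (forall x, a <= x <= b -> ~ N x -> is_derive x 1 D 0) -> D b = D a.
Proof.
move=> ab acD nN dD; apply/eqP; rewrite -subr_eq0 -normr_le0.
apply/ler_addgt0Pl => e e0; rewrite addr0.
(* The lengths will cost eps (b - a) and the exceptional intervals eps, in total e. *)
pose eps := e / (b - a + 1).
have ba1 : 0 < b - a + 1 by rewrite ltr_wpDl ?subr_ge0.
have eps0 : 0 < eps by rewrite divr_gt0.
have [del del0 acd] := acD eps eps0.
have [U [oU NU mU]] := null_cover del0 nN.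
have mUR : @measurable _ (measurableTypeR R) U by exact: open_measurable.
have mUi x : @measurable _ (measurableTypeR R) (U `&` `]a, x]) by exact: measurableI.
have lam_mono (X Y : set R) : X `<=` Y -> (lam X <= lam Y)%E.
  by move=> XY; exact: le_outer_measure.
pose m x := fine (lam (U `&` `]a, x])).
have fU x : lam (U `&` `]a, x]) \is a fin_num.
  rewrite ge0_fin_numE // (le_lt_trans _ (lt_trans mU (ltry _))) //.
  by apply: lam_mono; exact: subIsetl.
have m_del x : m x < del.
  rewrite -lte_fin fineK // (le_lt_trans _ mU) //.
  by apply: lam_mono; exact: subIsetl.
have m_mono x y : x <= y -> m x <= m y.
  move=> xy; apply: fine_le => //; apply: lam_mono.
  by apply: setIS; apply: subset_itvl; rewrite bnd_simp.
have m_add x y : a <= x -> x <= y -> `]x, y] `<=` U -> m x + (y - x) <= m y.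
  move=> ax xy xyU; rewrite -lee_fin EFinD fineK // fineK //.
  have -> : (y - x)%:E = lam `]x, y].
    by rewrite lebesgue_measure_itv /= lte_fin; case: ltgtP xy => // -> _; rewrite subrr.
  rewrite -measureU //; last first.
    apply/seteqP; split => // z [[_]]; rewrite /= !in_itv /= => /andP[_ zx] /andP[xz _].
    by rewrite ltNge zx in xz.
  apply: lam_mono.
  move=> z [[Uz]|]; rewrite /= !in_itv /=.
    by move=> /andP[az zx]; split=> //=; rewrite az (le_trans zx).
  move=> zxy; split; first by apply: xyU; rewrite /= in_itv.
  by case/andP: zxy => xz ->; rewrite (le_lt_trans ax).
(* The property propagated along [a, b]: the increment up to x is paid by eps times the length plus
   the variation over finitely many ordered intervals. Their total length is bounded by m x, the
   measure of the cover up to x, hence stays below del however many are added. *)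
pose P x := exists l : seq (R * R), [/\
   all (fun p => (a <= p.1) && (p.1 <= p.2) && (p.2 <= x)) l,
   pairwise (fun p q => p.2 <= q.1) l,
   `|D x - D a| <= eps * (x - a) + \sum_(p <- l) `|D p.2 - D p.1| &
   \sum_(p <- l) (p.2 - p.1) <= m x].
have step c : a <= c <= b -> exists2 eta : R, 0 < eta & forall x t, a <= x -> x <= c -> c <= t ->
    t <= b -> c - eta < x -> t < c + eta -> P x -> P t.
  move=> cab; have [Nc|nNc] := pselect (N c).
    have : nbhs c U by apply: open_nbhs_nbhs; split => //; exact: NU.
    rewrite -nbhs_ballE => -[eta /= eta0 BU]; exists eta => // x t ax xc ct tb cx tc [l [lin lpw lD lm]].
    have xt := le_trans xc ct.
    exists (rcons l (x, t)); split.
    - rewrite all_rcons /= ax xt lexx /=; apply: sub_all lin => p /andP[-> px] /=.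
      exact: le_trans xt.
    - rewrite pairwise_rcons lpw andbT; apply: sub_all lin => p /andP[_ px] /=; exact: px.
    - rewrite -cats1 big_cat big_seq1 /=.
      have -> : D t - D a = (D x - D a) + (D t - D x) by ring.
      apply: le_trans (ler_normD _ _) _; rewrite addrA lerD2r.
      by apply: le_trans lD _; rewrite lerD2r ler_pM2l // lerD2r.
    - rewrite -cats1 big_cat big_seq1 /=; apply: le_trans (m_add _ _ ax xt _).
        by rewrite lerD2r.
      move=> z; rewrite /= in_itv /= => /andP[xz zt]; apply: BU.
      by rewrite /ball /= ltr_norml; apply/andP; split; lra.
  have [eta eta0 H] := is_derive0_le eps0 (dD c cab nNc).
  exists eta => // x t ax xc ct tb cx tc [l [lin lpw lD lm]]; have xt := le_trans xc ct.
  exists l; split => //.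
  - by apply: sub_all lin => p /andP[-> px] /=; exact: le_trans xt.
  - have h1 : `|D t - D c| <= eps * (t - c).
      rewrite -[t - c]ger0_norm ?subr_ge0 //; apply: H; rewrite ger0_norm ?subr_ge0 //; lra.
    have h2 : `|D x - D c| <= eps * (c - x).
      rewrite -[c - x]ger0_norm ?subr_ge0 // distrC [leRHS]mulrC -mulrC distrC -[`|c - x|]distrC.
      by apply: H; rewrite ler0_norm ?subr_le0 //; lra.
    have -> : D t - D a = (D t - D c) - (D x - D c) + (D x - D a) by ring.
    apply: le_trans (ler_normD _ _) _.
    have := ler_normB (D t - D c) (D x - D c); move: h1 h2 lD; set S := \sum_(p <- l) _.
    by move=> *; nra.
  - exact: le_trans lm (m_mono _ _ xt).
have Pa : P a.
  by exists [::]; split => //; rewrite ?big_nil ?subrr ?normr0 ?mulr0 ?addr0 //; rewrite /m fine_ge0.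
pose S := [set x | a <= x <= b /\ P x].
have Sa : S a by split => //; rewrite lexx.
have Sub : ubound S b by move=> x [/andP[]].
have hS : has_sup S by split; [exists a|exists b].
pose c := sup S.
have ac : a <= c by exact: ub_le_sup (ex_intro _ b Sub) _ Sa.
have cb : c <= b by exact: ge_sup (ex_intro _ a Sa) Sub.
have [|eta eta0 H] := step c; first by rewrite ac cb.
have [x [/andP[ax xb] Px] cx] := sup_adherent eta0 hS.
have xc : x <= c by apply: (ub_le_sup (ex_intro _ b Sub)); split => //; rewrite ax.
have Pb : P b.
  have [bc|bc] := ltP b (c + eta); first exact: (H x b).
  have ch : c < c + eta / 2 by rewrite ltrDl divr_gt0.
  have : S (c + eta / 2).
    split; first by apply/andP; split; lra.
    by apply: (H x) => //; lra.
  move=> /(ub_le_sup (ex_intro _ b Sub)); rewrite -/c; lra.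
have [l [lin lpw lD lm]] := Pb.
apply: le_trans lD _.
pose s (i : 'I_(size l)) := (nth (0, 0) l i).1.
pose t (i : 'I_(size l)) := (nth (0, 0) l i).2.
have sumE (F : R * R -> R) : \sum_(p <- l) F p = \sum_(i < size l) F (s i, t i).
  by rewrite (big_nth (0, 0)) big_mkord; apply: eq_bigr => i _; rewrite /s /t -surjective_pairing.
have : \sum_(i < size l) `|D (t i) - D (s i)| < eps.
  apply: acd.
  - move=> i; have /allP/(_ (nth (0, 0) l i)) := lin; rewrite mem_nth // => /(_ isT).
    by move=> /andP[/andP[h1 h2] h3].
  - move=> i j ij.
    have /(pairwiseP (0, 0)) pw := lpw.
    case: (ltngtP i j) => [lt|lt|/val_inj eq]; last by rewrite eq eqxx in ij.
      by left; apply: (pw i j); rewrite ?inE.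
    by right; apply: (pw j i); rewrite ?inE.
  - by rewrite -(sumE (fun p => p.2 - p.1)) (le_lt_trans lm) // m_del.
rewrite (sumE (fun p => `|D p.2 - D p.1|)) /= => h.
rewrite (_ : e = eps * (b - a) + eps); last by rewrite /eps; field; rewrite gt_eqF.
by rewrite lerD2l ltW.
Qed.

End NullCover.

(** * The fundamental theorem of calculus for Lebesgue integrals *)

Section LebesgueFTC.
Context {R : realType}.
Notation lam := (@lebesgue_measure R).
Implicit Types (f g : R -> R).

Lemma ae_lebesgue (P : R -> Prop) : {ae lam, forall x, P x} -> {ae leb R, forall x, P x}.
Proof.
by move=> [A [mA A0 PA]]; exists A; split => //; exact: sub_caratheodory.
Qed.

Lemma ae_imp (P Q : R -> Prop) : (forall x, P x -> Q x) ->
  {ae leb R, forall x, P x} -> {ae leb R, forall x, Q x}.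
Proof. by move=> PQ; apply: negligibleS => x /= nQ Px; apply: nQ; exact: PQ. Qed.

Lemma ae_and (P Q : R -> Prop) : {ae leb R, forall x, P x} -> {ae leb R, forall x, Q x} ->
  {ae leb R, forall x, P x /\ Q x}.
Proof.
move=> nP nQ; apply: negligibleS (negligibleU nP nQ) => x /= nPQ.
by have [Px|nPx] := pselect (P x); [right=> Qx; exact: nPQ|left].
Qed.

Lemma lint_ae f g : measL f -> measL g -> {ae leb R, forall x, f x = g x} -> lint f = lint g.
Proof.
move=> mf mg fg; rewrite /lint /Rintegral; congr fine.
apply: (@ae_eq_integral _ (lebT R) R (leb R) setT (EFin \o g) (EFin \o f) measurableT).
- by apply/measurable_EFinP; exact: mf.
- by apply/measurable_EFinP; exact: mg.
by apply: ae_imp fg => x /= -> _.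
Qed.

Lemma L1_ae f g : L1 f -> measL g -> {ae leb R, forall x, f x = g x} -> L1 g.
Proof.
move=> fi mg fg; have mf := L1_measL fi.
apply/integrableP; split; first by apply/measurable_EFinP; exact: mg.
have /integrableP[_] := fi; congr (_ < _)%E.
apply: (@ae_eq_integral _ (lebT R) R (leb R) setT (fun x => `|(g x)%:E|)%E (fun x => `|(f x)%:E|)%E measurableT).
- by apply/measurable_EFinP; exact: measL_norm.
- by apply/measurable_EFinP; exact: measL_norm.
by apply: ae_imp fg => x /= -> _.
Qed.

(** Each set f < q with q rational contains a Borel set and exceeds it only inside a Borel null set;
    f is replaced by 0 on the union M of these countably many null sets. *)
Lemma borel_version f : measL f ->
  exists g, measurable_fun [set: measurableTypeR R] g /\ {ae leb R, forall x, f x = g x}.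
Proof.
move=> mf.
have mA (q : rat) : @measurable _ (lebT R) [set x | f x < ratr q].
  have := mf measurableT `]-oo, (ratr q)[%classic (measurable_itv _).
  by rewrite setTI; congr (measurable _); apply/seteqP; split => x /=; rewrite in_itv.
have BCq (q : rat) := cara_borel (mA q).
have /choice[B HB] := BCq.
have /choice[C HC] := HB.
pose C' n := if unpickle n is Some q then C q else set0.
pose M := \bigcup_n C' n.
have CE q : C' (pickle q) = C q by rewrite /C' pickleK.
have CM q : C q `<=` M by move=> x Cx; exists (pickle q); [exact: I|rewrite CE; exact: Cx].
have mM : @measurable _ (measurableTypeR R) M.
  apply: bigcupT_measurable => n; rewrite /C'; case: unpickle => [q|]; last exact: measurable0.
  by case: (HC q).
have M0 : lam.-negligible M.
  apply: negligible_bigcup => n; rewrite /C'; case: unpickle => [q|]; last exact: negligible_set0.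
  by have [_ mC C0 _ _] := HC q; exists (C q); split; [exact: mC|exact: C0|exact: subset_refl].
exists (fun x => if pselect (M x) then 0 else f x); split; last first.
  apply: ae_lebesgue; apply: negligibleS M0 => x /= nfg.
  by apply: contrapT => nM; apply: nfg; case: pselect.
apply: (measurability _ (RGenInftyO.measurableE R)) => // _ [_ [r ->] <-].
rewrite setTI.
(* Off M, being below r means f < q for a rational q < r, and there B q is the set f < q. On M the
   value is 0, and 0 < r is witnessed by a rational between. *)
have -> : (fun x => if pselect (M x) then 0 else f x) @^-1` `]-oo, r[ =
   \bigcup_(q : rat) (if ratr q < r then (B q `\` M) `|` (if 0 < (ratr q : R) then M else set0) else set0).
  apply/seteqP; split => x /=; rewrite in_itv /=.
    move=> xr; have [q /[!in_itv]/= /andP[xq qr]] := rat_in_itvoo xr; exists q => //=; rewrite qr.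
    case: pselect xq {xr} => [Mx|nMx] xq /=; first by right; rewrite xq.
    left; split => //; have [_ _ _ _ AB] := HC q; have /AB[//|Cx] : [set x | f x < ratr q] x by [].
    by exfalso; exact/nMx/(CM q).
  move=> [q _]; case: ifP => // qr [[Bx nMx]|].
    case: pselect => [//|? /=]; have [_ _ _ BA _] := HC q; have := BA _ Bx; rewrite /= => h.
    exact: lt_trans h qr.
  by case: ifP => // q0 Mx; case: pselect => [?|//] /=; exact: lt_trans q0 qr.
apply: bigcupT_measurable_rat => q; case: ifP => _; last exact: measurable0.
apply: measurableU; first by apply: measurableD => //; case: (HC q).
by case: ifP => _; [exact: mM|exact: measurable0].
Qed.

Definition primitive f (x : R) : R := lint (fun t => if t <= x then f t else 0).

Lemma L1_cutle f x : L1 f -> L1 (fun t => if t <= x then f t else 0).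
Proof.
move=> fi; apply: L1_le (L1_norm fi).
  by apply: (measL_if_le measL_id (measL_cst x) (L1_measL fi)); exact: measL_cst.
by move=> t; case: ifP => _ //; rewrite normr0.
Qed.

(** Lebesgue differentiation lives on the Borel line, so f is first replaced by a Borel version,
    which has the same primitive. *)
Lemma primitive_derive f : L1 f ->
  {ae leb R, forall x : R, is_derive x 1 (primitive f) (f x)}.
Proof.
move=> fi; have [g [mg fg]] := borel_version (L1_measL fi).
have mgL : measL g := measurableT_comp mg (@measurable_idfun_leb R).
have gi : L1 g by exact: L1_ae fi mgL fg.
have giB : lam.-integrable setT (EFin \o g).
  apply/integrableP; split; first exact/measurable_EFinP.
  have /integrableP[_] := gi; rewrite (@lint_borelE _ (fun x => `|(g x)%:E|%E)) //.
  by apply: measurableT_comp => //; exact/measurable_EFinP.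
have giy y : lam.-integrable `]-oo, y] (EFin \o g) by exact: integrableS giB.
have lg : locally_integrable setT g by exact: open_integrable_locally openT giB.
have E : primitive f = (fun x => \int[lam]_(t in [set` `]-oo, x]]) (g t)).
  apply/funext => x; transitivity (primitive g x).
    apply: lint_ae; try exact/L1_measL/L1_cutle.
    by apply: ae_imp fg => t ->.
  rewrite /primitive /lint /Rintegral [in RHS]integral_mkcond; congr fine.
  rewrite -lint_borelE.
    apply: eq_integral => t _; rewrite patchE; case: ifP => tx.
      by rewrite mem_set //= in_itv /= tx.
    by rewrite memNset //= in_itv /= tx.
  apply/(measurable_restrictT _ _).1 => //.
  exact: measurable_int (giy x).
have := ae_lebesgue (FTC1Ny giy lg); rewrite -E => H.
apply: ae_imp (ae_and H fg) => x [[dx ex] ->].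
by rewrite -ex derive1E; exact: derivableP.
Qed.

Lemma lint_cut_interval (a b : R) : a <= b ->
  L1 (fun t => if t <= a then 0 else if t <= b then 1 else 0) /\
  lint (fun t => if t <= a then 0 else if t <= b then 1 else 0) = b - a.
Proof.
move=> ab.
have E : (fun t : R => if t <= a then 0 else if t <= b then 1 else 0) = (cst (1 : R)) \_ `]a, b] :> (R -> R).
  apply/funext => t; rewrite patchE; case: (leP t a) => ta.
    by rewrite memNset //= in_itv /= ltNge ta.
  case: ifP => tb; first by rewrite mem_set //= in_itv /= ta tb.
  by rewrite memNset //= in_itv /= ta tb.
have mI : @measurable _ (measurableTypeR R) `]a, b] by exact: measurable_itv.
have mc : measurable_fun [set: measurableTypeR R] ((cst (1 : R)) \_ `]a, b] : R -> R).
  by apply/(measurable_restrictT _ _).1 => //; exact: measurable_cst.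
have I : (\int[lam]_x (((cst (1 : R)) \_ `]a, b] : R -> R) x)%:E = (b - a)%:E)%E.
  transitivity (\int[lam]_(x in `]a, b]) (cst 1%E x))%E.
    by rewrite [RHS]integral_mkcond; apply: eq_integral => x _; rewrite !patchE; case: ifP.
  have l1 : lam `]a, b] = (b - a)%:E.
    by rewrite lebesgue_measure_itv /= lte_fin; case: ltgtP ab => // -> _; rewrite subrr.
  by rewrite -l1 -[RHS]mul1e; exact: integral_cst.
rewrite E; have L : L1 ((cst (1 : R)) \_ `]a, b] : R -> R).
  apply: L1_borel; apply/integrableP; split; first exact/measurable_EFinP.
  have -> : (\int[lam]_x `|(((cst (1 : R)) \_ `]a, b] : R -> R) x)%:E| = (b - a)%:E)%E.
    by rewrite -I; apply: eq_integral => x _; rewrite gee0_abs // lee_fin patchE; case: ifP.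
  exact: ltry.
split=> //; apply/EFin_inj; rewrite -lintE // (@lint_borelE _ (fun x => (((cst (1 : R)) \_ `]a, b] : R -> R) x)%:E)) //.
exact/measurable_EFinP.
Qed.

Lemma primitiveB f (a b : R) : L1 f -> a <= b ->
  primitive f b - primitive f a = lint (fun t => (if t <= a then 0 else if t <= b then 1 else 0) * f t).
Proof.
move=> fi ab; rewrite -lintB; try exact: L1_cutle.
congr lint; apply/funext => t; case: (leP t a) => ta; last by case: ifP; rewrite ?mul1r ?mul0r ?subr0.
by rewrite (le_trans ta ab) subrr mul0r.
Qed.

Lemma lint_truncate f (eps : R) : L1 f -> 0 < eps ->
  exists n : nat, lint (fun t => if n%:R <= `|f t| then `|f t| else 0) < eps /\
    L1 (fun t => if n%:R <= `|f t| then `|f t| else 0).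
Proof.
move=> fi e0; pose F n t : R := if n%:R <= `|f t| then `|f t| else 0.
have mF n : measL (F n).
  apply: measL_if_le (measL_cst _) _ _ (measL_cst 0); exact: measL_norm (L1_measL fi).
have Fle n t : `|F n t| <= `|f t| by rewrite /F; case: ifP => _; rewrite ?normr0 ?normr_id.
have F0 t : F n t @[n --> \oo] --> (0 : R).
  apply: cvg_near_cst; near=> n; rewrite /F ifF //; apply/negbTE; rewrite -ltNge.
  near: n; exact: nbhs_infty_gtr.
have [_ c0] := lint_dct mF F0 Fle (L1_norm fi).
rewrite lint0 in c0; have /cvgrPdist_lt/(_ _ e0) := c0; move=> [n _ /(_ n)] /=.
rewrite sub0r normrN leqnn => /(_ isT) h; exists n; split.
  exact: le_lt_trans (ler_norm _) h.
exact: L1_le (mF n) (Fle n) (L1_norm fi).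
Unshelve. all: by end_near. Qed.

Lemma sum_cut_le1 (n : nat) (s t : 'I_n -> R) (x : R) :
  (forall i j, i != j -> t i <= s j \/ t j <= s i) ->
  \sum_(i < n) (if x <= s i then 0 else if x <= t i then 1 else 0) <= 1 :> R.
Proof.
move=> dis; have [[i /andP[xs xt]]|no] := pselect (exists i, (s i < x) && (x <= t i)).
  rewrite (bigD1 i) //= [X in _ + X]big1 ?addr0; first by rewrite (lt_geF xs) xt.
  move=> j ji; case: (leP x (s j)) => // sx; case: ifP => // xj.
  have [h|h] := dis _ _ ji; first by move: (lt_le_trans xs (le_trans xj h)); rewrite ltxx.
  by move: (lt_le_trans sx (le_trans xt h)); rewrite ltxx.
rewrite big1 // => i _; case: (leP x (s i)) => // sx; case: ifP => // xt.
by exfalso; apply: no; exists i; rewrite sx xt.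
Qed.

(** Where |f| >= n the integral is below eps / 2, and elsewhere |f| is at most n. The divisor n + 1
    covers n = 0. The delta serves intervals anywhere on the line; this uniformity is what
    [eigenfunction_bounded] relies on. *)
Lemma primitive_sum_small f (eps : R) : L1 f -> 0 < eps -> exists2 delta : R, 0 < delta &
  forall (n : nat) (s t : 'I_n -> R), (forall i, s i <= t i) ->
    (forall i j, i != j -> t i <= s j \/ t j <= s i) ->
    \sum_(i < n) (t i - s i) < delta ->
    \sum_(i < n) `|primitive f (t i) - primitive f (s i)| < eps.
Proof.
move=> fi e0; have e2 : 0 < eps / 2 by rewrite divr_gt0.
have [n [tn Ln]] := lint_truncate fi e2.
have n1 : 0 < n.+1%:R :> R by rewrite ltr0n.
exists (eps / 2 / n.+1%:R); first by rewrite divr_gt0.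
move=> N s t st dis len.
pose ch i x : R := if x <= s i then 0 else if x <= t i then 1 else 0.
have chL i : L1 (ch i) /\ lint (ch i) = t i - s i.
  exact: lint_cut_interval.
have bch i : bdd (ch i).
  exact: (bdd_ltcut (s i) (bdd_cst 0) (bdd_ltcut (t i) (bdd_cst 1) (bdd_cst 0))).
have chf i : L1 (fun x => ch i x * `|f x|) := bdd_L1 (bch i) (L1_norm fi).
have ch0 i x : 0 <= ch i x by rewrite /ch; case: ifP => // _; case: ifP.
apply: (@le_lt_trans _ _ (\sum_(i < N) lint (fun x => ch i x * `|f x|))).
  apply: ler_sum => i _; rewrite primitiveB //.
  apply: le_trans (lint_norm (bdd_L1 (bch i) fi)) _.
  by apply: lint_le; [exact: L1_norm (bdd_L1 (bch i) fi)|exact: chf|move=> x; rewrite normrM ger0_norm].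
rewrite -lint_sum //.
have Lsum : L1 (fun x => \sum_(i < N) ch i x) by apply: L1_sum => i; case: (chL i).
apply: (@le_lt_trans _ _ (lint (fun x => n%:R * (\sum_(i < N) ch i x) + (if n%:R <= `|f x| then `|f x| else 0)))).
  apply: lint_le; [exact: L1_sum|apply: L1_D => //; exact: L1_Z|].
  move=> x; rewrite -mulr_suml; have := sum_cut_le1 x dis; rewrite -/(ch _ x).
  have : 0 <= \sum_(i < N) ch i x by apply: sumr_ge0.
  rewrite -[X in X <= 1]/(\sum_(i < N) ch i x); move: (\sum_(i < N) ch i x) => S S0 S1.
  have f0 := normr_ge0 (f x); have n0 : 0 <= n%:R :> R by rewrite ler0n.
  have nS := mulr_ge0 n0 S0; have S1f : 0 <= (1 - S) * `|f x| by rewrite mulr_ge0 // subr_ge0.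
  case: (leP n%:R `|f x|) => h; first by lra.
  by have : 0 <= S * (n%:R - `|f x|); [rewrite mulr_ge0 // subr_ge0 ltW|lra].
rewrite lintD //; last exact: L1_Z.
rewrite lintZ // lint_sum; last by move=> i; case: (chL i).
rewrite (eq_bigr (fun i => t i - s i)); last by move=> i _; case: (chL i).
move: len; rewrite ltr_pdivlMr //; move: (\sum_(i < N) _) => S.
have : 0 <= n%:R :> R by rewrite ler0n.
move: tn; set X := lint _; move=> h1 h2 h3; rewrite [ltRHS]splitr.
have [S0|S0] := leP 0 S; first by rewrite mulrC; apply: ltrD => //; apply: le_lt_trans h3; rewrite ler_wpM2l // ler_nat.
by have := mulr_ge0_le0 h2 (ltW S0); lra.
Qed.

Lemma primitive_abs_cont f (a b : R) : L1 f -> abs_cont a b (primitive f).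
Proof.
move=> fi eps e0; have [d d0 H] := primitive_sum_small fi e0; exists d => // n s t st.
by apply: H => i; case: (st i) => _ [].
Qed.

Lemma abs_contB D1 D2 (a b : R) : abs_cont a b D1 -> abs_cont a b D2 ->
  abs_cont a b (fun x => D1 x - D2 x).
Proof.
move=> ac1 ac2 eps e0; have e2 : 0 < eps / 2 by rewrite divr_gt0.
have [d1 d10 H1] := ac1 _ e2; have [d2 d20 H2] := ac2 _ e2.
exists (Num.min d1 d2); first by rewrite lt_min d10.
move=> n s t st dis; rewrite lt_min => /andP[l1 l2].
have := ltrD (H1 n s t st dis l1) (H2 n s t st dis l2); rewrite -splitr; apply: le_lt_trans.
rewrite -big_split /=; apply: ler_sum => i _.
apply: le_trans (ler_normB _ _); rewrite (_ : D1 (t i) - D2 (t i) - _ = D1 (t i) - D1 (s i) - (D2 (t i) - D2 (s i))) //.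
by ring.
Qed.

(** D minus the primitive of f is absolutely continuous with derivative 0 almost everywhere, hence
    constant by [gauge_const]. *)
Lemma abs_cont_FTC D f (a b : R) : a <= b -> abs_cont a b D -> L1 f ->
  {ae leb R, forall x : R, a <= x <= b -> is_derive x 1 D (f x)} ->
  D b - D a = lint (fun t => (if t <= a then 0 else if t <= b then 1 else 0) * f t).
Proof.
move=> ab acD fi dD; rewrite -primitiveB //.
have [N nN HN] : exists2 N : set R, (leb R).-negligible N &
    forall x, a <= x <= b -> ~ N x -> is_derive x 1 (fun x => D x - primitive f x) 0.
  exists (~` [set x | (a <= x <= b -> is_derive x 1 D (f x)) /\ is_derive x 1 (primitive f) (f x)]).
    exact: ae_and dD (primitive_derive fi).
  move=> x abx /contrapT[/(_ abx) d1 d2]; rewrite -(subrr (f x)).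
  exact: is_deriveB.
have := gauge_const ab (abs_contB acD (primitive_abs_cont a b fi)) nN HN.
by move=> /eqP; rewrite subr_eq => /eqP ->; ring.
Qed.

End LebesgueFTC.

(** * The zero-energy eigenfunction *)

Section HalfGreenTransform.
Context {R : realType}.
Variables (k : R).
Hypothesis k0 : 0 < k.
Implicit Types (f h : R -> R).

Lemma bdd_halfgreen t : bdd (fun x => halfgreen k x t).
Proof.
split; first exact: meas2_sec1 (meas2_halfgreen k).
by exists 1 => x; exact: halfgreen_le1.
Qed.

Lemma bdd_halfgreen' t : bdd (fun x => halfgreen k t x).
Proof.
split; first exact: meas2_sec2 (meas2_halfgreen k).
by exists 1 => x; exact: halfgreen_le1.
Qed.

(** The transposed half-line kernel, that is (k + d/dx)^-1 applied to h. *)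
Definition hgint h (t : R) : R := lint (fun x => halfgreen k x t * h x).

Let mhg : meas2 (fun x y => halfgreen k y x).
Proof. exact: meas2_swap (meas2_halfgreen k). Qed.

Let hg1 x y : `|halfgreen k x y| <= 1.
Proof. exact: halfgreen_le1. Qed.

Lemma bdd_hgint h : L1 h -> bdd (hgint h).
Proof. exact: (@bdd_lint R (fun t x => halfgreen k x t) h 1 mhg (fun t x => hg1 x t)). Qed.

Lemma L1_hgint h : L1 h -> L1 (hgint h).
Proof.
move=> hL; have [||||_ _] := @lint_fubini R (fun y x => halfgreen k y x * h y) (fun y => k^-1 * `|h y|).
- exact: meas2_M (meas2_halfgreen k) (meas2_1 (L1_measL hL)).
- by move=> y; have [i _] := lint_halfgreen y k0; under eq_fun do rewrite mulrC; exact: L1_Z.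
- exact/L1_Z/L1_norm.
- move=> y; have [i e] := lint_halfgreen y k0.
  rewrite (_ : (fun x => _) = (fun x => `|h y| * halfgreen k y x)).
    by rewrite lintZ // e mulrC.
  by apply/funext => x; rewrite normrM ger0_norm ?halfgreen_ge0 // mulrC.
by [].
Qed.

Lemma lint_halfgreen_hgint h x : L1 h ->
  lint (fun t => halfgreen k x t * hgint h t) = lint (fun y => green k x y * h y).
Proof.
move=> hL; have [i e] := lint_halfgreen x k0.
rewrite (@lint_bounded_kernel R 1 (fun t y => halfgreen k y t) (halfgreen k x) h mhg (fun t y => hg1 y t) i hL).
congr lint; apply/funext => y; rewrite mulrC; congr (_ * h y).
by rewrite -(lint_halfgreenM x y k0); congr lint; apply/funext => t; exact: mulrC.
Qed.

Lemma lint_hgintM f h : L1 f -> L1 h ->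
  lint (fun t => hgint f t * hgint h t) = lint (fun x => f x * lint (fun y => green k x y * h y)).
Proof.
move=> fL hL; have HL := L1_hgint hL.
transitivity (lint (fun t => hgint h t * hgint f t)).
  by congr lint; apply/funext => t; rewrite mulrC.
rewrite (@lint_bounded_kernel R 1 (fun t x => halfgreen k x t) (hgint h) f mhg (fun t x => hg1 x t) HL fL).
congr lint; apply/funext => x; congr (_ * _); exact: lint_halfgreen_hgint.
Qed.

End HalfGreenTransform.

Lemma exp_coeff_squeeze (R : realType) (c q : R) (u_ : nat -> R) :
  (forall n, `|u_ n| <= c * exp_coeff q n) -> u_ @ \oo --> (0 : R).
Proof.
move=> uc; apply: norm_cvg0; apply: (squeeze_cvgr _ (cvg_cst 0) (h := fun n => c * exp_coeff q n)).
  by apply: nearW => n; rewrite normr_ge0 uc.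
rewrite -[X in _ --> X](mulr0 c); apply: cvgM; first exact: cvg_cst.
exact/cvg_series_cvg_0/is_cvg_series_exp_coeff.
Qed.

(** * Bounded solutions of first-order linear equations *)

Section HalfLineODE.
Context {R : realType}.
Variables (k : R).
Hypothesis k0 : 0 < k.
Implicit Types (D h : R -> R).

Lemma abs_contM_lip G D (a b C L M : R) : abs_cont a b D ->
  (forall x, a <= x <= b -> `|D x| <= M) -> (forall x, a <= x <= b -> `|G x| <= C) ->
  (forall s t, a <= s -> s <= t -> t <= b -> `|G t - G s| <= L * (t - s)) ->
  abs_cont a b (fun x => G x * D x).
Proof.
move=> acD DM GC GL eps e0.
have [ab|ba] := leP a b; last first.
  exists 1 => // n s t st _ _; rewrite big1 // => i _.
  by have [h1 [h2 h3]] := st i; have := le_trans h1 (le_trans h2 h3); rewrite leNgt ba.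
have M0 : 0 <= M by apply: le_trans (DM a _); rewrite ?normr_ge0 // lexx.
have C0 : 0 <= C by apply: le_trans (GC a _); rewrite ?normr_ge0 // lexx.
have C1 : 0 < C + 1 by rewrite ltr_wpDl.
pose L' := `|L| * M + 1.
have L1' : 0 < L' by rewrite ltr_wpDl // mulr_ge0.
have [d d0 H] := acD (eps / 2 / (C + 1)) (divr_gt0 (divr_gt0 e0 (@ltr0Sn R 1)) C1).
have e2 : 0 < eps / 2 by rewrite divr_gt0.
exists (Num.min d (eps / 2 / L')); first by rewrite lt_min d0 divr_gt0.
move=> n s t st dis; rewrite lt_min ltr_pdivlMr // => /andP[/(H n s t st dis) l1 l2].
apply: (@le_lt_trans _ _ (\sum_(i < n) ((C + 1) * `|D (t i) - D (s i)| + L' * (t i - s i)))).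
  apply: ler_sum => i _; have [h1 [h2 h3]] := st i.
  rewrite (_ : _ - _ = G (t i) * (D (t i) - D (s i)) + D (s i) * (G (t i) - G (s i))); last by ring.
  apply: le_trans (ler_normD _ _) _; rewrite !normrM; apply: lerD.
    by rewrite ler_wpM2r //; apply: le_trans (GC _ _) _; rewrite ?h3 ?(le_trans h1 h2) // lerDl.
  apply: le_trans (ler_pM _ _ (DM _ _) (GL _ _ h1 h2 h3)) _ => //.
    by rewrite h1 (le_trans h2 h3).
  have ts : 0 <= t i - s i by rewrite subr_ge0.
  rewrite mulrA ler_wpM2r // /L' mulrC; apply: (@le_trans _ _ (`|L| * M)).
    by rewrite ler_wpM2r // ler_norm.
  by rewrite lerDl.
rewrite big_split /= -!mulr_sumr [ltRHS]splitr; apply: ltrD; last by rewrite mulrC.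
by rewrite mulrC -ltr_pdivlMr.
Qed.

Lemma expR_lip (u v : R) : `|expR u - expR v| <= (expR u + expR v) * `|u - v|.
Proof.
wlog uv : u v / v <= u => [H|].
  have [|/ltW] := leP v u; first exact: H.
  by move=> /H; rewrite (distrC (expR v)) (addrC (expR v)) (distrC v u).
rewrite !ger0_norm ?subr_ge0 ?ler_expR //.
have := expR_ge1Dx (v - u); rewrite expRD expRN => h.
have u0 := expR_gt0 u; have v0 := expR_gt0 v.
have : expR u * (1 + (v - u)) <= expR v.
  by have := ler_wpM2l (ltW u0) h; rewrite (mulrC (expR v)) mulrA mulfV ?gt_eqF // mul1r.
have := mulr_ge0 (ltW v0) (_ : 0 <= u - v); rewrite subr_ge0 => /(_ uv); lra.
Qed.

Lemma abs_contM_exp D (a b c e M : R) : abs_cont a b D -> (forall x, `|D x| <= M) ->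
  abs_cont a b (fun x => expR (c * (x - e)) * D x).
Proof.
move=> acD DM.
pose K := `|c| * (`|a - e| + `|b - e|).
have B x : a <= x <= b -> expR (c * (x - e)) <= expR K.
  move=> /andP[ax xb]; rewrite ler_expR; apply: le_trans (ler_norm _) _.
  rewrite normrM /K ler_wpM2l // ler_norml.
  have := ler_norm (b - e); have := ler_norm (- (a - e)); rewrite normrN.
  have := normr_ge0 (b - e); have := normr_ge0 (a - e).
  by move=> h1 h2 h3 h4; apply/andP; split; lra.
apply: (@abs_contM_lip _ _ _ _ (expR K) ((expR K + expR K) * `|c|) M) => //.
  by move=> x /B; rewrite ger0_norm ?expR_ge0.
move=> s t as_ st tb; apply: le_trans (expR_lip _ _) _.
rewrite -mulrBr opprB addrA subrK normrM (ger0_norm (_ : 0 <= t - s)) ?subr_ge0 // mulrA.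
rewrite ler_wpM2r ?subr_ge0 // ler_wpM2r // lerD // B ?as_ ?tb ?(le_trans as_ st) //.
by rewrite (le_trans st tb).
Qed.

Lemma expRN_cvg0 (c : R) : 0 < c -> (fun n => expR (- (c * n%:R))) @ \oo --> (0 : R).
Proof.
move=> c0; have : (fun n => expR (- c) ^+ n) @ \oo --> (0 : R).
  by apply: cvg_expr; rewrite ger0_norm ?expR_ge0 // -[ltRHS]expR0 ltr_expR oppr_lt0.
by apply: cvg_trans; apply: near_eq_cvg; apply: nearW => n; rewrite -expRM_natr mulNr.
Qed.

Lemma is_derive_expM D (c e x d : R) : is_derive x 1 D d ->
  is_derive x 1 (fun x => expR (c * (x - e)) * D x) (expR (c * (x - e)) * (c * D x + d)).
Proof.
move=> dD.
have dl : is_derive x (1 : R) (fun y : R => c * (y - e)) c.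
  have := is_deriveZ c (is_deriveB (is_derive_id x (1 : R)) (is_derive_cst e x (1 : R))).
  by rewrite subr0 /GRing.scale /= mulr1.
have de : is_derive x (1 : R) (fun y : R => expR (c * (y - e))) (c * expR (c * (x - e))).
  by have := @is_derive1_comp R expR (fun y => c * (y - e)) x _ _ (is_derive_expR (c * (x - e))) dl; rewrite mulrC.
suff : is_derive x (1 : R) ((fun y : R => expR (c * (y - e))) * D) (expR (c * (x - e)) * (c * D x + d)) by [].
by apply: (is_derive_eq (is_deriveM de dD)); rewrite /GRing.scale /=; ring.
Qed.

Let exp_bounded_cvg0 D (M : R) (x_ : nat -> R) : (forall x, `|D x| <= M) ->
  (fun n => expR (- (k * n%:R)) * D (x_ n)) @ \oo --> (0 : R).
Proof.
move=> DM; have e0 : (fun n => expR (- (k * n%:R)) * M) @ \oo --> (0 : R).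
  by rewrite -(mul0r M); apply: cvgM; [exact: expRN_cvg0|exact: cvg_cst].
apply: norm_cvg0; apply: (squeeze_cvgr _ (cvg_cst 0) e0).
by apply: nearW => n; rewrite normr_ge0 normrM ger0_norm ?expR_ge0 // ler_wpM2l // expR_ge0.
Qed.

Let cut_le (s t z g : R) : `|(if z <= s then 0 else if z <= t then 1 else 0) * g| <= `|g|.
Proof.
case: ifP => _; first by rewrite mul0r normr0.
by case: ifP => _; rewrite ?mul1r // mul0r normr0.
Qed.

Let measL_cut (s t : R) (g : R -> R) : measL g ->
  measL (fun x => (if x <= s then 0 else if x <= t then 1 else 0) * g x).
Proof.
apply: measL_M; apply: measL_if_le measL_id (measL_cst _) (measL_cst 0) _.
exact: measL_if_le measL_id (measL_cst _) (measL_cst 1) (measL_cst 0).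
Qed.

(** Variation of constants from t - n to t. Boundedness of D makes the boundary term e^(-kn) D(t -
    n) vanish, which excludes the homogeneous solution e^(-kx). *)
Lemma ode_left D h (M t : R) : AC_loc D -> (forall x, `|D x| <= M) -> L1 h ->
  {ae leb R, forall x : R, is_derive x 1 D (h x - k * D x)} ->
  D t = lint (fun x => halfgreen k x t * h x).
Proof.
move=> acD DM hi dD.
have gi : L1 (fun x => halfgreen k x t * h x) by exact: bdd_L1 (bdd_halfgreen k0 t) hi.
pose F n x := (if x <= t - n%:R then 0 else if x <= t then 1 else 0) * (halfgreen k x t * h x).
have FE n : lint (F n) = D t - expR (- (k * n%:R)) * D (t - n%:R).
  rewrite /F -(@abs_cont_FTC _ (fun x => expR (k * (x - t)) * D x)) //.
  - by rewrite subrr mulr0 expR0 mul1r (_ : t - n%:R - t = - n%:R) ?mulrN //; ring.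
  - by rewrite lerBlDr lerDl.
  - exact: abs_contM_exp (acD _ _) DM.
  apply: ae_imp dD => x /(is_derive_expM k t) dx /andP[_ xt].
  apply: is_derive_eq; rewrite /halfgreen xt (_ : - (k * (t - x)) = k * (x - t)); last by ring.
  by ring.
have Fcvg x : F n x @[n --> \oo] --> halfgreen k x t * h x.
  apply: cvg_near_cst; near=> n; rewrite /F ifF.
    by case: ifP => xt; rewrite ?mul1r // /halfgreen xt !mul0r.
  apply/negbTE; rewrite -ltNge ltrBlDr -ltrBlDl; near: n; exact: nbhs_infty_gtr.
have mF n : measL (F n) := measL_cut _ _ (L1_measL gi).
have FL n x : `|F n x| <= `|halfgreen k x t * h x| := cut_le _ _ _ _.
have [_ c1] := lint_dct mF Fcvg FL (L1_norm gi).
have c2 : (fun n => lint (F n)) @ \oo --> D t.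
  rewrite (_ : (fun n => lint (F n)) = (fun n => D t - expR (- (k * n%:R)) * D (t - n%:R))); last exact/funext.
  rewrite -[X in _ --> X]subr0; apply: cvgB; first exact: cvg_cst.
  exact: exp_bounded_cvg0 DM.
exact: (cvg_unique _ c2 c1).
Unshelve. all: by end_near. Qed.

(** Here the homogeneous solution e^(kx) must be excluded, so the integration runs to +oo. *)
Lemma ode_right D h (M t : R) : AC_loc D -> (forall x, `|D x| <= M) -> L1 h ->
  {ae leb R, forall x : R, is_derive x 1 D (h x + k * D x)} ->
  D t = - lint (fun x => halfgreen k t x * h x).
Proof.
move=> acD DM hi dD.
have gi : L1 (fun x => halfgreen k t x * h x) by exact: bdd_L1 (bdd_halfgreen' k0 t) hi.
pose F n x := (if x <= t then 0 else if x <= t + n%:R then 1 else 0) * (halfgreen k t x * h x).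
have FE n : lint (F n) = expR (- (k * n%:R)) * D (t + n%:R) - D t.
  rewrite /F -(@abs_cont_FTC _ (fun x => expR (- k * (x - t)) * D x)) //.
  - by rewrite subrr mulr0 expR0 mul1r (_ : t + n%:R - t = n%:R) ?mulNr //; ring.
  - by rewrite lerDl.
  - exact: abs_contM_exp (acD _ _) DM.
  apply: ae_imp dD => x /(is_derive_expM (- k) t) dx /andP[tx _].
  apply: is_derive_eq; rewrite /halfgreen tx mulNr.
  by ring.
pose g x := if x <= t then 0 else halfgreen k t x * h x.
have gL : L1 g.
  apply: L1_le (L1_norm gi).
    by apply: measL_if_le measL_id (measL_cst _) (measL_cst 0) (L1_measL gi).
  by move=> x; rewrite /g; case: ifP => // _; rewrite normr0.
have Fcvg x : F n x @[n --> \oo] --> g x.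
  apply: cvg_near_cst; near=> n; rewrite /F /g; case: ifP => xt; first by rewrite mul0r.
  rewrite ifT ?mul1r // -lerBlDl ltW //; near: n; exact: nbhs_infty_gtr.
have mF n : measL (F n) := measL_cut _ _ (L1_measL gi).
have FL n x : `|F n x| <= `|halfgreen k t x * h x| := cut_le _ _ _ _.
have [_ c1] := lint_dct mF Fcvg FL (L1_norm gi).
have gE : lint g = lint (fun x => halfgreen k t x * h x).
  apply: (lint_point gL gi (y := t)) => x xt; rewrite /g /halfgreen; case: (ltgtP x t) xt => // xt _.
  by rewrite mul0r.
have c2 : (fun n => lint (F n)) @ \oo --> - D t.
  rewrite (_ : (fun n => lint (F n)) = (fun n => expR (- (k * n%:R)) * D (t + n%:R) - D t)); last exact/funext.
  rewrite -[X in _ --> X]sub0r; apply: cvgB; last exact: cvg_cst.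
  exact: exp_bounded_cvg0 DM.
by rewrite -gE -(cvg_unique _ c2 c1) // opprK.
Unshelve. all: by end_near. Qed.

End HalfLineODE.

Lemma meas2_sum (R : realType) (I : Type) (r : seq I) (P : pred I) (K : I -> R -> R -> R) :
  (forall i, meas2 (K i)) -> meas2 (fun x y => \sum_(i <- r | P i) K i x y).
Proof.
move=> mK; elim: r => [|i r IH].
  rewrite (_ : (fun x y => _) = (fun _ _ => 0)); first exact: meas2_cst.
  by apply/funext => x; apply/funext => y; rewrite big_nil.
rewrite (_ : (fun x y => _) = (fun x y => (if P i then K i x y else 0) + \sum_(i <- r | P i) K i x y)).
  by apply: meas2_D IH; case: (P i) => //; exact: meas2_cst.
by apply/funext => x; apply/funext => y; rewrite big_cons; case: (P i); rewrite ?add0r.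
Qed.

Lemma meas2_jost_green (R : realType) (k : R) (w : R -> R) (n : nat) : 0 < k -> L1 w ->
  meas2 (jost_green k w n).
Proof.
move=> k0 wL; have mj b i := proj1 (bdd_jost k0 wL b i).
apply: meas2_M (meas2_green k) _; apply: meas2_sum => j; apply: meas2_M.
  rewrite (_ : (fun x y => _) = (fun x y => if x <= y then jost k w false j x else jost k w false j y)).
    exact: meas2_if_le meas2_fst meas2_snd (meas2_1 (mj _ _)) (meas2_2 (mj _ _)).
  by apply/funext => x; apply/funext => y; case: leP.
rewrite (_ : (fun x y => _) = (fun x y => if x <= y then jost k w true (n - j) y else jost k w true (n - j) x)).
  exact: meas2_if_le meas2_fst meas2_snd (meas2_2 (mj _ _)) (meas2_1 (mj _ _)).
by apply/funext => x; apply/funext => y; case: leP.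
Qed.

(** * Boundedness, integral equation and energy of the eigenfunction *)

Section Eigenfunction.
Context {R : realType}.
Variables (k : R) (W f : R -> R).
Hypothesis k0 : 0 < k.
Hypothesis WL : L1 W.
Hypothesis mf : measL f.
Hypothesis f2 : L1 (fun x => f x ^+ 2).
Hypothesis acf : AC_loc f.
Hypothesis df : forall x : R, derivable f x 1.
Hypothesis acdf : AC_loc (derive1 f).
Hypothesis eqf : {ae leb R, forall x : R, derivable (derive1 f) x 1 /\
  0 = - derive1 (derive1 f) x + (W x + k ^+ 2) * f x}.

Let dfE (x : R) : is_derive x 1 f (derive1 f x).
Proof. by rewrite derive1E; apply: derivableP; exact: df. Qed.

Let cf (a b : R) : {within `[a, b], continuous f}.
Proof. by apply: derivable_within_continuous => x _; exact: df. Qed.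

Let ddfE : {ae leb R, forall x : R, is_derive x 1 (derive1 f) ((W x + k ^+ 2) * f x)}.
Proof.
apply: ae_imp eqf => x [dd /eqP]; rewrite eq_sym addrC subr_eq0 => /eqP ->.
by rewrite derive1E; exact: derivableP.
Qed.

Let mvt (a b : R) : a < b -> exists2 c, a < c < b & f b - f a = derive1 f c * (b - a).
Proof.
move=> ab; have [c cab E] := @MVT R f (derive1 f) a b ab (fun x _ => dfE x) (@cf a b).
by exists c => //; move: cab; rewrite in_itv.
Qed.

Lemma cut_ge0 (a b x : R) : 0 <= (if x <= a then 0 else if x <= b then 1 else 0) :> R.
Proof. by case: ifP => // _; case: ifP. Qed.

(** Chebyshev: otherwise f^2 would exceed the right side on an interval of length d, and its
    integral would be too large. *)
Lemma small_point (a d : R) : 0 < d -> exists2 p, a <= p <= a + d &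
  f p ^+ 2 <= (lint (fun x => f x ^+ 2) + 1) / d.
Proof.
move=> d0; apply: contrapT => no.
have [iL iE] := lint_cut_interval (ltW (ltr_pwDr d0 (lexx a))).
pose c := (lint (fun x => f x ^+ 2) + 1) / d.
have : c * d <= lint (fun x => f x ^+ 2).
  rewrite [X in _ * X](_ : d = a + d - a); last by ring.
  rewrite -iE -lintZ //; apply: lint_le => //; first exact: L1_Z.
  move=> x; case: (leP x a) => xa; first by rewrite mulr0 sqr_ge0.
  case: (leP x (a + d)) => xd; last by rewrite mulr0 sqr_ge0.
  rewrite mulr1 leNgt; apply/negP => h; apply: no; exists x; last exact: ltW.
  by rewrite (ltW xa).
by rewrite /c divfK ?gt_eqF //; lra.
Qed.

(* On intervals so short that the variation of f' is at most half of max |f|,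
   two points with |f| = O(||f||_2) at distance >= d bound f' somewhere, hence f
   and f' everywhere on the interval. *)
Lemma eigenfunction_bounded : exists M : R, forall x, `|f x| <= M /\ `|derive1 f x| <= M.
Proof.
have k2 : 0 < k ^+ 2 by rewrite exprn_gt0.
have q0 : (0 : R) < 1 / 4 by rewrite divr_gt0.
have [d0 d00 H0] := primitive_sum_small (L1_norm WL) q0.
(* Any interval of length at most 3 d < d0 carries less than 1/4 of |W|, and k^2 times that length
   is at most 1/4, so f' varies by at most S / 2 there. The bound 1/3 allows 3 d S / 2 to be
   absorbed into S. *)
pose d := Num.min (Num.min (d0 / 4) (1 / 3)) (1 / (12 * k ^+ 2)).
have d_gt0 : 0 < d by rewrite !lt_min !divr_gt0 // mulr_gt0.
have d1 : d <= d0 / 4 by rewrite /d !ge_min lexx.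
have d2 : d <= 1 / 3 by rewrite /d !ge_min lexx orbT.
have d3 : 3 * d * k ^+ 2 <= 1 / 4.
  have : d <= 1 / (12 * k ^+ 2) by rewrite /d ge_min lexx orbT.
  by rewrite ler_pdivlMr ?mulr_gt0 //; lra.
pose m := Num.sqrt ((lint (fun x => f x ^+ 2) + 1) / d).
have m0 : 0 <= m by exact: sqrtr_ge0.
have mE (p : R) : f p ^+ 2 <= (lint (fun x => f x ^+ 2) + 1) / d -> `|f p| <= m.
  by move=> h; rewrite -sqrtr_sqr; exact: ler_wsqrtr.
(* The 14 comes from S <= m + 3 d (2 m / d + S / 2) <= 7 m + S / 2. *)
suff main (a : R) : `|f a| <= 14 * m /\ `|derive1 f a| <= 2 * m / d + 7 * m.
  exists (14 * m + 2 * m / d) => x; have [h1 h2] := main x.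
  have : 0 <= 2 * m / d by rewrite divr_ge0 ?mulr_ge0 // ltW.
  by move=> h3; split; lra.
have ad : a <= a + 3 * d by rewrite lerDl mulr_ge0 // ltW.
have [s /[!in_itv]/= sab smax] := @EVT_max R (fun x => `|f x|) a (a + 3 * d) ad
   (fun x => continuous_comp (@cf a (a + 3 * d) x) (@norm_continuous _ R^o (f x))).
pose S := `|f s|.
have SE y : a <= y <= a + 3 * d -> `|f y| <= S by move=> h; apply: smax; rewrite in_itv.
have S0 : 0 <= S by exact: normr_ge0.
have dvar x y : a <= x -> x <= y -> y <= a + 3 * d -> `|derive1 f y - derive1 f x| <= S / 2.
  move=> ax xy yb.
  pose fc z := if x <= z then if z <= y then f z else 0 else 0.
  have mfc : measL fc.
    apply: measL_if_le (measL_cst _) measL_id _ (measL_cst 0).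
    exact: measL_if_le measL_id (measL_cst _) mf (measL_cst 0).
  have fcS z : `|fc z| <= S.
    rewrite /fc; case: (leP x z) => zx; last by rewrite normr0.
    case: (leP z y) => zy; last by rewrite normr0.
    by apply: SE; rewrite (le_trans ax zx) (le_trans zy yb).
  have x1y : x - 1 <= y by lra.
  have fcL : L1 fc.
    have [i1 _] := lint_cut_interval x1y; apply: L1_le mfc _ (L1_Z S i1) => z.
    case: (leP z (x - 1)) => zx.
      rewrite /fc ifF ?normr0 ?mulr0 //; apply/negbTE; rewrite -ltNge; lra.
    case: (leP z y) => zy; first by rewrite mulr1.
    by rewrite /fc (lt_geF zy); case: ifP; rewrite normr0 mulr0.
  have [iL iE] := lint_cut_interval xy.
  pose F z := fc z * W z + k ^+ 2 * fc z.
  have FL : L1 F by exact: L1_D (L1_bM mfc fcS WL) (L1_Z _ fcL).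
  have bcut : bdd (fun z : R => if z <= x then 0 else if z <= y then 1 else 0 : R).
    exact: bdd_ltcut (bdd_cst 0) (bdd_ltcut y (bdd_cst 1) (bdd_cst 0)).
  rewrite (@abs_cont_FTC _ (derive1 f) F x y xy (acdf x y) FL); last first.
    apply: ae_imp ddfE => z dz /andP[xz zy]; apply: is_derive_eq.
    by rewrite /F /fc xz zy; ring.
  have cWL := bdd_L1 bcut (L1_norm WL).
  apply: le_trans (lint_norm (bdd_L1 bcut FL)) _.
  apply: (@le_trans _ _ (S * lint (fun z => (if z <= x then 0 else if z <= y then 1 else 0) * `|W z|) +
     k ^+ 2 * S * lint (fun z => if z <= x then 0 else if z <= y then 1 else 0))).
    rewrite -(lintZ _ cWL) -(lintZ _ iL) -(lintD (L1_Z _ cWL) (L1_Z _ iL)).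
    apply: lint_le; [exact: L1_norm (bdd_L1 bcut FL)|exact: L1_D (L1_Z _ cWL) (L1_Z _ iL)|move=> z].
    have := cut_ge0 x y z; move: (if z <= x then _ else _) => C C0.
    have -> : S * (C * `|W z|) + k ^+ 2 * S * C = C * (S * `|W z| + k ^+ 2 * S) by ring.
    rewrite normrM (ger0_norm C0) ler_wpM2l // /F (le_trans (ler_normD _ _)) // (normrM (fc z)) (normrM (k ^+ 2)) (ger0_norm (ltW k2)).
    by apply: lerD; [rewrite ler_wpM2r // normr_ge0|rewrite ler_wpM2l // ltW].
  rewrite iE -primitiveB //; last exact: L1_norm.
  have /= := H0 1%N (fun=> x) (fun=> y) (fun=> xy); rewrite !big_ord1 => h.
  have {}h : `|primitive (fun z => `|W z|) y - primitive (fun z => `|W z|) x| < 1 / 4.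
    by apply: h; [move=> i j; rewrite !ord1 eqxx|lra].
  have h1 : primitive (fun z => `|W z|) y - primitive (fun z => `|W z|) x <= 1 / 4.
    exact: le_trans (ler_norm _) (ltW h).
  have h2 : k ^+ 2 * (y - x) <= 1 / 4.
    apply: le_trans d3; rewrite mulrC ler_wpM2r ?(ltW k2) //; lra.
  have := ler_wpM2l S0 h1; have := ler_wpM2l S0 h2; rewrite mulrA (mulrC S) -mulrA; lra.
have [p /andP[ap pd] /mE pm] := small_point a d_gt0.
have [q /andP[aq qd] /mE qm] := small_point (a + 2 * d) d_gt0.
have pq : p < q by lra.
have [c /andP[pc cq] cE] := mvt pq.
have cm : `|derive1 f c| <= 2 * m / d.
  rewrite ler_pdivlMr //; apply: (@le_trans _ _ (`|derive1 f c| * (q - p))).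
    by rewrite ler_wpM2l //; lra.
  rewrite -[q - p]ger0_norm; last by lra.
  by rewrite -normrM -cE; apply: le_trans (ler_normB _ _) _; lra.
have dS y : a <= y <= a + 3 * d -> `|derive1 f y| <= 2 * m / d + S / 2.
  move=> /andP[ay yb]; rewrite -[derive1 f y](subrK (derive1 f c)) addrC.
  apply: le_trans (ler_normD _ _) _; apply: lerD => //.
  have [yc|/ltW cy] := leP y c; last by apply: dvar => //; lra.
  by rewrite distrC; apply: dvar => //; lra.
have SS : S <= 14 * m.
  have /andP[as_ sb] := sab.
  have pab : a <= p <= a + 3 * d by apply/andP; split; lra.
  have pb : p <= a + 3 * d by lra.
  have [e eab E] : exists2 e, a <= e <= a + 3 * d & f s - f p = derive1 f e * (s - p).
    have [ps|sp|ps] := ltgtP p s; last by exists p => //; rewrite ps !subrr mulr0.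
      by have [e /andP[pe es] eE] := mvt ps; exists e => //; apply/andP; split; lra.
    have [e /andP[pe es] eE] := mvt sp; exists e.
      by apply/andP; split; lra.
    by rewrite -opprB eE -mulrN opprB.
  have : `|f s - f p| <= (2 * m / d + S / 2) * (3 * d).
    rewrite E normrM ler_pM ?normr_ge0 ?dS // ler_norml.
    by apply/andP; split; lra.
  have -> : (2 * m / d + S / 2) * (3 * d) = 6 * m + S / 2 * (3 * d) by field; rewrite gt_eqF.
  have : S / 2 * (3 * d) <= S / 2 * 1 by rewrite ler_wpM2l ?divr_ge0 //; lra.
  have : S <= `|f p| + `|f s - f p| by rewrite /S -{1}[f s](subrK (f p)) addrC ler_normD.
  lra.
split; first by apply: le_trans SS; apply: SE; rewrite lexx.
by apply: le_trans (dS a _) _; [rewrite lexx|lra].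
Qed.

Let bf : bdd f.
Proof. by have [M fM] := eigenfunction_bounded; split => //; exists M => x; case: (fM x). Qed.

Let h x := W x * f x.

Let hL : L1 h.
Proof. by rewrite /h; under eq_fun do rewrite mulrC; exact: bdd_L1 bf WL. Qed.

Let xi := hgint k h.

(** Since c^2 = k^2, the operator d^2/dx^2 - k^2 factors as (d/dx + c)(d/dx - c); the inner factor
    applied to f solves a first-order equation with source W f. *)
Let first_order (c : R) : `|c| = k ->
  [/\ AC_loc (fun x => derive1 f x - c * f x),
      exists M : R, forall x, `|derive1 f x - c * f x| <= M &
      {ae leb R, forall x : R, is_derive x 1 (fun x => derive1 f x - c * f x)
                                (h x - c * (derive1 f x - c * f x))}].
Proof.
move=> ck; have [M fM] := eigenfunction_bounded; split.
- move=> a b; apply: abs_contB; first exact: acdf.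
  have := abs_contM_lip (acf a b) (fun x _ => proj1 (fM x)) (fun x _ => le_refl `|c|).
  by move=> /(_ 0); apply => s t _ _ _; rewrite subrr normr0 mul0r.
- exists (M + k * M) => y; rewrite (le_trans (ler_normB _ _)) // lerD //; first by case: (fM y).
  by rewrite normrM ck (ler_wpM2l (ltW k0)) //; case: (fM y).
have c2 : c * c = k ^+ 2 by rewrite -ck real_normK ?num_real.
apply: ae_imp ddfE => y dd; apply: is_derive_eq (is_deriveB dd (is_deriveZ c (dfE y))) _.
by rewrite /h /GRing.scale /= -c2; ring.
Qed.

Let xiE x : derive1 f x - k * f x = xi x.
Proof.
have [|ac [M b] d] := @first_order k; first by rewrite gtr0_norm.
exact: (ode_left k0 x ac b hL d).
Qed.

Let etaE x : derive1 f x - - k * f x = - lint (fun y => halfgreen k x y * h y).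
Proof.
have [|ac [M b] d] := @first_order (- k); first by rewrite normrN gtr0_norm.
apply: (ode_right k0 x ac b hL); apply: ae_imp d => y.
by rewrite (mulNr k (derive1 f y - _)) opprK.
Qed.

(** Solving for f' - k f from the left and for f' + k f from the right, and subtracting, leaves 2 k
    f; the two half-line kernels make up 2 k g away from the diagonal. *)
Lemma eigenfunction_green x : f x = - lint (fun y => green k x y * (W y * f y)).
Proof.
have gL : L1 (fun y => green k x y * h y).
  apply: L1_bM (meas2_sec2 _ (meas2_green k)) (fun y => green_le x y k0) hL.
have h1 := bdd_L1 (bdd_halfgreen k0 x) hL; have h2 := bdd_L1 (bdd_halfgreen' k0 x) hL.
have E : lint (fun y => 2 * k * (green k x y * h y)) =
    lint (fun y => halfgreen k y x * h y + halfgreen k x y * h y).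
  apply: (lint_point (y := x) (L1_Z _ gL) (L1_D h1 h2)) => y yx.
  rewrite mulrA -mulrDl; congr (_ * _).
  have -> : 2 * k * green k x y = expR (- k * `|x - y|) by rewrite /green; field; rewrite gt_eqF.
  rewrite /halfgreen.
  case: (ltgtP y x) yx => // yx _; [rewrite addr0|rewrite add0r]; congr expR.
    by rewrite gtr0_norm ?subr_gt0 // mulNr.
  by rewrite ltr0_norm ?subr_lt0 // mulNr opprB.
apply: (mulfI (_ : 2 * k != 0)); first by rewrite mulf_neq0 ?gt_eqF.
rewrite mulrN -(lintZ _ gL) E (lintD h1 h2) -/(hgint k h x) -/(xi x) -xiE.
have := etaE x => /eqP; rewrite -eqr_oppLR => /eqP <-; ring.
Qed.

Let halfgreen_xi x : lint (fun t => halfgreen k x t * xi t) = - f x.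
Proof. by rewrite lint_halfgreen_hgint // eigenfunction_green opprK. Qed.

(** Were the energy zero, xi would vanish almost everywhere, while [halfgreen_xi] recovers f from xi
    at every point. *)
Lemma eigenfunction_energy : (exists x, f x != 0) -> lint (fun x => W x * f x ^+ 2) != 0.
Proof.
move=> [x0 fx0]; apply/eqP => I0.
have E : lint (fun t => xi t * xi t) = 0.
  rewrite lint_hgintM //; transitivity (lint (fun y => - 1 * (W y * f y ^+ 2))).
    congr lint; apply/funext => y; rewrite -[lint _]opprK -eigenfunction_green /h; ring.
  rewrite lintZ ?I0 ?mulr0 //.
  rewrite (_ : (fun y => _) = (fun y => f y * h y)); last by apply/funext => y; rewrite /h; ring.
  exact: bdd_L1 bf hL.
have xiL : L1 xi by exact: L1_hgint.
have xi2L : L1 (fun t => xi t * xi t) by exact: bdd_L1 (bdd_hgint k0 hL) xiL.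
have xi0 : {ae leb R, forall x, xi x = 0}.
  have m2 : measurable_fun [set: lebT R] (fun x : lebT R => (xi x * xi x)%:E).
    by apply/measurable_EFinP; exact: L1_measL xi2L.
  have := (@ae_eq_integral_abs _ (lebT R) R (leb R) setT measurableT _ m2).1.
  case.
    rewrite -[RHS]/(0%:E) -E -lintE //; apply: eq_integral => x _.
    by rewrite gee0_abs // lee_fin -expr2 sqr_ge0.
  move=> N [mN N0 NH]; exists N; split => // x /= nx; apply: NH => /= H; apply: nx.
  by have [] := H I; move=> /eqP; rewrite mulf_eq0 orbb => /eqP.
move: fx0; rewrite -oppr_eq0 -halfgreen_xi => /eqP; apply.
rewrite -(@lint0 R); apply: lint_ae; [|exact: measL_cst|by apply: ae_imp xi0 => x ->; rewrite mulr0].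
exact: L1_measL (bdd_L1 (bdd_halfgreen' k0 x0) xiL).
Qed.

Let w x := W x / (2 * k).

Let wL : L1 w.
Proof. by rewrite /w; under eq_fun do rewrite mulrC; exact: L1_Z. Qed.

Let jgbound n := (2 * k)^-1 * ((2 * lint (fun z => `|w z|)) ^+ n / n`!%:R).

(* Integrating jost_green_rec against f (V - Vinf) gives the partial sums of
   jost_coef times f, while jost_green n tends to 0 factorially. *)
Lemma eigenfunction_jost_sum : (exists x, f x != 0) ->
  (fun n => \sum_(m < n) jost_coef k w m) @ \oo --> (0 : R).
Proof.
move=> [x0 fx0].
have WE z : 2 * k * w z = W z by rewrite /w; field; rewrite gt_eqF.
have mjg n := meas2_jost_green n k0 wL.
have jgB n x y : `|jost_green k w n x y| <= jgbound n := jost_green_le k0 wL n x y.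
have hjgL n y : L1 (fun x => h x * jost_green k w n x y).
  under eq_fun do rewrite mulrC.
  exact: L1_bM (meas2_sec1 y (mjg n)) (fun x => jgB n x y) hL.
pose T n y := lint (fun x => h x * jost_green k w n x y).
have hgL y : L1 (fun x => h x * green k x y).
  under eq_fun do rewrite mulrC.
  exact: L1_bM (meas2_sec1 y (meas2_green k)) (fun x => green_le x y k0) hL.
have hg y : lint (fun x => h x * green k x y) = - f y.
  rewrite eigenfunction_green opprK; congr lint; apply/funext => x.
  by rewrite mulrC green_sym.
have TE n y : T n y = - (\sum_(m < n.+1) jost_coef k w m) * f y.
  elim: n => [|n IH].
    rewrite big_ord1 mulN1r -hg; congr lint; apply/funext => x; congr (_ * _).
    by rewrite /jost_green big_ord1 !mulr1.
  have WjL : L1 (fun z => 2 * k * w z * jost_green k w n z y).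
    under eq_fun do rewrite WE mulrC.
    exact: L1_bM (meas2_sec1 y (mjg n)) (fun x => jgB n x y) WL.
  pose G x := lint (fun z => green k x z * (2 * k * w z * jost_green k w n z y)).
  have GE x : jost_green k w n.+1 x y = jost_coef k w n.+1 * green k x y - G x.
    rewrite /G; under [X in lint X]eq_fun do rewrite mulrA.
    by rewrite (jost_green_rec k0 wL) opprB addrC subrK.
  have bG : bdd G := bdd_lint (meas2_green k) (fun x y => green_le x y k0) WjL.
  have hGL : L1 (fun x => h x * G x) by under eq_fun do rewrite mulrC; exact: bdd_L1 bG hL.
  transitivity (lint (fun x => jost_coef k w n.+1 * (h x * green k x y) - h x * G x)).
    by congr lint; apply/funext => x; rewrite GE; ring.
  rewrite (lintB (L1_Z _ (hgL y)) hGL) (lintZ _ (hgL y)) hg.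
  rewrite (lint_bounded_kernel (meas2_green k) (fun x y => green_le x y k0) hL WjL).
  rewrite (_ : lint _ = - T n y); last first.
    rewrite -mulN1r -lintZ //; congr lint; apply/funext => z.
    rewrite WE (_ : lint _ = - f z); first by rewrite /h; ring.
    by rewrite -hg; congr lint; apply/funext => x; exact: mulrC.
  have -> : \sum_(m < n.+2) jost_coef k w m = \sum_(m < n.+1) jost_coef k w m + jost_coef k w n.+1.
    by rewrite big_ord_recr.
  by rewrite IH; move: (jost_coef k w n.+1) (\sum_(m < n.+1) _) => F S; ring.
have Tle n : `|\sum_(m < n.+1) jost_coef k w m| <=
    (`|f x0|^-1 * ((2 * k)^-1 * lint (fun z => `|h z|))) * exp_coeff (2 * lint (fun z => `|w z|)) n.
  have f0 : 0 < `|f x0| by rewrite normr_gt0.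
  rewrite -mulrA -ler_pdivrMl ?invr_gt0 // invrK mulrC -normrM -normrN -mulNr -TE.
  rewrite /T (_ : (fun x => _) = (fun x => jost_green k w n x x0 * h x)); last by apply/funext => x; exact: mulrC.
  apply: le_trans (lint_normM (meas2_sec1 x0 (mjg n)) (fun x => jgB n x x0) hL) _.
  by rewrite /jgbound /exp_coeff /= mulrAC.
by rewrite -(@cvg_shiftS R^o); exact: exp_coeff_squeeze Tle.
Qed.

End Eigenfunction.

(** * Traces of the Birman-Schwinger kernel *)

Lemma meas2_kernel_comp (R : realType) (K L : R -> R -> R) : meas2 K -> meas2 L ->
  meas2 (fun x y => lint (fun z => K x z * L z y)).
Proof.
move=> mK mL.
pose G (p : (lebT R * lebT R) * lebT R) : R := K p.1.1 p.2 * L p.2 p.1.2.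
have mG : measurable_fun setT G.
  have m1 : measurable_fun setT (fun p : (lebT R * lebT R) * lebT R => (p.1.1, p.2)).
    by apply: measurable_fun_pair; [exact: (measurableT_comp measurable_fst measurable_fst)|exact: measurable_snd].
  have m2 : measurable_fun setT (fun p : (lebT R * lebT R) * lebT R => (p.2, p.1.2)).
    by apply: measurable_fun_pair; [exact: measurable_snd|exact: (measurableT_comp measurable_snd measurable_fst)].
  exact: measurable_funM (measurableT_comp mK m1) (measurableT_comp mL m2).
exact: (@measurable_Rintegral _ _ (lebT R * lebT R)%type (lebT R) R (leb R) G mG).
Qed.

Section HalfGreen.
Context {R : realType}.
Variables (k : R) (W : R -> R).
Hypothesis k0 : 0 < k.
Hypothesis WL : L1 W.

Let hg1 x y : `|halfgreen k x y| <= 1.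
Proof. exact: halfgreen_le1. Qed.

Let w x := W x / (2 * k).

Let wL : L1 w.
Proof. by rewrite /w; under eq_fun do rewrite mulrC; exact: L1_Z. Qed.

Let WE z : 2 * k * w z = W z.
Proof. by rewrite /w; field; rewrite gt_eqF. Qed.

(* The coefficients of det(I - z K0) (I + z g W)^-1 applied to halfgreen k _ t,
   where g is the integral operator with kernel green k. *)
Fixpoint hgiter n (z t : R) : R := if n is m.+1 then
  jost_coef k w n * halfgreen k z t - lint (fun y => green k z y * (W y * hgiter m y t))
  else halfgreen k z t.

Let hgiterS n z t : hgiter n.+1 z t =
  jost_coef k w n.+1 * halfgreen k z t - lint (fun y => green k z y * (W y * hgiter n y t)).
Proof. by []. Qed.

Lemma hgiter_meas_bdd n : meas2 (hgiter n) /\ exists C, forall z t, `|hgiter n z t| <= C.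
Proof.
elim: n => [|n [mn [C nC]]]; first by split; [exact: meas2_halfgreen|exists 1].
have mWn : meas2 (fun y t => W y * hgiter n y t) by exact: meas2_M (meas2_1 (L1_measL WL)) mn.
split.
  apply: meas2_B; first exact: meas2_M (meas2_cst _) (meas2_halfgreen k).
  exact: meas2_kernel_comp (meas2_green k) mWn.
exists (`|jost_coef k w n.+1| + (2 * k)^-1 * (C * lint (fun y => `|W y|))) => z t.
apply: le_trans (ler_normB _ _) _; rewrite normrM; apply: lerD; first by rewrite ler_piMr.
have WnL : L1 (fun y => W y * hgiter n y t).
  by under eq_fun do rewrite mulrC; exact: L1_bM (meas2_sec1 t mn) (fun y => nC y t) WL.
apply: le_trans (lint_normM (meas2_sec2 z (meas2_green k)) (fun y => green_le z y k0) WnL) _.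
rewrite ler_wpM2l ?invr_ge0 ?mulr_ge0 ?(ltW k0) // -lintZ; last exact: L1_norm.
apply: lint_le; [exact: L1_norm|exact/L1_Z/L1_norm|].
by move=> y; rewrite normrM mulrC ler_wpM2r.
Qed.

(** Integrating against the second half-line factor restores g, and the recursion of [hgiter]
    becomes [jost_green_rec]. *)
Lemma lint_halfgreen_hgiter n x z : lint (fun t => halfgreen k x t * hgiter n z t) = jost_green k w n z x.
Proof.
have [hL _] := lint_halfgreen x k0.
elim: n z => [|n IH] z.
  by rewrite /= lint_halfgreenM // /jost_green big_ord1 !mulr1 green_sym.
have [mn [C nC]] := hgiter_meas_bdd n.
have gWL : L1 (fun y => green k z y * W y).
  exact: L1_bM (meas2_sec2 z (meas2_green k)) (fun y => green_le z y k0) WL.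
pose G t := lint (fun y => hgiter n y t * (green k z y * W y)).
have bG : bdd G := bdd_lint (meas2_swap mn) (fun t y => nC y t) gWL.
have GL : L1 (fun t => halfgreen k x t * G t).
  by under eq_fun do rewrite mulrC; exact: bdd_L1 bG hL.
have hhL : L1 (fun t => halfgreen k x t * halfgreen k z t).
  by under eq_fun do rewrite mulrC; exact: L1_bM (meas2_sec2 z (meas2_halfgreen k)) (hg1 z) hL.
transitivity (lint (fun t => jost_coef k w n.+1 * (halfgreen k x t * halfgreen k z t) - halfgreen k x t * G t)).
  congr lint; apply/funext => t; rewrite hgiterS.
  rewrite (_ : lint _ = G t); first by move: (jost_coef k w n.+1) (G t) => F G'; ring.
  by congr lint; apply/funext => y; ring.
rewrite (lintB (L1_Z _ hhL) GL) (lintZ _ hhL) lint_halfgreenM //.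
rewrite (lint_bounded_kernel (meas2_swap mn) (fun t y => nC y t) hL gWL).
have := jost_green_rec k0 wL n z x; rewrite (green_sym k x z).
rewrite (_ : lint (fun y => green k z y * W y * _) = lint (fun y => green k z y * (2 * k * w y) * jost_green k w n y x)).
  by move=> ->; rewrite opprB addrC subrK.
congr lint; apply/funext => y; rewrite WE -IH; congr (_ * lint _).
by apply/funext => t; exact: mulrC.
Qed.

(** Fubini links the integral over t, the form in which traces of sections converge, with the
    diagonal integral of [jost_green]. *)
Lemma lint_hgiter_diag n :
  L1 (fun t => lint (fun x => W x * (halfgreen k x t * hgiter n x t))) /\
  lint (fun t => lint (fun x => W x * (halfgreen k x t * hgiter n x t))) = n.+1%:R * jost_coef k w n.+1.
Proof.
have [mn [C nC]] := hgiter_meas_bdd n.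
have hnL x : L1 (fun t => halfgreen k x t * hgiter n x t).
  have [hL _] := lint_halfgreen x k0.
  by under eq_fun do rewrite mulrC; exact: L1_bM (meas2_sec2 x mn) (nC x) hL.
have [||||E _ L] := @lint_fubini R (fun x t => W x * (halfgreen k x t * hgiter n x t)) (fun x => C / k * `|W x|).
- exact: meas2_M (meas2_1 (L1_measL WL)) (meas2_M (meas2_halfgreen k) mn).
- by move=> x; exact: L1_Z.
- exact/L1_Z/L1_norm.
- move=> x; have [hL e] := lint_halfgreen x k0.
  apply: (@le_trans _ _ (lint (fun t => `|W x| * (C * halfgreen k x t)))).
    apply: lint_le; [exact/L1_norm/L1_Z|exact/L1_Z/L1_Z|move=> t].
    rewrite (normrM (W x)) ler_wpM2l // normrM (ger0_norm (halfgreen_ge0 k x t)) mulrC.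
    by rewrite (ler_wpM2r (halfgreen_ge0 k x t)).
  by rewrite (lintZ _ (L1_Z _ hL)) (lintZ _ hL) e mulrC.
split; first exact: L.
rewrite -E -(jost_green_diag k0 wL n); congr lint; apply/funext => x.
rewrite (lintZ (W x) (hnL x)) (lint_halfgreen_hgiter n x x) WE; reflexivity.
Qed.

End HalfGreen.

(** * The Birman-Schwinger operator *)

Section ComplexKernel.
Context {R : realType}.
Implicit Types (f g a b : R -> R[i]).

Local Notation re := (@complex.Re R).
Local Notation im := (@complex.Im R).
Local Notation nc := (@Normc.normc R).

Lemma Re_realM (r : R) (z : R[i]) : re (r%:C * z) = r * re z.
Proof. by rewrite cReM /= mul0r subr0. Qed.

Lemma Im_realM (r : R) (z : R[i]) : im (r%:C * z) = r * im z.
Proof. by rewrite cImM /= mul0r addr0. Qed.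

Lemma conjC_real (r : R) : (r%:C)^* = r%:C :> R[i].
Proof. by apply: complexP; rewrite ?cRe_conj ?cIm_conj //= oppr0. Qed.

Lemma cint_realM (r : R -> R) f : cintegral (fun x => (r x)%:C * f x) =
  lint (fun x => r x * re (f x)) +i* lint (fun x => r x * im (f x)).
Proof.
rewrite cintegralE; apply: complexP => /=; congr lint; apply/funext => x; first exact: Re_realM.
exact: Im_realM.
Qed.

Lemma cL1_realM (r : R -> R) f : L1 (fun x => r x * re (f x)) -> L1 (fun x => r x * im (f x)) ->
  cL1 (fun x => (r x)%:C * f x).
Proof.
move=> h1 h2; split.
  by rewrite (_ : (fun x => _) = (fun x => r x * re (f x))) //; apply/funext => x; exact: Re_realM.
by rewrite (_ : (fun x => _) = (fun x => r x * im (f x))) //; apply/funext => x; exact: Im_realM.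
Qed.

Lemma inner_realE (r : R -> R) f : inner (fun x => (r x)%:C) f = cintegral (fun x => (r x)%:C * f x).
Proof. by congr cintegral; apply/funext => x; congr (_ * _); exact: conjC_real. Qed.

Lemma inner_real_real (r s : R -> R) :
  inner (fun x => (r x)%:C) (fun x => (s x)%:C) = (lint (fun x => r x * s x))%:C.
Proof.
rewrite inner_realE -cint_real; congr cintegral; apply/funext => x.
by apply: complexP; rewrite ?Re_realM ?Im_realM //= mulr0.
Qed.

Lemma norm2_real (r : R -> R) : norm2 (fun x => (r x)%:C) ^+ 2 = lint (fun x => r x ^+ 2).
Proof.
rewrite norm2_sqr; congr lint; apply/funext => x.
by rewrite normc_real -normrX ger0_norm ?sqr_ge0.
Qed.

Lemma inner_mulr f a : inner f a = cintegral (fun x => a x * (f x)^*).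
Proof. by congr cintegral; apply/funext => x; rewrite mulrC. Qed.

Lemma L2_conj f : L2 f -> L2 (fun x => (f x)^*).
Proof.
move=> /L2P[[m1 i1] [m2 i2]]; apply/L2P; split.
  by rewrite (_ : (fun x => _) = (fun x => re (f x))) //; apply/funext => x; rewrite cRe_conj.
rewrite (_ : (fun x => _) = (fun x => - im (f x))); last by apply/funext => x; rewrite cIm_conj.
by split; [exact: measL_N|rewrite (_ : (fun x => _) = (fun x => im (f x) ^+ 2)) //; apply/funext => x; rewrite sqrrN].
Qed.

Lemma cint_ext f g : (forall x, f x = g x) -> cintegral f = cintegral g.
Proof. by move=> fg; congr cintegral; exact/funext. Qed.

(** The factor 2 comes from treating real and imaginary parts separately; it only enters
    constants. *)
Lemma normc_cint (f : R -> R[i]) (g : R -> R) : cL1 f -> L1 g -> (forall x, nc (f x) <= g x) ->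
  nc (cintegral f) <= 2 * lint g.
Proof.
move=> [f1 f2] gL fg; rewrite cintegralE; apply: le_trans (normc_le _) _ => /=.
rewrite mulr2n mulrDl mul1r; apply: lerD.
  apply: le_trans (lint_norm f1) _; apply: lint_le => //; first exact: L1_norm.
  by move=> x; apply: le_trans (Re_normc _) (fg x).
apply: le_trans (lint_norm f2) _; apply: lint_le => //; first exact: L1_norm.
by move=> x; apply: le_trans (Im_normc _) (fg x).
Qed.

Lemma cint_dct (G : nat -> R -> R[i]) (G0 : R -> R[i]) (g : R -> R) :
  (forall N, cL1 (G N)) -> (forall t, ccvg (G^~ t) (G0 t)) ->
  (forall N t, nc (G N t) <= g t) -> L1 g ->
  ccvg (fun N => cintegral (G N)) (cintegral G0).
Proof.
move=> GL Gc Gg gL; split.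
  apply: (proj2 (lint_dct (fun N => L1_measL (GL N).1) (fun t => (Gc t).1) _ gL)) => N t.
  exact: le_trans (Re_normc _) (Gg N t).
apply: (proj2 (lint_dct (fun N => L1_measL (GL N).2) (fun t => (Gc t).2) _ gL)) => N t.
exact: le_trans (Im_normc _) (Gg N t).
Qed.

Lemma cL1_normc f : cL1 f -> L1 (fun x => nc (f x)).
Proof.
move=> [f1 f2]; apply: (@L1_le R _ (fun x => `|re (f x)| + `|im (f x)|)).
- rewrite (_ : (fun x => _) = (fun x => Num.sqrt (re (f x) ^+ 2 + im (f x) ^+ 2))); last first.
    by apply/funext => x; case: (f x).
  apply: (@measL_comp R (fun y => Num.sqrt y)).
    by apply: continuous_measurable_fun; exact: sqrt_continuous.
  by apply: measL_D; apply: measL_M; exact: L1_measL.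
- by move=> x; rewrite ger0_norm ?normc_ge0 // normc_le.
- by apply: L1_D; exact: L1_norm.
Qed.

End ComplexKernel.

#[local] Opaque L2 cintegral norm2 inner.

Section Factored.
Context {R : realType}.
Variables (k : R) (W u v : R -> R).
Hypothesis k0 : 0 < k.
Hypothesis WL : L1 W.
Hypothesis mu : measL u.
Hypothesis mv : measL v.
Hypothesis u2 : forall x, u x ^+ 2 = `|W x|.
Hypothesis v2 : forall x, v x ^+ 2 = `|W x|.
Implicit Types (f g a b : R -> R[i]) (e : nat -> R -> R[i]) (N n : nat).

Local Notation re := (@complex.Re R).
Local Notation im := (@complex.Im R).
Local Notation nc := (@Normc.normc R).

Lemma rL2_sqrtabs (r : R -> R) : measL r -> (forall x, r x ^+ 2 = `|W x|) -> rL2 r.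
Proof.
move=> mr r2; split => //.
by rewrite (_ : (fun x => _) = (fun x => `|W x|)); [exact: L1_norm|exact/funext].
Qed.

Let uL := rL2_sqrtabs mu u2.
Let vL := rL2_sqrtabs mv v2.

Lemma cL1_rL2M (r : R -> R) f : rL2 r -> L2 f -> cL1 (fun x => (r x)%:C * f x).
Proof.
by move=> rr /L2P[f1 f2]; apply: cL1_realM; exact: rL2M.
Qed.

(* The Birman-Schwinger operator u (-d^2/dx^2 + k^2)^-1 v. *)
Definition bso f x : R[i] := (u x)%:C * cintegral (fun y => (green k x y * v y)%:C * f y).

Let rL2_gv x : rL2 (fun y => green k x y * v y).
Proof. exact: rL2_bM (meas2_sec2 x (meas2_green k)) (fun y => green_le x y k0) vL. Qed.

Lemma bsoE f x : bso f x = (u x)%:C * inner (fun y => (green k x y * v y)%:C) f.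
Proof. by rewrite inner_realE. Qed.

Lemma bsoD f g x : L2 f -> L2 g -> bso (fun x => f x + g x) x = bso f x + bso g x.
Proof. by move=> fL gL; rewrite !bsoE (innerDr (L2_real (rL2_gv x)) fL gL) mulrDr. Qed.

Lemma bsoZ c f x : L2 f -> bso (fun x => c * f x) x = c * bso f x.
Proof. by move=> fL; rewrite !bsoE (innerZr c (L2_real (rL2_gv x)) fL); exact: mulrCA. Qed.

Lemma norm_gv x : norm2 (fun y => (green k x y * v y)%:C) <= (2 * k)^-1 * norm2 (fun y => (v y)%:C).
Proof.
have k2 : 0 <= (2 * k)^-1 by rewrite invr_ge0 mulr_ge0 // ltW.
rewrite -(ler_pXn2r (n := 2)) ?nnegrE ?norm2_ge0 ?(mulr_ge0 k2) ?norm2_ge0 //.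
rewrite exprMn !norm2_real -(lintZ _ vL.2); apply: lint_le; [exact: (rL2_gv x).2|exact: L1_Z vL.2|].
move=> y; rewrite exprMn (ler_wpM2r (sqr_ge0 _)) //.
by rewrite ler_sqr ?nnegrE ?green_ge0 // -[green k x y]ger0_norm ?green_ge0 ?green_le.
Qed.

Let Kb := (2 * k)^-1 * norm2 (fun y => (v y)%:C).

Lemma L2_bso f : L2 f -> L2 (bso f) /\ norm2 (bso f) <= norm2 (fun x => (u x)%:C) * Kb * norm2 f.
Proof.
move=> fL; have [f1 f2] := (L2P f).1 fL.
have vf1 := rL2M vL f1; have vf2 := rL2M vL f2.
have B (r : R -> R) : L1 (fun y => v y * r y) -> rL2 (fun x => lint (fun y => green k x y * v y * r y) * u x).
  move=> vr; have [m [C hC]] := bdd_lint (meas2_green k) (fun x y => green_le x y k0) vr.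
  rewrite (_ : (fun x => _) = (fun x => lint (fun y => green k x y * (v y * r y)) * u x)).
    exact: rL2_bM m hC uL.
  by apply/funext => x; congr (lint _ * _); apply/funext => y; rewrite mulrA.
have bL : L2 (bso f).
  apply/L2P; split.
    rewrite (_ : (fun x => _) = (fun x => lint (fun y => green k x y * v y * re (f y)) * u x)); first exact: B.
    by apply/funext => x; rewrite /bso cint_realM Re_realM mulrC.
  rewrite (_ : (fun x => _) = (fun x => lint (fun y => green k x y * v y * im (f y)) * u x)); first exact: B.
  by apply/funext => x; rewrite /bso cint_realM Im_realM mulrC.
split=> //.
have K0 : 0 <= norm2 (fun x => (u x)%:C) * Kb * norm2 f.
  by rewrite !mulr_ge0 ?norm2_ge0 // invr_ge0 mulr_ge0 // ltW.
rewrite -(ler_pXn2r (n := 2)) ?nnegrE ?norm2_ge0 //.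
have -> : (norm2 (fun x => (u x)%:C) * Kb * norm2 f) ^+ 2 = lint (fun x => (Kb * norm2 f) ^+ 2 * u x ^+ 2).
  rewrite (lintZ ((Kb * norm2 f) ^+ 2) uL.2) -(norm2_real u).
  by move: (norm2 (fun x => (u x)%:C)) Kb (norm2 f) => x y z; ring.
rewrite norm2_sqr; apply: lint_le; [by case: bL|exact: L1_Z uL.2|move=> x].
rewrite bsoE normcM normc_real exprMn -normrX (ger0_norm (sqr_ge0 _)) mulrC.
rewrite (ler_wpM2r (sqr_ge0 _)) //.
have h := cauchy_schwarz (L2_real (rL2_gv x)) fL.
rewrite ler_pXn2r ?nnegrE ?normc_ge0 //; last first.
  by rewrite mulr_ge0 ?norm2_ge0 // mulr_ge0 ?norm2_ge0 // invr_ge0 mulr_ge0 // ltW.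
by apply: le_trans h _; rewrite ler_wpM2r ?norm2_ge0 // norm_gv.
Qed.

Lemma bso_sum (I : Type) (r : seq I) (F : I -> R -> R[i]) x : (forall i, L2 (F i)) ->
  bso (fun x => \sum_(i <- r) F i x) x = \sum_(i <- r) bso (F i) x.
Proof.
move=> FL; elim: r => [|i r IH].
  have -> : (fun x => \sum_(i <- [::]) F i x) = (fun=> 0) by apply/funext => y; rewrite big_nil.
  by rewrite big_nil bsoE inner0r mulr0.
have -> : (fun x => \sum_(i <- i :: r) F i x) = (fun x => F i x + \sum_(i <- r) F i x).
  by apply/funext => y; rewrite big_cons.
by rewrite big_cons (bsoD x (FL i) (L2_sum r predT FL)) IH.
Qed.

(** With r = u and r = v these are the vectors X_t and Y_t of [FactoredOperator]. *)
Definition hgl (r : R -> R) (t x : R) : R[i] := (r x * halfgreen k x t)%:C.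

Let rL2_hgl (r : R -> R) t : rL2 r -> rL2 (fun x => r x * halfgreen k x t).
Proof.
move=> rr; rewrite (_ : (fun x => _) = (fun x => halfgreen k x t * r x)).
  exact: rL2_bM (meas2_sec1 t (meas2_halfgreen k)) (fun x => halfgreen_le1 x t k0) rr.
by apply/funext => x; exact: mulrC.
Qed.

Lemma L2_hglu t : L2 (hgl u t).
Proof. exact: L2_real (rL2_hgl t uL). Qed.

Lemma L2_hglv t : L2 (hgl v t).
Proof. exact: L2_real (rL2_hgl t vL). Qed.

Definition hgw t : R := lint (fun x => `|W x| * halfgreen k x t ^+ 2).

Lemma norm2_hgl (r : R -> R) t : (forall x, r x ^+ 2 = `|W x|) -> norm2 (hgl r t) ^+ 2 = hgw t.
Proof.
by move=> r2; rewrite norm2_real; congr lint; apply/funext => x; rewrite exprMn r2.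
Qed.

(** The half-line kernel takes values in [0, 1], so its square is below itself and [hgw] is
    dominated by the transform of |W|. *)
Lemma L1_hgw : L1 hgw.
Proof.
have WaL := L1_norm WL.
have h2L t : L1 (fun x => `|W x| * halfgreen k x t ^+ 2).
  by have := (rL2_hgl t uL).2; rewrite (_ : (fun x => _ ^+ 2) = (fun x => `|W x| * halfgreen k x t ^+ 2)) //; apply/funext => x; rewrite exprMn u2.
apply: L1_le (L1_hgint k0 WaL).
  apply: measL_lint; apply: meas2_M; first exact: meas2_2 (L1_measL WaL).
  by apply: meas2_M; exact: meas2_swap (meas2_halfgreen k).
move=> t; rewrite ger0_norm; last by apply: lint_ge0 => x; rewrite mulr_ge0 ?sqr_ge0.
apply: lint_le; [exact: h2L|exact: bdd_L1 (bdd_halfgreen k0 t) WaL|move=> x].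
rewrite mulrC expr2 (ler_wpM2r (normr_ge0 _)) // ler_piMl ?halfgreen_ge0 //.
by have := halfgreen_le1 x t k0; rewrite ger0_norm ?halfgreen_ge0.
Qed.

Definition chg a t : R[i] := cintegral (fun x => (halfgreen k x t)%:C * a x).

Lemma chgE a t : chg a t = hgint k (fun x => re (a x)) t +i* hgint k (fun x => im (a x)) t.
Proof. exact: cint_realM. Qed.

Lemma chgM a b : cL1 a -> cL1 b -> cL1 (fun t => chg a t * chg b t) /\
  cintegral (fun t => chg a t * chg b t) =
  cintegral (fun x => a x * cintegral (fun y => (green k x y)%:C * b y)).
Proof.
move=> [a1 a2] [b1 b2].
have HM (r s : R -> R) : L1 r -> L1 s -> L1 (fun t => hgint k r t * hgint k s t).
  by move=> rL sL; exact: bdd_L1 (bdd_hgint k0 rL) (L1_hgint k0 sL).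
have GM (r s : R -> R) : L1 r -> L1 s -> L1 (fun x => r x * lint (fun y => green k x y * s y)).
  move=> rL sL; have := bdd_L1 (bdd_lint (meas2_green k) (fun x y => green_le x y k0) sL) rL.
  by rewrite (_ : (fun x => _ * r x) = (fun x => r x * lint (fun y => green k x y * s y))) //; apply/funext => x; exact: mulrC.
have R1 : (fun t => re (chg a t * chg b t)) = (fun t => hgint k (fun x => re (a x)) t * hgint k (fun x => re (b x)) t -
    hgint k (fun x => im (a x)) t * hgint k (fun x => im (b x)) t).
  by apply/funext => t; rewrite cReM !chgE.
have R2 : (fun t => im (chg a t * chg b t)) = (fun t => hgint k (fun x => re (a x)) t * hgint k (fun x => im (b x)) t +
    hgint k (fun x => im (a x)) t * hgint k (fun x => re (b x)) t).
  by apply/funext => t; rewrite cImM !chgE.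
split.
  split; first by rewrite R1; exact: L1_B (HM _ _ a1 b1) (HM _ _ a2 b2).
  by rewrite R2; exact: L1_D (HM _ _ a1 b2) (HM _ _ a2 b1).
rewrite !cintegralE R1 R2 (lintB (HM _ _ a1 b1) (HM _ _ a2 b2)) (lintD (HM _ _ a1 b2) (HM _ _ a2 b1)).
rewrite (lint_hgintM k0 a1 b1) (lint_hgintM k0 a2 b2) (lint_hgintM k0 a1 b2) (lint_hgintM k0 a2 b1).
congr (_ +i* _).
  rewrite -(lintB (GM _ _ a1 b1) (GM _ _ a2 b2)); congr lint; apply/funext => x.
  by rewrite cReM cint_realM.
rewrite -(lintD (GM _ _ a1 b2) (GM _ _ a2 b1)); congr lint; apply/funext => x.
by rewrite cImM cint_realM.
Qed.

Lemma inner_bso a b : L2 a -> L2 b ->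
  cL1 (fun t => inner a (hgl u t) * inner (hgl v t) b) /\
  inner a (bso b) = cintegral (fun t => inner a (hgl u t) * inner (hgl v t) b).
Proof.
move=> aL bL; have uaL := cL1_rL2M uL (L2_conj aL); have vbL := cL1_rL2M vL bL.
have E : (fun t => inner a (hgl u t) * inner (hgl v t) b) =
    (fun t => chg (fun x => (u x)%:C * (a x)^*) t * chg (fun x => (v x)%:C * b x) t).
  apply/funext => t; congr (_ * _).
    rewrite inner_mulr; apply: cint_ext => x.
    by rewrite /hgl rmorphM /= mulrAC -mulrA [RHS]mulrC -mulrA.
  rewrite inner_realE; apply: cint_ext => x; rewrite rmorphM /=; ring.
have [c1 c2] := chgM uaL vbL; rewrite E; split; first exact: c1.
rewrite c2 inner_mulr; apply: cint_ext => x; rewrite /bso mulrAC; congr (_ * _).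
by apply: cint_ext => y; rewrite rmorphM /= mulrA.
Qed.

End Factored.

(** * Determinants of factored operators *)

Section Projections.
Context {R : realType}.
Implicit Types (f g h : R -> R[i]).
Local Notation re := (@complex.Re R).
Local Notation im := (@complex.Im R).
Local Notation nc := (@Normc.normc R).

Lemma L2_B f g : L2 f -> L2 g -> L2 (fun x => f x - g x).
Proof.
move=> fL gL; have := L2_D fL (L2_Z (-1) gL); congr L2; apply/funext => x.
by rewrite mulN1r.
Qed.

Lemma norm2N f : L2 f -> norm2 (fun x => - f x) = norm2 f.
Proof.
move=> fL; rewrite -[RHS]mul1r -(norm2_ext (fun x => mulN1r (f x))) (norm2Z (-1) fL).
by congr (_ * _); rewrite /= oppr0 expr0n /= addr0 sqrrN expr1n sqrtr1.
Qed.

Lemma norm2_triangleB f g : L2 f -> L2 g -> norm2 (fun x => f x - g x) <= norm2 f + norm2 g.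
Proof.
move=> fL gL; have := norm2_triangle fL (L2_Z (-1) gL).
rewrite (norm2_ext (f := fun x => f x + -1 * g x) (g := fun x => f x - g x)); last first.
  by move=> x; rewrite mulN1r.
by rewrite (norm2_ext (fun x => mulN1r (g x))) (norm2N gL).
Qed.

Lemma projB e N f g : Defs.orthonormal e -> L2 f -> L2 g ->
  forall x, oproj e N (fun x => f x - g x) x = oproj e N f x - oproj e N g x.
Proof.
move=> oe fL gL x; have := congr1 (fun F => F x) (projD N oe fL (L2_Z (-1) gL)).
rewrite (congr1 (fun F => F x) (projZ N (-1) oe gL)) mulN1r => <-.
by congr oproj; apply/funext => y; rewrite mulN1r.
Qed.

End Projections.

(* An operator T = \int X_t <Y_t, .> dt with |X_t| = |Y_t| square integrable in
   t, that is, a product of two Hilbert-Schmidt operators. *)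
Section FactoredOperator.
Context {R : realType}.
Variables (T : (R -> R[i]) -> R -> R[i]) (X Y : R -> R -> R[i]) (om : R -> R) (KT : R).
Implicit Types (f g h a b : R -> R[i]) (e : nat -> R -> R[i]) (N n : nat).
Local Notation nc := (@Normc.normc R).

Hypothesis TL : forall f, L2 f -> L2 (T f).
Hypothesis Tsum : forall (I : Type) (r : seq I) (F : I -> R -> R[i]) x, (forall i, L2 (F i)) ->
  T (fun x => \sum_(i <- r) F i x) x = \sum_(i <- r) T (F i) x.
Hypothesis TD : forall f g x, L2 f -> L2 g -> T (fun x => f x + g x) x = T f x + T g x.
Hypothesis TZ : forall c f x, L2 f -> T (fun x => c * f x) x = c * T f x.
Hypothesis Tb : forall f, L2 f -> norm2 (T f) <= KT * norm2 f.
Hypothesis KT0 : 0 <= KT.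
Hypothesis XL : forall t, L2 (X t).
Hypothesis YL : forall t, L2 (Y t).
Hypothesis Xom : forall t, norm2 (X t) ^+ 2 = om t.
Hypothesis Yom : forall t, norm2 (Y t) ^+ 2 = om t.
Hypothesis omL : L1 om.
Hypothesis TXY : forall a b, L2 a -> L2 b -> cL1 (fun t => inner a (X t) * inner (Y t) b) /\
  inner a (T b) = cintegral (fun t => inner a (X t) * inner (Y t) b).

Definition lc e N (b : 'cV[R[i]]_N) (x : R) : R[i] := \sum_(j < N) b j 0 * e j x.
Definition coord e N a : 'cV[R[i]]_N := \col_i inner (e i) a.
Definition opmx e N : 'M[R[i]]_N := \matrix_(i, j) inner (e i) (T (e j)).

Lemma L2_lc e N (b : 'cV[R[i]]_N) : Defs.orthonormal e -> L2 (lc e b).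
Proof. by move=> [eL _]; exact: (L2_sum _ _ (fun i : 'I_N => L2_Z (b i 0) (eL i))). Qed.

Lemma inner_lc e N (b : 'cV[R[i]]_N) f : Defs.orthonormal e -> L2 f ->
  inner f (lc e b) = \sum_(j < N) b j 0 * inner f (e j).
Proof.
move=> [eL _] fL; rewrite (inner_sumr _ _ fL (fun i : 'I_N => L2_Z (b i 0) (eL i))).
by apply: eq_bigr => i _; exact: (innerZr _ fL (eL i)).
Qed.

Lemma lc_coord e N a x : lc e (coord e N a) x = oproj e N a x.
Proof. by apply: eq_bigr => i _; rewrite mxE. Qed.

Lemma T_lc e N (b : 'cV[R[i]]_N) x : Defs.orthonormal e -> T (lc e b) x = \sum_(j < N) b j 0 * T (e j) x.
Proof.
move=> [eL _]; rewrite (Tsum _ _ (fun i : 'I_N => L2_Z (b i 0) (eL i))).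
by apply: eq_bigr => i _; exact: (TZ _ _ (eL i)).
Qed.

Lemma coord_T_lc e N (b : 'cV[R[i]]_N) : Defs.orthonormal e -> coord e N (T (lc e b)) = opmx e N *m b.
Proof.
move=> oe; have eL := oe.1; apply/colP => i; rewrite !mxE.
have -> : T (lc e b) = (fun x => \sum_(j < N) b j 0 * T (e j) x) by apply/funext => x; exact: T_lc.
rewrite (inner_sumr _ _ (eL i) (fun j : 'I_N => L2_Z (b j 0) (TL (eL j)))).
by apply: eq_bigr => j _; rewrite (innerZr _ (eL i) (TL (eL j))) mxE; exact: mulrC.
Qed.

Lemma lcB e N (b c : 'cV[R[i]]_N) x : lc e (b - c) x = lc e b x - lc e c x.
Proof. by rewrite /lc -sumrB; apply: eq_bigr => i _; rewrite !mxE mulrBl. Qed.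

Lemma lcZ e N (z : R[i]) (b : 'cV[R[i]]_N) x : lc e (z *: b) x = z * lc e b x.
Proof. by rewrite /lc mulr_sumr; apply: eq_bigr => i _; rewrite !mxE mulrA. Qed.

(* The n-th coefficient of \adj (1 + z T_N), where T_N is the N-th section of T. *)
Definition adjop e n N a := lc e (adj_coef (opmx e N) n *m coord e N a).

Lemma adjop0 e N a x : adjop e 0 N a x = oproj e N a x.
Proof. by rewrite /adjop mul1mx lc_coord. Qed.

Lemma adjopS e n N a x : Defs.orthonormal e -> adjop e n.+1 N a x =
  minor_sum (opmx e N) n.+1 * oproj e N a x - oproj e N (T (adjop e n N a)) x.
Proof.
move=> oe; rewrite /adjop /= mulmxBl mul_scalar_mx lcB lcZ lc_coord -mulmxA -(coord_T_lc _ oe).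
by rewrite lc_coord.
Qed.

Lemma L2_adjop e n N a : Defs.orthonormal e -> L2 (adjop e n N a).
Proof. by move=> oe; exact: L2_lc. Qed.

Lemma minor_sum_adjop e n N : Defs.orthonormal e ->
  cL1 (fun t => inner (Y t) (adjop e n N (X t))) /\
  n.+1%:R * minor_sum (opmx e N) n.+1 = cintegral (fun t => inner (Y t) (adjop e n N (X t))).
Proof.
move=> oe; have eL := oe.1; set B := adj_coef (opmx e N) n.
have E : (fun t => inner (Y t) (adjop e n N (X t))) =
    (fun t => \sum_(i < N) \sum_(j < N) B i j * (inner (e j) (X t) * inner (Y t) (e i))).
  apply/funext => t; rewrite (inner_lc _ oe (YL t)); apply: eq_bigr => i _.
  by rewrite mxE mulr_suml; apply: eq_bigr => j _; rewrite mxE mulrA.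
have L (i j : 'I_N) : cL1 (fun t => B i j * (inner (e j) (X t) * inner (Y t) (e i))).
  exact: cL1_Z (proj1 (TXY (eL j) (eL i))).
have L2' (i : 'I_N) : cL1 (fun t => \sum_(j < N) B i j * (inner (e j) (X t) * inner (Y t) (e i))).
  exact: cL1_sum (L i).
rewrite E; split; first exact: cL1_sum L2'.
rewrite minor_sum_adj_coef -/B (cint_sum _ _ L2') /mxtrace.
transitivity (\sum_(j < N) \sum_(i < N) opmx e N j i * B i j).
  by apply: eq_bigr => j _; rewrite mxE.
rewrite exchange_big /=; apply: eq_bigr => i _; rewrite (cint_sum _ _ (L i)).
apply: eq_bigr => j _; have [c1 c2] := TXY (eL j) (eL i).
by rewrite (cintZ _ c1) -c2 mxE; exact: mulrC.
Qed.

Variable F : nat -> R[i].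

(* The coefficients of det(I + z T) (I + z T)^-1, F n being those of det(I + z T). *)
Fixpoint limop n a : R -> R[i] := if n is m.+1 then fun x => F n * a x - T (limop m a) x else a.

Hypothesis F0 : F 0 = 1.
(** The limiting form of [minor_sum_adjop], which determines F recursively; [trace_limop] verifies
    it for the Birman-Schwinger operator. *)
Hypothesis FS : forall n, cintegral (fun t => inner (Y t) (limop n (X t))) = n.+1%:R * F n.+1.

Lemma L2_limop n a : L2 a -> L2 (limop n a).
Proof. by move=> aL; elim: n => [|n IH]; [exact: aL|exact: (L2_B (L2_Z (F n.+1) aL) (TL IH))]. Qed.

(** The three claims feed each other: the bound uniform in N dominates the trace integrand by K
    om(t), strong convergence gives its pointwise limit in t, so the next minor sum converges, and
    with it the next adjugate coefficient. *)
Lemma adjop_limit e n : orthonormal_basis e ->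
  [/\ exists2 K, 0 <= K & forall N a, L2 a -> norm2 (adjop e n N a) <= K * norm2 a,
      forall a, L2 a -> (fun N => norm2 (fun x => adjop e n N a x + (-1) * limop n a x)) @ \oo --> (0 : R) &
      ccvg (fun N => minor_sum (opmx e N) n) (F n)].
Proof.
move=> [oe be]; elim: n => [|n [[K K0 HK] Hlim Hc]].
  split.
  - exists 1 => // N a aL; rewrite (norm2_ext (adjop0 e N a)) mul1r; exact: norm2_proj oe aL.
  - move=> a aL; have := be a aL.
    rewrite (_ : (fun N => norm2 (fun x => adjop e 0 N a x + (-1) * limop 0 a x)) = (fun N => norm2 (fun x => a x - oproj e N a x))) //.
    apply/funext => N; rewrite -(norm2N (L2_B aL (L2_proj N a oe))); apply: norm2_ext => x.
    by rewrite adjop0 mulN1r opprB.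
  - rewrite F0 (_ : (fun N => _) = (fun=> 1)); first exact: ccvg_cst.
    by apply/funext => N; exact: minor_sum0.
have mb N t : nc (inner (Y t) (adjop e n N (X t))) <= K * om t.
  apply: le_trans (cauchy_schwarz (YL t) (L2_adjop n N (X t) oe)) _.
  have Y0 := norm2_ge0 (Y t); have := ler_wpM2l Y0 (HK N (X t) (XL t)).
  move=> /le_trans; apply; rewrite mulrCA.
  have -> : norm2 (X t) = norm2 (Y t).
    by apply/eqP; rewrite -(eqrXn2 (n := 2)) ?norm2_ge0 // Xom Yom.
  by rewrite -expr2 Yom.
have omK : L1 (fun t => K * om t) by exact: L1_Z.
have cn : ccvg (fun N => minor_sum (opmx e N) n.+1) (F n.+1).
  have n0 : n.+1%:R != 0 :> R[i] by rewrite pnatr_eq0.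
  have h : ccvg (fun N => cintegral (fun t => inner (Y t) (adjop e n N (X t)))) (n.+1%:R * F n.+1).
    rewrite -FS; apply: (cint_dct _ _ mb omK).
      by move=> N; exact: (minor_sum_adjop n N oe).1.
    move=> t; exact: (inner_cvg (YL t) (fun N => L2_adjop n N (X t) oe) (L2_limop n (XL t)) (Hlim _ (XL t))).
  have := ccvgZ n.+1%:R^-1 h; rewrite mulrA mulVf // mul1r.
  rewrite (_ : (fun N => _ * cintegral _) = (fun N => minor_sum (opmx e N) n.+1)) //.
  by apply/funext => N; rewrite -(minor_sum_adjop n N oe).2 mulrA mulVf // mul1r.
have msb N : nc (minor_sum (opmx e N) n.+1) <= 2 * lint (fun t => K * om t).
  apply: le_trans (normc_cint (minor_sum_adjop n N oe).1 omK (mb N)).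
  rewrite -(minor_sum_adjop n N oe).2 normcM ler_peMl ?normc_ge0 //.
  by rewrite -(rmorph_nat (real_complex R)) normc_real normr_nat ler1n.
have I0 : 0 <= 2 * lint (fun t => K * om t).
  by rewrite mulr_ge0 // lint_ge0 // => t; rewrite mulr_ge0 // -Xom sqr_ge0.
have aLn N a := L2_adjop n N a oe.
split; last exact: cn.
  exists (2 * lint (fun t => K * om t) + KT * K); first by rewrite addr_ge0 // mulr_ge0.
  move=> N a aL; rewrite (norm2_ext (fun x => adjopS n N a x oe)).
  have PL := L2_proj N a oe; have TaL := TL (aLn N a).
  apply: le_trans (norm2_triangleB (L2_Z _ PL) (L2_proj N _ oe)) _.
  rewrite mulrDl (norm2Z _ PL); apply: lerD.
    by apply: ler_pM; rewrite ?normc_ge0 ?norm2_ge0 //; exact: norm2_proj oe aL.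
  apply: le_trans (norm2_proj N oe TaL) _; apply: le_trans (Tb (aLn N a)) _.
  by rewrite -mulrA ler_wpM2l // HK.
move=> a aL; have bL := L2_limop n aL; have TbL := TL bL.
pose c N := minor_sum (opmx e N) n.+1.
pose d N := norm2 (fun x => a x - oproj e N a x).
pose d' N := norm2 (fun x => T (limop n a) x - oproj e N (T (limop n a)) x).
pose d2 N := norm2 (fun x => adjop e n N a x + (-1) * limop n a x).
have dL N : L2 (fun x => a x - oproj e N a x) by exact: L2_B aL (L2_proj N a oe).
have dL' N : L2 (fun x => T (limop n a) x - oproj e N (T (limop n a)) x) by exact: L2_B TbL (L2_proj N _ oe).
have dL2 N : L2 (fun x => adjop e n N a x + (-1) * limop n a x) by exact: L2_D (aLn N a) (L2_Z _ bL).
apply: (squeeze_cvgr _ (cvg_cst 0) (h := fun N => nc (c N - F n.+1) * norm2 a + nc (F n.+1) * d N + KT * d2 N + d' N)).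
  apply: nearW => N; rewrite norm2_ge0 /=.
  (* Four sources of error: the scalar coefficient, the projection of a, the previous adjugate
     coefficient, and the projection of its limit after T. *)
  pose f1 x := (c N - F n.+1) * oproj e N a x.
  pose f2 x := F n.+1 * (a x - oproj e N a x).
  pose f3 x := oproj e N (T (fun x => adjop e n N a x + (-1) * limop n a x)) x.
  pose f4 x := T (limop n a) x - oproj e N (T (limop n a)) x.
  have L1' : L2 f1 := L2_Z _ (L2_proj N a oe).
  have L2' : L2 f2 := L2_Z _ (dL N).
  have L3 : L2 f3 := L2_proj N _ oe.
  have L4 : L2 f4 := dL' N.
  have -> : norm2 (fun x => adjop e n.+1 N a x + -1 * limop n.+1 a x) = norm2 (fun x => ((f1 x - f2 x) - f3 x) + f4 x).
    apply: norm2_ext => x; rewrite (adjopS n N a x oe) /f1 /f2 /f3 /f4.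
    have -> : T (fun x => adjop e n N a x + (-1) * limop n a x) = (fun x => T (adjop e n N a) x - T (limop n a) x).
      by apply/funext => y; rewrite (TD y (aLn N a) (L2_Z (-1) bL)) (TZ (-1) y bL) mulN1r.
    rewrite (projB N oe (TL (aLn N a)) TbL) mulN1r -/(c N) /=.
    move: (c N) (F n.+1) (a x) (oproj e N a x) (oproj e N (T (adjop e n N a)) x) (T (limop n a) x) (oproj e N (T (limop n a)) x) => *; ring.
  apply: le_trans (norm2_triangle (L2_B (L2_B L1' L2') L3) L4) _; rewrite lerD2r.
  apply: le_trans (norm2_triangleB (L2_B L1' L2') L3) _; apply: lerD.
    apply: le_trans (norm2_triangleB L1' L2') _.
    rewrite (norm2Z _ (dL N)) lerD2r (norm2Z _ (L2_proj N a oe)) ler_wpM2l ?normc_ge0 //.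
    exact: norm2_proj oe aL.
  by apply: le_trans (norm2_proj N oe (TL (dL2 N))) _; exact: Tb.
have z0 : nc 0 = 0 :> R by rewrite /= expr0n /= addr0 sqrtr0.
rewrite -[X in _ --> X](_ : 0 * norm2 a + nc (F n.+1) * 0 + KT * 0 + 0 = 0); last by rewrite mul0r !mulr0 !addr0.
apply: cvgD; first apply: cvgD; first apply: cvgD.
- by apply: cvgM; [exact/ccvgP|exact: cvg_cst].
- by apply: cvgM; [exact: cvg_cst|exact: be].
- by apply: cvgM; [exact: cvg_cst|exact: Hlim].
- exact: be.
Qed.

(** * Rank one perturbation of a factored operator *)

Variables (A : (R -> R[i]) -> R -> R[i]) (p q : R -> R[i]).
Hypothesis pL : L2 p.
Hypothesis qL : L2 q.
Hypothesis AE : forall f, L2 f -> A f = (fun x => T f x - inner p f * q x).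

Let AL f : L2 f -> L2 (A f).
Proof. by move=> fL; rewrite (AE fL); exact: (L2_B (TL fL) (L2_Z (inner p f) qL)). Qed.

Let inner_A a f : L2 a -> L2 f -> inner a (A f) = inner a (T f) - inner p f * inner a q.
Proof.
move=> aL fL; rewrite (AE fL) -mulNr -(innerZr (- inner p f) aL qL).
rewrite -(innerDr aL (TL fL) (L2_Z (- inner p f) qL)); congr inner.
by apply/funext => x; rewrite mulNr.
Qed.

Let A_bounded : bounded_operator A.
Proof.
split; first exact: AL.
  move=> c f g fL gL; apply: aeW => x; have cfL := L2_Z c fL; have cfgL := L2_D cfL gL.
  rewrite (AE cfgL) (AE fL) (AE gL) (TD x cfL gL) (TZ c x fL) (innerDr pL cfL gL) (innerZr c pL fL).
  by move: (T f x) (T g x) (inner p f) (inner p g) (q x) => *; ring.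
exists (KT + norm2 p * norm2 q) => f fL; rewrite (AE fL).
apply: le_trans (norm2_triangleB (TL fL) (L2_Z (inner p f) qL)) _.
rewrite mulrDl (norm2Z _ qL); apply: lerD; first exact: Tb.
by rewrite mulrAC ler_wpM2r ?norm2_ge0 //; exact: cauchy_schwarz.
Qed.

(* AM-GM and Bessel's inequality bound the sum of |<e_n, T f_n>| by twice the
   integral of om. *)
Lemma factored_trace_class : trace_class A.
Proof.
split=> // e f oe of_; have eL := oe.1; have fL := of_.1.
pose h n t := inner (e n) (X t) * inner (Y t) (f n).
have hL n : cL1 (h n) := (TXY (eL n) (fL n)).1.
have am (x y : R) : 2 * (x * y) <= x ^+ 2 + y ^+ 2.
  by have := sqr_ge0 (x - y); rewrite sqrrB; lra.
have sq_le (F1 F2 : nat -> R) N (B1 B2 : R) : \sum_(n < N) F1 n ^+ 2 <= B1 -> \sum_(n < N) F2 n ^+ 2 <= B2 ->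
    2 * \sum_(n < N) F1 n * F2 n <= B1 + B2.
  move=> h1 h2; apply: le_trans (lerD h1 h2); rewrite mulr_sumr -big_split /=.
  by apply: ler_sum => i _; exact: am.
have bes a N : L2 a -> \sum_(n < N) nc (inner a (f n)) ^+ 2 <= norm2 a ^+ 2.
  move=> aL; apply: le_trans (bessel N of_ aL); apply: ler_sum => i _.
  by rewrite (inner_conj (fL i) aL) normc_conj.
have bound N : \sum_(n < N) nc (inner (e n) (A (f n))) <= 2 * lint om + (norm2 p ^+ 2 + norm2 q ^+ 2).
  apply: (@le_trans _ _ (\sum_(n < N) (2 * lint (fun t => nc (h n t)) + nc (inner p (f n)) * nc (inner (e n) q)))).
    apply: ler_sum => n _; rewrite (inner_A (eL n) (fL n)) -mulNr.
    apply: le_trans (normcD _ _) _; apply: lerD; last by rewrite mulNr -mulN1r normcM normcM [nc (-1)]/= oppr0 expr0n addr0 sqrrN expr1n sqrtr1 mul1r.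
    rewrite (TXY (eL n) (fL n)).2; exact: normc_cint (hL n) (cL1_normc (hL n)) (fun t => lexx _).
  rewrite big_split /=; apply: lerD.
    rewrite -mulr_sumr ler_wpM2l // -(lint_sum _ _ (fun n : 'I_N => cL1_normc (hL n))).
    apply: lint_le => //; first exact: (L1_sum _ _ (fun n : 'I_N => cL1_normc (hL n))).
    move=> t; have := sq_le (fun n => nc (inner (e n) (X t))) (fun n => nc (inner (Y t) (f n))) N _ _
      (bessel N oe (XL t)) (bes _ N (YL t)).
    rewrite Xom Yom (_ : \sum_(i < N) nc (h i t) = \sum_(n < N) nc (inner (e n) (X t)) * nc (inner (Y t) (f n))).
      by move: (\sum_(n < N) _) (om t) => S o; lra.
    by apply: eq_bigr => n _; exact: normcM.
  have S0 : 0 <= \sum_(n < N) nc (inner p (f n)) * nc (inner (e n) q).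
    by apply: sumr_ge0 => n _; rewrite mulr_ge0 ?normc_ge0.
  have := sq_le (fun n => nc (inner p (f n))) (fun n => nc (inner (e n) q)) N _ _ (bes _ N pL) (bessel N oe qL).
  by move: S0; move: (\sum_(n < N) _) (norm2 p ^+ 2) (norm2 q ^+ 2) => *; lra.
apply: (@le_lt_trans _ _ (2 * lint om + (norm2 p ^+ 2 + norm2 q ^+ 2))%:E); last exact: ltry.
apply: lime_le; first by apply: is_cvg_nneseries => n _ _; rewrite lee_fin normc_ge0.
by apply: nearW => N; rewrite sumEFin lee_fin big_mkord.
Qed.

Hypothesis Tq : forall x, T q x = - q x.
Hypothesis pq : inner p q = 1.

Let limop_q n x : limop n q x = (\sum_(m < n.+1) F m) * q x.
Proof.
elim: n x => [|n IH] x; first by rewrite big_ord1 F0 mul1r.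
have -> : limop n.+1 q x = F n.+1 * q x - T (limop n q) x by [].
have -> : limop n q = (fun x => (\sum_(m < n.+1) F m) * q x) by exact/funext.
rewrite (TZ _ x qL) Tq [in RHS]big_ord_recr; move: (\sum_(m < n.+1) F m) => S /=; ring.
Qed.

Lemma exterior_trace_limit e n : orthonormal_basis e ->
  ccvg (exterior_trace A e n) (F n - \sum_(m < n) F m).
Proof.
move=> oeb; have oe := oeb.1; have eL := oe.1.
have E N : exterior_trace A e n N = minor_sum (opmx e N - coord e N q *m \row_j inner p (e j)) n.
  apply: eq_bigr => i _; congr (\det _); apply/matrixP => a b.
  by rewrite !mxE big_ord1 !mxE (inner_A (eL _) (eL _)) mulrC.
have -> : exterior_trace A e n = (fun N => minor_sum (opmx e N - coord e N q *m \row_j inner p (e j)) n) by exact/funext.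
case: n {E} => [|n].
  rewrite big_ord0 subr0 F0 (_ : (fun N => _) = (fun=> 1)); first exact: ccvg_cst.
  by apply/funext => N; exact: minor_sum0.
have [_ Hl Hc] := adjop_limit n oeb; have [_ _ Hc1] := adjop_limit n.+1 oeb.
rewrite (_ : (fun N => _) = (fun N => minor_sum (opmx e N) n.+1 - inner p (adjop e n N q))); last first.
  apply/funext => N; rewrite minor_sum_sub_rank1; congr (_ - _).
  rewrite -mulmxA (inner_lc _ oe pL) mxE; apply: eq_bigr => j _.
  by rewrite mxE mulrC.
apply: ccvgB Hc1 _.
have -> : \sum_(m < n.+1) F m = inner p (limop n q).
  have -> : limop n q = (fun x => (\sum_(m < n.+1) F m) * q x) by apply/funext => x; exact: limop_q.
  by rewrite (innerZr _ pL qL) pq mulr1.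
exact: (inner_cvg pL (fun N => L2_adjop n N q oe) (L2_limop n qL) (Hl q qL)).
Qed.

End FactoredOperator.

(** * The Jost and Volterra equations *)

Section JostSeries.
Context {R : realType} (k : R) (w : R -> R).
Hypotheses (k0 : 0 < k) (wL : L1 w).
Variables (b : bool).
Implicit Types (f g h y : R -> R).

Lemma L1_vker_bdd x h : bdd h -> L1 (fun z => vker k b x z * (w z * h z)).
Proof.
move=> bh; apply: L1_bM (meas2_sec2 x (meas2_vker k b)) _ (bdd_wL1 wL bh) => z.
exact: vker_le1.
Qed.

Lemma vopD f g x : bdd f -> bdd g -> vop k w b (fun x => f x + g x) x = vop k w b f x + vop k w b g x.
Proof.
move=> bf bg; rewrite /vop -(lintD (L1_vker_bdd x bf) (L1_vker_bdd x bg)).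
by congr lint; apply/funext => z; ring.
Qed.

Lemma vopZ c f x : bdd f -> vop k w b (fun x => c * f x) x = c * vop k w b f x.
Proof.
move=> bf; rewrite /vop -(lintZ c (L1_vker_bdd x bf)).
by congr lint; apply/funext => z; ring.
Qed.

Lemma iter_vopD n f g : bdd f -> bdd g ->
  iter n (vop k w b) (fun x => f x + g x) = (fun x => iter n (vop k w b) f x + iter n (vop k w b) g x).
Proof.
move=> bf bg; elim: n => // n IH; apply/funext => x; rewrite !iterS IH.
by rewrite vopD //; exact: bdd_iter_vop.
Qed.

Lemma iter_vopN n f : bdd f ->
  iter n (vop k w b) (fun x => - f x) = (fun x => - iter n (vop k w b) f x).
Proof.
move=> bf; elim: n => // n IH; apply/funext => x; rewrite !iterS IH -mulN1r -vopZ; last exact: bdd_iter_vop.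
by congr vop; apply/funext => z; rewrite mulN1r.
Qed.

(** Both signs yield the same coefficients, which lets one computation serve the two formulas. *)
Lemma jost_coef_side n : lint (fun z => w z * jost k w b n z) = jost_coef k w n.+1.
Proof.
case: b; first reflexivity.
have := jost_pair k0 wL 0 n; rewrite add0n => <-.
by congr lint; apply/funext => z; rewrite jost0 mulr1.
Qed.

Let Mom h n := lint (fun z => w z * iter n (vop k w b) h z).

Let MomL h n : bdd h -> L1 (fun z => w z * iter n (vop k w b) h z).
Proof. by move=> bh; apply: bdd_wL1 => //; exact: bdd_iter_vop. Qed.

Lemma moment_cvg0 h : bdd h -> (fun n => lint (fun z => w z * iter n (vop k w b) h z)) @ \oo --> (0 : R).
Proof.
move=> bh; have [_ [M hM]] := bh; pose Q := lint (fun z => `|w z|).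
have M0 : 0 <= M by apply: le_trans (hM 0); exact: normr_ge0.
have B n : `|Mom h n| <= M * Q * exp_coeff Q n.
  have [mi [C hC]] := bdd_iter_vop k0 wL b n bh.
  have E : (fun z => w z * iter n (vop k w b) h z) = (fun z => iter n (vop k w b) h z * w z) by apply/funext => z; exact: mulrC.
  rewrite /Mom E (_ : M * Q * exp_coeff Q n = M * (Q ^+ n / n`!%:R) * Q); last by rewrite /exp_coeff /=; ring.
  apply: lint_normM => // x; apply: le_trans (iter_vop_le k0 wL b n x bh hM) _.
  rewrite ler_wpM2l // ler_wpM2r ?invr_ge0 //.
  by rewrite lerXn2r ?nnegrE ?vtail_ge0 ?vtail_le // lint_ge0.
exact: exp_coeff_squeeze B.
Qed.

Variables (y phi : R -> R).
Hypotheses (by_ : bdd y) (bphi : bdd phi).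
Hypothesis yE : forall x, y x = 1 + vop k w b y x.
Hypothesis phiE : forall x, phi x = - y x + vop k w b phi x.
Hypothesis Fsum : (fun n => \sum_(m < n) jost_coef k w m) @ \oo --> (0 : R).

Let F := jost_coef k w.

Let MyS n : Mom y n = F n.+1 + Mom y n.+1.
Proof.
have bv := bdd_iter_vop k0 wL b 1 by_.
have E : iter n (vop k w b) y = (fun x => jost k w b n x + iter n.+1 (vop k w b) y x).
  rewrite -[in RHS]addn1 iterD -iter_vopD //; last exact: bdd_cst.
  by congr iter; apply/funext => x; rewrite yE.
rewrite /F -jost_coef_side /Mom -lintD; [|exact: bdd_wL1 (bdd_jost k0 wL b n)|exact: MomL].
by congr lint; apply/funext => z; rewrite E mulrDr.
Qed.

Let MphiS n : Mom phi n = - Mom y n + Mom phi n.+1.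
Proof.
have bv := bdd_iter_vop k0 wL b 1 bphi; have bNy := bdd_Z (-1) by_.
have E : iter n (vop k w b) phi = (fun x => - iter n (vop k w b) y x + iter n.+1 (vop k w b) phi x).
  have {}bNy : bdd (fun x => - y x) by move: bNy; under eq_fun do rewrite mulN1r.
  transitivity (fun x => iter n (vop k w b) (fun x => - y x) x + iter n (vop k w b) (vop k w b phi) x).
    rewrite -(iter_vopD n bNy bv); congr iter; apply/funext => x; exact: phiE.
  by apply/funext => x; rewrite iter_vopN // iterSr.
rewrite /Mom -lintN; last exact: MomL.
rewrite -lintD; [|exact/L1_N/MomL|exact: MomL].
by congr lint; apply/funext => z; rewrite E mulrDr mulrN.
Qed.

Let sumF n : \sum_(m < n.+1) F m = 1 + Mom y 0 - Mom y n.
Proof.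
elim: n => [|n IH]; first by rewrite big_ord1 addrK.
have -> : \sum_(m < n.+2) F m = \sum_(m < n.+1) F m + F n.+1 by rewrite big_ord_recr.
rewrite IH (MyS n); move: (Mom y 0) (Mom y n.+1); generalize (F n.+1) => f a c; ring.
Qed.

(** The partial sums of F tend to 1 + \int w y, the Jost function at zero energy, and to 0 by
    hypothesis. *)
Let Mom0 : 1 + Mom y 0 = 0.
Proof.
apply/eqP; rewrite -[X in X == _]subr0.
have c1 : (fun n => 1 + Mom y 0 - Mom y n) @ \oo --> 1 + Mom y 0 - 0.
  by apply: cvgB; [exact: cvg_cst|exact: moment_cvg0].
have c2 : (fun n => 1 + Mom y 0 - Mom y n) @ \oo --> (0 : R).
  rewrite (_ : (fun n => _) = (fun n => \sum_(m < n.+1) F m)); last by apply/funext => n; rewrite sumF.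
  by move: Fsum; rewrite -(@cvg_shiftS R^o).
exact/eqP/(cvg_unique _ c1 c2).
Qed.

(* The moments r_n of y satisfy r_n = F_(n+1) + r_(n+1), and those of phi
   satisfy rho_n = - r_n + rho_(n+1), so both sums telescope. *)
Lemma jost_series : (fun K => \sum_(n < K) (F n - \sum_(m < n) F m)) @ \oo --> - lint (fun z => w z * phi z).
Proof.
have sF n : \sum_(m < n.+1) F m = - Mom y n by rewrite sumF Mom0 sub0r.
have E K : \sum_(n < K.+1) (F n - \sum_(m < n) F m) = - Mom y K + Mom phi K - Mom phi 0.
  elim: K => [|K IH].
    by rewrite big_ord1 big_ord0 subr0 addrK -sF big_ord1.
  have -> : \sum_(n < K.+2) (F n - \sum_(m < n) F m) =
      \sum_(n < K.+1) (F n - \sum_(m < n) F m) + (F K.+1 - \sum_(m < K.+1) F m) by rewrite big_ord_recr.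
  rewrite IH sF (MphiS K) (MyS K).
  move: (Mom y K.+1) (Mom phi K.+1) (Mom phi 0); generalize (F K.+1) => f a c d; ring.
rewrite -(@cvg_shiftS R^o) (_ : [sequence _]_n = (fun K => - Mom y K + Mom phi K - Mom phi 0)); last exact/funext.
have c0 : (fun K => - Mom y K + Mom phi K - Mom phi 0) @ \oo --> - 0 + 0 - Mom phi 0.
  apply: cvgB; last exact: cvg_cst.
  by apply: cvgD; [apply: cvgN; exact: moment_cvg0|exact: moment_cvg0].
by move: c0; rewrite oppr0 add0r sub0r.
Qed.

End JostSeries.

(** * Conjugating the Volterra equations by e^(+-kx) *)

Section VolterraSolution.
Context {R : realType} (V : R -> R) (Vinf : R).
Hypothesis Vinf0 : 0 < Vinf.
Hypothesis WL : L1 (potW V Vinf).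
Let k := Num.sqrt Vinf.
Let w x := potW V Vinf x / (2 * k).

Definition is_plus (s : side) := if s is Plus then true else false.

Let k0 : 0 < k. Proof. by rewrite sqrtr_gt0. Qed.

Let wL : L1 w.
Proof. by rewrite /w; under eq_fun do rewrite mulrC; exact: L1_Z. Qed.

Lemma volterra_bdd (s : side) (f0 Y : R -> R) : volterra_solution V Vinf s f0 Y ->
  bdd (fun x => expR (side_sg s * k * x) * Y x).
Proof.
move=> [mY [M hM] _]; split; last by exists M.
apply: measL_M mY; apply: (@measL_comp R (fun x => expR (side_sg s * k * x))); last exact: measL_id.
by apply: measurableT_comp; [exact: measurable_expR|apply: measurable_funM; [exact: measurable_cst|exact: measurable_id]].
Qed.

Lemma integral_toE (s : side) (x : R) (f : R -> R) :
  integral_to s x f = side_sg s * lint (fun z => if (if s is Plus then x <= z else z <= x) then f z else 0).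
Proof.
rewrite /integral_to; case: s; rewrite /side_sg ?mul1r ?mulN1r ?/lint Rintegral_mkcond; congr (Rintegral _ _ _) || congr (- Rintegral _ _ _).
- apply/funext => z; rewrite patchE; case: (leP x z) => h; first by rewrite mem_set.
  by rewrite memNset //= leNgt h.
- apply/funext => z; rewrite patchE; case: (leP z x) => h; first by rewrite mem_set.
  by rewrite memNset //= leNgt h.
Qed.

(** The conjugation turns the growing sinh into the bounded (1 - e^(-2k|x-z|)) / 2, and the
    prefactor 1 / k then makes W into w. Both kernels vanish at z = x, so closed and strict
    half-lines agree. *)
Lemma volterra_vop (s : side) (f0 Y : R -> R) x : volterra_solution V Vinf s f0 Y ->
  expR (side_sg s * k * x) * Y x = expR (side_sg s * k * x) * f0 x +
    vop k w (is_plus s) (fun x => expR (side_sg s * k * x) * Y x) x.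
Proof.
move=> vs; have by_ := volterra_bdd vs; have [_ _ YE] := vs.
have vL := L1_vker_bdd k0 wL (is_plus s) x by_.
rewrite [in LHS]YE mulrBr -/k; congr (_ + _); rewrite integral_toE.
rewrite (_ : (fun z => _) = (fun z => (- side_sg s * k * expR (- (side_sg s * k * x))) *
   (vker k (is_plus s) x z * (w z * (expR (side_sg s * k * z) * Y z))))); last first.
  apply/funext => z; rewrite /vker /before /w /sinh -/(potW V Vinf z) -/k; move: (potW V Vinf z) (Y z) => Wz Yz.
  have kn : k != 0 by rewrite gt_eqF.
  (* In terms of A and B the identity of kernels is rational. *)
  pose A := expR (k * x); pose B := expR (k * z).
  have A0 : A != 0 by rewrite gt_eqF // expR_gt0.
  have B0 : B != 0 by rewrite gt_eqF // expR_gt0.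
  have E1 : expR (k * (x - z)) = A / B by rewrite mulrBr expRD expRN.
  have E2 : expR (- (k * (x - z))) = B / A by rewrite -mulrN opprB mulrBr expRD expRN.
  have E3 : expR (- (2 * k * (z - x))) = (A / B) ^+ 2.
    by rewrite -E1 -expRM_natl; congr expR; ring.
  have E4 : expR (- (2 * k * (x - z))) = (B / A) ^+ 2.
    by rewrite -E2 -expRM_natl; congr expR; ring.
  have E5 : expR (- (k * x)) = A^-1 by rewrite expRN.
  have E6 : expR (- (k * z)) = B^-1 by rewrite expRN.
  rewrite E1 E2; case: s {vs by_ YE vL} => /=.
    rewrite !mul1r E5 -/B; case: (ltgtP x z) => [xz|zx|xz]; rewrite /= ?mul0r ?mulr0 //.
      by rewrite ltr0_norm ?subr_lt0 // opprB E3; field; rewrite kn A0 B0.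
    by rewrite (_ : A = B) ?subrr ?mul0r // /A /B xz.
  rewrite !mulN1r !mulNr E6 !opprK -/A; case: (ltgtP z x) => [xz|zx|xz]; rewrite /= ?mul0r ?mulr0 //.
    by rewrite gtr0_norm ?subr_gt0 // E4; field; rewrite kn A0 B0.
  by rewrite (_ : A = B) ?subrr ?mul0r // /A /B xz.
rewrite (lintZ _ vL) -/(vop _ _ _ _ _).
have e0 : expR (side_sg s * k * x) * expR (- (side_sg s * k * x)) = 1 by rewrite -expRD addrN expR0.
have s1 : side_sg s * side_sg s = 1 :> R by case: s {vs by_ YE vL e0} => /=; ring.
have kk : k^-1 * k = 1 by rewrite mulVf // gt_eqF.
move: (expR (side_sg s * k * x)) (expR (- (side_sg s * k * x))) e0 => e e' e0.
move: (vop _ _ _ _ _) => v.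
transitivity (side_sg s * side_sg s * (k^-1 * k) * (e * e') * v); first by ring.
by rewrite s1 kk e0 !mul1r.
Qed.

End VolterraSolution.

(** * The determinant *)

Section BirmanSchwinger.
Context {R : realType}.
Variables (k : R) (W u v f : R -> R).
Hypothesis k0 : 0 < k.
Hypothesis WL : L1 W.
Hypothesis mu : measL u.
Hypothesis mv : measL v.
Hypothesis u2 : forall x, u x ^+ 2 = `|W x|.
Hypothesis v2 : forall x, v x ^+ 2 = `|W x|.
Hypothesis uv : forall x, u x * v x = W x.
Hypothesis bf : bdd f.
Hypothesis fE : forall x, f x = - lint (fun y => green k x y * (W y * f y)).

Let w x := W x / (2 * k).
Let F n : R[i] := (jost_coef k w n)%:C.
Let c0 := (lint (fun x => W x * f x ^+ 2))^-1.
Let p (x : R) : R[i] := (v x * f x)%:C.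
Let q (x : R) : R[i] := (c0 * (u x * f x))%:C.

Hypothesis energy_neq0 : lint (fun x => W x * f x ^+ 2) != 0.

Lemma bso_real (r : R -> R) x :
  bso k u v (fun x => (r x)%:C) x = (u x * lint (fun y => green k x y * v y * r y))%:C.
Proof. by rewrite bsoE inner_real_real -rmorphM. Qed.

(** Since u v = W, the limiting recursion started at u l(., t) keeps the factor u and reduces to
    [hgiter]. *)
Let limop_hgl n t x : limop (bso k u v) F n (hgl k u t) x = (u x * hgiter k W n x t)%:C.
Proof.
elim: n x => // n IH x.
have -> : limop (bso k u v) F n.+1 (hgl k u t) x =
  F n.+1 * hgl k u t x - bso k u v (limop (bso k u v) F n (hgl k u t)) x by [].
have -> : limop (bso k u v) F n (hgl k u t) = (fun x => (u x * hgiter k W n x t)%:C) by exact/funext.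
rewrite bso_real -rmorphM -rmorphB; congr (_%:C).
have -> : hgiter k W n.+1 x t = jost_coef k w n.+1 * halfgreen k x t - lint (fun y => green k x y * (W y * hgiter k W n y t)) by [].
rewrite (_ : lint (fun y => green k x y * v y * _) = lint (fun y => green k x y * (W y * hgiter k W n y t))).
  by generalize (jost_coef k w n.+1) => c; move: (lint _) => I; ring.
by congr lint; apply/funext => y; rewrite -uv; ring.
Qed.

Let trace_limop n : cintegral (fun t => inner (hgl k v t) (limop (bso k u v) F n (hgl k u t))) = n.+1%:R * F n.+1.
Proof.
transitivity (cintegral (fun t => (lint (fun x => W x * (halfgreen k x t * hgiter k W n x t)))%:C)).
  apply: cint_ext => t.
  have -> : limop (bso k u v) F n (hgl k u t) = (fun x => (u x * hgiter k W n x t)%:C) by apply/funext => x; exact: limop_hgl.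
  rewrite inner_real_real; congr (lint _)%:C; apply/funext => x; rewrite -uv; ring.
rewrite cint_real (lint_hgiter_diag k0 WL n).2 rmorphM /=; congr (_ * _).
exact: (rmorph_nat (real_complex R)).
Qed.

Let rL2_f (r : R -> R) : rL2 r -> rL2 (fun x => r x * f x).
Proof.
move=> rr; have [mf [C fC]] := bf.
by rewrite (_ : (fun x => _) = (fun x => f x * r x)); [exact: rL2_bM mf fC rr|apply/funext => x; exact: mulrC].
Qed.

Let pL : L2 p.
Proof. exact: L2_real (rL2_f (rL2_sqrtabs WL mv v2)). Qed.

Let qL : L2 q.
Proof. exact: L2_real (rL2_Z c0 (rL2_f (rL2_sqrtabs WL mu u2))). Qed.

Let pq : inner p q = 1.
Proof.
rewrite inner_real_real (_ : (fun x => _) = (fun x => c0 * (W x * f x ^+ 2))); last first.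
  by apply/funext => x; rewrite -uv; ring.
have WfL : L1 (fun x => W x * f x ^+ 2).
  rewrite (_ : (fun x => _) = (fun x => f x ^+ 2 * W x)); first exact: bdd_L1 (bdd_M bf bf) WL.
  by apply/funext => x; exact: mulrC.
by rewrite (lintZ _ WfL) mulVf.
Qed.

Let Tq x : bso k u v q x = - q x.
Proof.
have WfL : L1 (fun y => green k x y * (W y * f y)).
  apply: (L1_bM (meas2_sec2 x (meas2_green k)) (fun y => green_le x y k0)).
  rewrite (_ : (fun x => _) = (fun x => f x * W x)); first exact: bdd_L1 bf WL.
  by apply/funext => y; exact: mulrC.
rewrite /q bso_real (_ : (fun y => _) = (fun y => c0 * (green k x y * (W y * f y)))); last first.
  by apply/funext => y; rewrite -uv; ring.
rewrite (lintZ _ WfL) -rmorphN; congr (_%:C); rewrite [f x]fE /=; ring.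
Qed.

Variable A : (R -> R[i]) -> R -> R[i].
Hypothesis AE : forall g, L2 g -> A g = (fun x => bso k u v g x - inner p g * q x).

Lemma birman_schwinger_det : trace_class A /\ forall e n, orthonormal_basis e ->
  ccvg (exterior_trace A e n) (jost_coef k w n - \sum_(m < n) jost_coef k w m)%:C.
Proof.
have TL g (gL : L2 g) := (L2_bso k0 WL mu mv u2 v2 gL).1.
have Tb g (gL : L2 g) := (L2_bso k0 WL mu mv u2 v2 gL).2.
have TD g h x (gL : L2 g) (hL : L2 h) := bsoD u k0 WL mv v2 x gL hL.
have TZ c g x (gL : L2 g) := bsoZ u k0 WL mv v2 c x gL.
have TS I r G x (GL : forall i : I, L2 (G i)) := bso_sum u k0 WL mv v2 r x GL.
have XL := L2_hglu k0 WL mu u2; have YL := L2_hglv k0 WL mv v2.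
have Xn t := norm2_hgl k t u2; have Yn t := norm2_hgl k t v2.
have oL := L1_hgw k0 WL mu u2.
have TXY a b (aL : L2 a) (bL : L2 b) := inner_bso k0 WL mu mv u2 v2 aL bL.
have KT0 : 0 <= norm2 (fun x => (u x)%:C) * ((2 * k)^-1 * norm2 (fun y => (v y)%:C)).
  by rewrite mulr_ge0 ?norm2_ge0 // mulr_ge0 ?norm2_ge0 // invr_ge0 mulr_ge0 // ltW.
split; first exact: (factored_trace_class TL TD TZ Tb XL YL Xn Yn oL TXY pL qL AE).
move=> e n be; rewrite rmorphB rmorph_sum /=.
exact: (exterior_trace_limit TL TS TD TZ Tb KT0 XL YL Xn Yn oL TXY (F := F) (erefl _) trace_limop pL qL AE Tq pq n be).
Qed.

End BirmanSchwinger.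

Section Potential.
Context {R : realType} (V : R -> R) (Vinf : R).
Hypothesis WL : L1 (potW V Vinf).

Lemma measL_potv : measL (potv V Vinf).
Proof.
apply: (@measL_comp R (fun y => Num.sqrt y)); last exact: measL_norm (L1_measL WL).
by apply: continuous_measurable_fun; exact: sqrt_continuous.
Qed.

Lemma measL_potu : measL (potu V Vinf).
Proof.
rewrite (_ : potu V Vinf = (fun x => if potW V Vinf x <= 0 then - potv V Vinf x else potv V Vinf x)).
  exact: measL_if_le (L1_measL WL) (measL_cst 0) (measL_N measL_potv) measL_potv.
apply/funext => x; rewrite /potu /potv; case: ltgtP => [h|h|->].
- by rewrite ltr0_sg // mulN1r.
- by rewrite gtr0_sg // mul1r.
- by rewrite normr0 sqrtr0 mulr0 oppr0.
Qed.

Lemma potv_sqr x : potv V Vinf x ^+ 2 = `|potW V Vinf x|.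
Proof. by rewrite sqr_sqrtr. Qed.

Lemma potuM x : potu V Vinf x * potv V Vinf x = potW V Vinf x.
Proof. by rewrite /potu -mulrA -expr2 potv_sqr -numEsg. Qed.

Lemma potu_sqr x : potu V Vinf x ^+ 2 = `|potW V Vinf x|.
Proof.
rewrite /potu exprMn potv_sqr; case: (sgrP (potW V Vinf x)) => _.
- by rewrite mulr0.
- by rewrite expr1n mul1r.
- by rewrite sqrrN expr1n mul1r.
Qed.

End Potential.

(** A trivial kernel would be spanned by the zero function as well; the eigenvector supplied by the
    spectrum excludes this. *)
Lemma kernel_function_neq0 (R : realType) (V Psi0 : R -> R) :
  discrete_spectrum (schrodinger V) 0 -> spans_kernel V Psi0 -> exists x, Psi0 x != 0.
Proof.
move=> [_ _ [g gE g0] _] [_ span]; apply: contrapT => no.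
have Psi00 x : Psi0 x = 0 by apply/eqP/negP => /negP h; apply: no; exists x.
have E : (fun x => 0 * g x) = (fun=> 0) by apply/funext => x; rewrite mul0r.
have [c gc] := span g (eq_ind _ (schrodinger V g) gE _ E).
apply: g0; apply: ae_imp gc => x ->.
by rewrite Psi00 mulr0.
Qed.

Theorem theorem3p8 (R : realType) (V : R -> R) (Vinf : R)
    (mV : measurable_fun [set: lebT R] (V : lebT R -> R))
    (Vinf_gt0 : 0 < Vinf)
    (V_int : (leb R).-integrable setT (fun x => (V x - Vinf)%:E))
    (ev0 : discrete_spectrum (schrodinger V) 0)
    (Psi0 : R -> R) (hPsi0 : spans_kernel V Psi0)
    (s : side) (Psi psi : R -> R)
    (hPsi : jost_at_0 V Vinf s Psi)
    (hpsi : volterra_solution V Vinf s (fun x => - Psi x) psi) :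
  is_fredholm_det (fun f x => f x - P0 V Vinf Psi0 f x - K0 V Vinf f x)
    (-1 / (2 * Num.sqrt Vinf) *
       \int[leb R]_x ((V x - Vinf) * expR (side_sg s * Num.sqrt Vinf * x)
                        * psi x))%:C.
Proof.
have nz := kernel_function_neq0 ev0 hPsi0.
set k := Num.sqrt Vinf; have k0 : 0 < k by rewrite sqrtr_gt0.
have WL : L1 (potW V Vinf) by exact: V_int.
have wL : L1 (fun x => potW V Vinf x / (2 * k)).
  by rewrite (_ : (fun x => _) = (fun x => (2 * k)^-1 * potW V Vinf x)); [exact: L1_Z|apply/funext => x; exact: mulrC].
have [PL _ [ac df acd eqn] _] := hPsi0.1.
have [[mf f2] _] := (L2P _).1 PL.
have eqf : {ae leb R, forall x : R, derivable (derive1 Psi0) x 1 /\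
    0 = - derive1 (derive1 Psi0) x + (potW V Vinf x + k ^+ 2) * Psi0 x}.
  apply: ae_imp eqn => x [dd E]; split => //.
  by rewrite sqr_sqrtr ?(ltW Vinf_gt0) // /potW subrK; exact: E.
have bf : bdd Psi0.
  have [M fM] := eigenfunction_bounded k0 WL mf f2 df acd eqf.
  by split => //; exists M => x; case: (fM x).
have fE := eigenfunction_green k0 WL mf f2 ac df acd eqf.
have I0 := eigenfunction_energy k0 WL mf f2 ac df acd eqf nz.
have Fs := eigenfunction_jost_sum k0 WL mf f2 ac df acd eqf nz.
(* [is_fredholm_det] concerns the operator minus the identity, here - P0 - K0: [bso] minus a rank
   one term, with the normalization of P0 put into q. *)
pose A (f : R -> R[i]) x := f x - P0 V Vinf Psi0 f x - K0 V Vinf f x - f x.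
have AE g : L2 g -> A g = (fun x => bso k (potu V Vinf) (potv V Vinf) g x -
    inner (fun x => (potv V Vinf x * Psi0 x)%:C) g *
    ((lint (fun x => potW V Vinf x * Psi0 x ^+ 2))^-1 * (potu V Vinf x * Psi0 x))%:C).
  move=> gL; apply/funext => x.
  have K0E : K0 V Vinf g x = - bso k (potu V Vinf) (potv V Vinf) g x.
    have gvL := rL2_bM (meas2_sec2 x (meas2_green k)) (fun y => green_le x y k0)
      (rL2_sqrtabs WL (measL_potv WL) (potv_sqr V Vinf)).
    rewrite /bso -mulNr -rmorphN -(cintZ _ (cL1_rL2M gvL gL)); apply: cint_ext => y.
    have E (a b c : R) (z : R[i]) : (a * b * c)%:C * z = a%:C * ((b * c)%:C * z).
      by rewrite mulrA -rmorphM /= mulrA.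
    exact: E.
  have P0E : P0 V Vinf Psi0 g x = inner (fun x => (potv V Vinf x * Psi0 x)%:C) g *
    ((lint (fun x => potW V Vinf x * Psi0 x ^+ 2))^-1 * (potu V Vinf x * Psi0 x))%:C.
    have E (a b : R) (z : R[i]) : a%:C * z * b%:C = z * (a * b)%:C by rewrite rmorphM /= mulrA (mulrC z).
    by rewrite inner_realE; exact: E.
  rewrite /A K0E P0E; move: (bso _ _ _ _ _) (inner _ _ * _) (g x) => *; ring.
have [tc et] := birman_schwinger_det k0 WL (measL_potu WL) (measL_potv WL) (potu_sqr V Vinf)
  (potv_sqr V Vinf) (potuM V Vinf) bf fE I0 AE.
split; first exact: tc.
move=> e be; eexists; split; first by move=> n; exact: (et e n be).
(* Conjugation turns the inhomogeneity e^(-+kx) of the Jost equation into 1. *)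
have e1 x : expR (side_sg s * k * x) * expR (- side_sg s * k * x) = 1 by rewrite -expRD !mulNr addrN expR0.
have y1 x : expR (side_sg s * k * x) * Psi x = 1 +
    vop k (fun x => potW V Vinf x / (2 * k)) (is_plus s) (fun x => expR (side_sg s * k * x) * Psi x) x.
  by rewrite -[X in X + _](e1 x); exact: (volterra_vop Vinf_gt0 WL x hPsi).
have y2 x : expR (side_sg s * k * x) * psi x = - (expR (side_sg s * k * x) * Psi x) +
    vop k (fun x => potW V Vinf x / (2 * k)) (is_plus s) (fun x => expR (side_sg s * k * x) * psi x) x.
  by rewrite -mulrN; exact: (volterra_vop Vinf_gt0 WL x hpsi).
have js := jost_series k0 wL (volterra_bdd hPsi) (volterra_bdd hpsi) y1 y2 Fs.
have -> : (fun n => \sum_(i < n) (jost_coef k (fun x => potW V Vinf x / (2 * k)) i -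
    \sum_(m < i) jost_coef k (fun x => potW V Vinf x / (2 * k)) m)%:C) =
  (fun n => (\sum_(i < n) (jost_coef k (fun x => potW V Vinf x / (2 * k)) i -
    \sum_(m < i) jost_coef k (fun x => potW V Vinf x / (2 * k)) m))%:C).
  by apply/funext => n; rewrite rmorph_sum.
apply: ccvg_real; rewrite (_ : -1 / _ * _ = - lint (fun z => potW V Vinf z / (2 * k) * (expR (side_sg s * k * z) * psi z))).
  exact: js.
have L : L1 (fun x => (V x - Vinf) * expR (side_sg s * k * x) * psi x).
  rewrite (_ : (fun x => _) = (fun x => expR (side_sg s * k * x) * psi x * potW V Vinf x)).
    exact: bdd_L1 (volterra_bdd hpsi) WL.
  by apply/funext => x; rewrite /potW; ring.
apply: (eq_trans (esym (lintZ (-1 / (2 * k)) L))); rewrite -lintN.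
  by congr lint; apply/funext => x; rewrite /potW; ring.
rewrite (_ : (fun x => _) = (fun x => expR (side_sg s * k * x) * psi x * (potW V Vinf x / (2 * k)))).
  exact: bdd_L1 (volterra_bdd hpsi) wL.
by apply/funext => x; exact: mulrC.
Qed.
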